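(* Let $\mathbb{K}$ be a field, $G$ a simple graph on $[n]$, $S=\mathbb{K}[x_1,\ldots,x_n,y_1,\ldots,y_n]$ and $\mathcal{I}_G=(x_ix_j-y_iy_j:\{i,j\}\in E(G))$. Then $S/\mathcal{I}_G$ has a pure resolution if and only if $G$ is one of the following: (1) a complete bipartite graph; (2) a disjoint union of some odd cycles and some paths.
   Context: For a homogeneous ideal $I\subset S$ all of whose minimal generators have the same degree, $S/I$ has a pure resolution if for each $1\leq i\leq \operatorname{pd}(S/I)$ there is a unique $d_i>0$ with $\beta^S_{i,d_i}(S/I)\neq 0$ (graded Betti numbers, standard grading).
   Formalization: In (1), ''a complete bipartite graph'' is read as a complete bipartite graph together with any number of isolated vertices of [n]; without this the claim fails, e.g. for K_{1,3} plus an isolated vertex, which has a pure resolution. *)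

(* Defs.v *)
From HB Require Import structures.
From mathcomp Require Import all_boot all_order all_algebra.
From mathcomp Require Import mpoly.
Set Implicit Arguments. Unset Strict Implicit. Unset Printing Implicit Defensive.
Import Order.TTheory GRing.Theory.
Local Open Scope ring_scope.

Definition simple_graph (n : nat) (e : rel 'I_n) : Prop :=
  ssrbool.symmetric e /\ ssrbool.irreflexive e.

(* G is a complete bipartite graph K_{a,b} (a,b >= 1): the edges are
   exactly the pairs between two disjoint nonempty vertex sets A and B
   (vertices outside A :|: B are isolated). *)
Definition complete_bipartite (n : nat) (e : rel 'I_n) : Prop :=
  exists A B : {set 'I_n},
    [/\ [disjoint A & B], A != set0, B != set0 &
        forall x y, e x y = ((x \in A) && (y \in B)) || ((x \in B) && (y \in A))].

Definition consec (n : nat) (s : seq 'I_n) (x y : 'I_n) : bool :=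
  has (fun k => ((nth x s k == x) && (nth x s k.+1 == y))
             || ((nth x s k == y) && (nth x s k.+1 == x)))
      (iota 0 (size s).-1).

Definition component (n : nat) (e : rel 'I_n) (v : 'I_n) : {set 'I_n} :=
  [set u | connect e v u].

Definition is_path_on (n : nat) (e : rel 'I_n) (C : {set 'I_n}) : Prop :=
  exists s : seq 'I_n,
    [/\ uniq s, C =i s &
        forall x y, x \in C -> y \in C -> e x y = consec s x y].

Definition is_odd_cycle_on (n : nat) (e : rel 'I_n) (C : {set 'I_n}) : Prop :=
  exists s : seq 'I_n,
    [/\ uniq s, C =i s, (3 <= size s)%N, odd (size s) &
        forall x y, x \in C -> y \in C ->
          e x y = consec (rcons s (head x s)) x y].

Definition union_odd_cycles_paths (n : nat) (e : rel 'I_n) : Prop :=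
  forall v : 'I_n,
    is_path_on e (component e v) \/ is_odd_cycle_on e (component e v).

Definition xv (K : fieldType) (n : nat) (i : 'I_n) : {mpoly K[n + n]} :=
  'X_(lshift n i).
Definition yv (K : fieldType) (n : nat) (i : 'I_n) : {mpoly K[n + n]} :=
  'X_(rshift n i).

Definition bgen (K : fieldType) (n : nat) (i j : 'I_n) : {mpoly K[n + n]} :=
  xv K i * xv K j - yv K i * yv K j.

Definition in_IG (K : fieldType) (n : nat) (e : rel 'I_n)
    (p : {mpoly K[n + n]}) : Prop :=
  exists q : 'I_n -> 'I_n -> {mpoly K[n + n]},
    p = \sum_(i < n) \sum_(j < n | e i j) q i j * bgen K i j.

(* Graded Betti numbers via Koszul homology:
   beta_{i,j}(S/I) = dim_K Tor_i^S(S/I, K)_j = dim_K H_i(x; S/I)_j,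
   where K(x;S) is the Koszul complex on all 2n variables (standard
   grading, e_A of degree |A|).  A Koszul chain is a family of
   coefficients c A, indexed by subsets A of the variables.             *)

Definition kchain (K : fieldType) (k : nat) := {ffun {set 'I_k} -> {mpoly K[k]}}.

(* Koszul differential: d(e_A) = sum_{t in A} (-1)^{#{s in A | s < t}} x_t e_{A\t} *)
Definition kdiff (K : fieldType) (k : nat) (c : kchain K k) : kchain K k :=
  [ffun B : {set 'I_k} =>
     \sum_(t : 'I_k | t \notin B)
        (-1) ^+ #|[set s in B | (s < t)%N]| * 'X_t * c (t |: B)].

Definition kbideg (K : fieldType) (k : nat) (i j : nat) (c : kchain K k) : Prop :=
  forall A, c A <> 0 -> [/\ #|A| = i, (i <= j)%N & c A \is (j - i)%N.-homog].

(* Koszul homology of S/I_G, in bidegree (i,j), is nonzero, i.e.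
   beta_{i,j}(S/I_G) <> 0: there is a chain with coefficients read modulo
   I_G which is a cycle but not a boundary. *)
Definition betti_nz (K : fieldType) (n : nat) (e : rel 'I_n) (i j : nat) : Prop :=
  exists c : kchain K (n + n),
    [/\ kbideg i j c,
        (forall B, in_IG e (kdiff c B)) &
        ~ (exists c' : kchain K (n + n),
             kbideg i.+1 j c' /\ forall A, in_IG e (c A - kdiff c' A))].

Definition is_pd (K : fieldType) (n : nat) (e : rel 'I_n) (p : nat) : Prop :=
  (exists j, betti_nz K e p j) /\ (forall i j, (p < i)%N -> ~ betti_nz K e i j).

Definition pure_resolution (K : fieldType) (n : nat) (e : rel 'I_n) : Prop :=
  forall p, is_pd K e p ->
    forall i, (1 <= i <= p)%N ->
      exists! d, (0 < d)%N /\ betti_nz K e i d.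

(* Main.v *)
(** Graded Betti numbers are read off the Koszul homology of [S/I].

    If [f] is a quadric regular modulo [I], it acts as zero on Koszul homology, so
    [H_i(S/(I,f))_j] is an extension of [H_(i-1)(S/I)_(j-2)] by [H_i(S/I)_j]. After exchanging
    [x] and [y] at every other vertex, the generators of a path are the adjacent 2-minors
    [u_i v_(i+1) - v_i u_(i+1)], and they form a regular sequence which stays regular when
    [u_1 u_k - v_1 v_k] is added; for odd [k] this is the edge that closes the cycle. Hence
    disjoint unions of paths and odd cycles are complete intersections, with
    [beta_(i,j) <> 0] only for [j = 2i].

    For a complete bipartite graph on [A] and [B] the ideal is the intersection of the ideal of
    2-minors on [A :|: B] with the variable ideals of [A] and of [B], which gives regularity 2.
    The generators have no linear syzygy, so [beta_(i,i+1) = 0] for [i >= 2] and [beta_i] lives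
    in degree [i+2]. Nonvanishing up to the projective dimension is rigidity of Koszul homology.

    Conversely, a vertex of degree 3 or a 4-cycle gives [beta_(3,5) <> 0], while an induced
    triangle, 4-vertex path, or 3-vertex path plus a disjoint edge gives [beta_(3,6) <> 0];
    a graph with a vertex of degree 2 avoiding the latter is complete bipartite. Without the former,
    components are paths and cycles, and an even cycle of length [k >= 6] has the minimal
    syzygy [sum_a m_a f_a = 0], [m_a] the product of the [u_l] off the edge [a], so that
    [beta_(2,k) <> 0] besides [beta_(2,4) <> 0]. *)

Require Import Defs.
From HB Require Import structures.
From mathcomp Require Import all_boot all_order all_algebra.
From mathcomp Require Import mpoly ring.
From Stdlib Require Import Classical.
Set Implicit Arguments. Unset Strict Implicit. Unset Printing Implicit Defensive.
Import GRing.Theory.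
Local Open Scope ring_scope.

(** No free resolution is built. Vanishing of a Koszul homology group is the lifting statement [hz],
    and each exact sequence is a chase with explicit chains, so that ideals stay predicates on the
    polynomial ring. Classical logic turns a failure of [hz] into a nonzero Betti number.

    Induced subgraphs suffice for nonvanishing because setting the variables of all other vertices
    to zero is a retraction of the Koszul complexes.

    For odd cycles the obstacle is the closing edge: the regularity of the path generators alone
    does not give that of the closing form, so the induction carries the variables of both end
    vertices.

    In the converse, homological degree 3 decides. Three generators forming a complete intersection
    on an induced subgraph give beta_(3,6); a linear relation among syzygies with quadratic entries
    gives beta_(3,5); purity forbids having both. The 4-cycle must be treated in this way, since for
    k = 4 the long syzygy of the even cycle lies in degree 4 and does not contradict beta_(2,4). *)

Lemma rmorph_mpoly_eq (K : fieldType) (k : nat) (A : comNzRingType)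
    (f g : {rmorphism {mpoly K[k]} -> A}) :
  (forall c, f c%:MP = g c%:MP) -> (forall t, f 'X_t = g 'X_t) -> f =1 g.
Proof.
move=> fgC fgX p; rewrite (mpolyE p) !raddf_sum; apply: eq_bigr => m _ /=.
rewrite -mul_mpolyC !rmorphM /= fgC mpolyXE_id !rmorph_prod; congr (_ * _).
by apply: eq_bigr => i _; rewrite !rmorphXn /= fgX.
Qed.

(** * Substitution by zero and division by a variable *)

Section Poly.
Variables (K : fieldType) (k : nat).
Local Notation S := {mpoly K[k]}.
Implicit Types (p q f : S) (t s : 'I_k) (D : {set 'I_k}).

Lemma mpolyX_neq0 (m : 'X_{1..k}) : 'X_[m] != 0 :> S.
Proof.
apply/negP => /eqP /(congr1 (mcoeff m)).
by rewrite mcoeffX eqxx mcoeff0 => /eqP; rewrite oner_eq0.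
Qed.

Lemma dhomogU t : ('X_t : S) \is 1.-homog.
Proof. by rewrite dhomogX /= mdeg1. Qed.

Lemma pihomogM d e f p : f \is d.-homog ->
  pihomog mdeg e (f * p) = if (d <= e)%N then f * pihomog mdeg (e - d)%N p else 0.
Proof.
move=> hf; rewrite {1}(pihomog_partitionE (mf:=mdeg) (leqnn (msize p))).
rewrite mulr_sumr raddf_sum /=.
have E (i : nat) : pihomog mdeg e (f * pihomog mdeg i p) =
    if (d + i == e)%N then f * pihomog mdeg i p else 0.
  have h : f * pihomog mdeg i p \is (d + i).-homog.
    by apply: dhomogM => //; apply: pihomogP.
  by case: eqP => [<-|/eqP ne]; [rewrite pihomog_dE | rewrite (pihomog_ne0 ne)].
under eq_bigr do rewrite E.
case: leqP => [led|lted]; last first.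
  by apply: big1 => i _; case: eqP => // Ee; move: lted; rewrite -Ee ltnNge leq_addr.
have Ei (i : nat) : (d + i == e)%N = (i == e - d)%N.
  by rewrite -(subnKC led) eqn_add2l subnKC.
under eq_bigr do rewrite Ei.
case: (ltnP (e - d) (msize p)) => [lt|ge].
  rewrite (bigD1 (Ordinal lt)) //= eqxx big1 ?addr0 // => i.
  by rewrite -val_eqE /= => /negbTE ->.
rewrite big1 => [|i _]; last first.
  by case: eqP => // Ee; move: (ltn_ord i); rewrite Ee ltnNge ge.
rewrite pihomogE big_seq_cond big1 ?mulr0 // => m /andP[mp /eqP Em].
by move: (msize_mdeg_lt mp); rewrite /= Em ltnNge ge.
Qed.

Definition ev D : S -> S :=
  mmap (@mpolyC k K) (fun t => if t \in D then 0 else 'X_t).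
HB.instance Definition _ D := GRing.RMorphism.on (ev D).

Lemma evC D c : ev D c%:MP = c%:MP.
Proof. by rewrite /ev mmapC. Qed.

Lemma evX D t : ev D 'X_t = if t \in D then 0 else 'X_t.
Proof. by rewrite /ev mmapX mmap1U. Qed.

Lemma evXm D (m : 'X_{1..k}) :
  ev D 'X_[m] = if [forall t in D, m t == 0%N] then 'X_[m] else 0.
Proof.
rewrite {1}mpolyXE_id rmorph_prod /=.
case: ifP => [/'forall_in_eqP m0|/negbT].
  rewrite mpolyXE_id; apply: eq_bigr => t _.
  by rewrite rmorphXn /= evX; case: ifP => // /m0 ->; rewrite !expr0.
rewrite negb_forall => /existsP[t]; rewrite negb_imply => /andP[tD mt].
by rewrite (bigD1 t) //= rmorphXn /= evX tD expr0n (negbTE mt) mul0r.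
Qed.

Lemma evE D p : ev D p =
  \sum_(m <- msupp p) p@_m *: (if [forall t in D, m t == 0%N] then 'X_[m] else 0).
Proof.
rewrite {1}(mpolyE p) raddf_sum; apply: eq_bigr => m _ /=.
by rewrite -mul_mpolyC rmorphM /= evC evXm mul_mpolyC.
Qed.

Lemma ev_dhomog D d p : p \is d.-homog -> ev D p \is d.-homog.
Proof.
move=> hp; rewrite evE big_seq; apply: rpred_sum => m mp; apply: rpredZ.
by case: ifP; rewrite ?rpred0 // dhomogX (dhomog_mf hp mp) eqxx.
Qed.

Lemma mcoeff_ev D p (m : 'X_{1..k}) : (forall t, t \in D -> m t = 0%N) -> (ev D p)@_m = p@_m.
Proof.
move=> m0; rewrite evE [in RHS](mpolyE p) !raddf_sum; apply: eq_bigr => m' _ /=.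
rewrite !mcoeffZ; congr (_ * _); rewrite mcoeffX.
case: ifP => [_|/negP h]; first by rewrite mcoeffX.
rewrite mcoeff0; case: eqP => // E; case: h; apply/'forall_in_eqP => t.
by rewrite E; apply: m0.
Qed.

Lemma ev_ev D D' p : ev D (ev D' p) = ev (D :|: D') p.
Proof.
apply: (rmorph_mpoly_eq (f := ev D \o ev D') (g := ev (D :|: D'))) => [c|t] /=.
  by rewrite !evC.
rewrite !evX inE; case: ifP => _; rewrite ?rmorph0 ?orbT //.
by rewrite evX orbF.
Qed.

(* The quotient of [p - p|_(X_t = 0)] by [X_t], see [mulX_del]. *)
Definition del t p : S := \sum_(m <- msupp p)
  p@_m *: (if (0 < m t)%N then 'X_[(m - U_(t))%MM] else 0).

Lemma mulX_del t p : 'X_t * del t p = p - ev [set t] p.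
Proof.
rewrite evE {2}(mpolyE p) /del mulr_sumr -sumrB; apply: eq_bigr => m _.
rewrite -scalerAr -scalerBr; congr (_ *: _).
have -> : [forall s in [set t], m s == 0%N] = ~~ (0 < m t)%N.
  rewrite -eqn0Ngt; apply/'forall_in_eqP/eqP => [/(_ t (set11 t))|m0 s] //.
  by rewrite inE => /eqP->.
case: ltnP => h /=; last by rewrite mulr0 subrr.
rewrite subr0 -mpolyXD; congr 'X_[_]; apply/mnmP => s.
rewrite mnmDE mnmBE subnKC // mnm1E; case: eqP => // <- //.
Qed.

Lemma ev1X t : ev [set t] 'X_t = 0.
Proof. by rewrite evX set11. Qed.

(** [mulX_del] determines [del] after cancellation of [X_t], so identities for [del] reduce to
    identities for [ev]. *)
Lemma Xreg t : GRing.lreg ('X_t : S).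
Proof. by apply/lregP; rewrite mpolyX_neq0. Qed.

Fact del_zmod t : zmod_morphism (del t).
Proof.
by move=> p q; apply: (@Xreg t); rewrite mulrBr !mulX_del rmorphB /=; ring.
Qed.
HB.instance Definition _ t := GRing.isZmodMorphism.Build S S (del t) (del_zmod t).

Lemma delX t p : del t ('X_t * p) = p.
Proof.
by apply: (@Xreg t); rewrite mulX_del rmorphM /= ev1X mul0r subr0.
Qed.

Lemma delM t f p : ev [set t] f = f -> del t (f * p) = f * del t p.
Proof.
move=> fE; apply: (@Xreg t).
by rewrite mulrCA !mulX_del rmorphM /= fE; ring.
Qed.

Lemma delXs s t p : s != t -> del t ('X_s * p) = 'X_s * del t p.
Proof. by move=> st; rewrite delM // evX inE (negbTE st). Qed.

Lemma del_dhomog t d p : p \is d.+1.-homog -> del t p \is d.-homog.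
Proof.
move=> hp; rewrite /del big_seq; apply: rpred_sum => m mp; apply: rpredZ.
case: ltnP; rewrite ?rpred0 // => m0; rewrite dhomogX /=.
have tm : (U_(t) <= m)%MM.
  by apply/mnm_lepP => s; rewrite mnm1E; case: eqP => // <-.
have := dhomog_mf hp mp; rewrite /= -{1}(submK tm) mdegD mdeg1 addn1.
by move=> [->].
Qed.

Lemma del_dhomog0 t p : p \is 0.-homog -> del t p = 0.
Proof.
move=> hp; rewrite /del big_seq big1 // => m mp.
have /eqP := dhomog_mf hp mp; rewrite /= mdeg_eq0 => /eqP ->.
by rewrite mnm0E scaler0.
Qed.

End Poly.

(** * Koszul complexes *)

Section Koszul.
Variables (K : fieldType) (k : nat).
Local Notation S := {mpoly K[k]}.
Local Notation C := {ffun {set 'I_k} -> S}.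
Implicit Types (p q : S) (c : C) (t s : 'I_k) (A B V D : {set 'I_k}).

Definition sg t A : S := (-1) ^+ #|[set s in A | (s < t)%N]|.

Lemma sgU s t B : t \notin B -> sg s (t |: B) = (-1) ^+ (t < s)%N * sg s B.
Proof.
move=> tB; rewrite /sg -exprD; congr (_ ^+ _).
rewrite -!sum1dep_card (bigID (pred1 t)) /=; congr (_ + _)%N.
  have [lt|ge] := ltnP t s.
    rewrite (big_pred1 t) // => r; rewrite /= !inE.
    by case: eqP => [->|]; rewrite ?lt ?andbF.
  rewrite big_pred0 // => r; rewrite !inE.
  by case: eqP => [->|]; rewrite ?andbF // ltnNge ge.
apply: eq_bigl => r; rewrite !inE.
by case: (eqVneq r t) => [->|]; rewrite ?(negbTE tB) ?andbF ?andbT.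
Qed.

Lemma sgD1 t A : sg t (A :\ t) = sg t A.
Proof.
rewrite /sg; congr (_ ^+ _); apply: eq_card => r; rewrite !inE.
by case: (eqVneq r t) => [->|_]; rewrite ?ltnn ?andbF ?andbT.
Qed.

Lemma sgU1 t A : sg t (t |: A) = sg t A.
Proof.
rewrite /sg; congr (_ ^+ _); apply: eq_card => r; rewrite !inE.
by case: (eqVneq r t) => [->|_]; rewrite ?ltnn ?andbF ?andbT.
Qed.

Lemma sg_sq t A : sg t A * sg t A = 1.
Proof. by rewrite /sg -expr2 sqrr_sign. Qed.

(* Contraction with, and exterior product by, the basis vector [e_t]. *)
Definition iot t c : C := [ffun B : {set 'I_k} => if t \in B then 0 else sg t B * c (t |: B)].
Definition ext t c : C := [ffun A : {set 'I_k} => if t \in A then sg t A * c (A :\ t) else 0].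
Definition cm q c : C := [ffun A : {set 'I_k} => q * c A].
Definition cmap (h : S -> S) c : C := [ffun A : {set 'I_k} => h (c A)].
(* The Koszul differential on the variables in [V] only; rigidity needs partial complexes. *)
Definition kd V c : C := \sum_(t in V) cm 'X_t (iot t c).

Lemma kdiffE c : kdiff c = kd setT c.
Proof.
apply/ffunP => B; rewrite /kd sum_ffunE ffunE big_mkcond /=.
apply: eq_big => [t|t _]; first by rewrite inE.
by rewrite !ffunE; case: (t \in B); rewrite ?mulr0 //= mulrA; congr (_ * _); rewrite mulrC.
Qed.

Fact iot_zmod t : zmod_morphism (iot t).
Proof.
move=> c c'; apply/ffunP => A; rewrite !ffunE.
by case: ifP => _; rewrite ?subr0 // mulrBr.
Qed.
HB.instance Definition _ t := GRing.isZmodMorphism.Build C C (iot t) (iot_zmod t).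

Fact ext_zmod t : zmod_morphism (ext t).
Proof.
move=> c c'; apply/ffunP => A; rewrite !ffunE.
by case: ifP => _; rewrite ?subr0 // mulrBr.
Qed.
HB.instance Definition _ t := GRing.isZmodMorphism.Build C C (ext t) (ext_zmod t).

Fact cm_zmod q : zmod_morphism (cm q).
Proof. by move=> c c'; apply/ffunP => A; rewrite !ffunE mulrBr. Qed.
HB.instance Definition _ q := GRing.isZmodMorphism.Build C C (cm q) (cm_zmod q).

Fact cmap_zmod (h : {additive S -> S}) : zmod_morphism (cmap h).
Proof. by move=> c c'; apply/ffunP => A; rewrite !ffunE raddfB. Qed.
HB.instance Definition _ (h : {additive S -> S}) :=
  GRing.isZmodMorphism.Build C C (cmap h) (cmap_zmod h).

Fact kd_zmod V : zmod_morphism (kd V).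
Proof.
by move=> c c'; rewrite /kd -sumrB; apply: eq_bigr => t _; rewrite !raddfB.
Qed.
HB.instance Definition _ V := GRing.isZmodMorphism.Build C C (kd V) (kd_zmod V).

(** Together with [iot_ext] and [iot_iot], these are the anticommutation relations of the exterior
    algebra. They contain the sign computations from which the square-zero and homotopy identities
    of [kd] follow formally. *)
Lemma ext_iot t c : iot t (ext t c) + ext t (iot t c) = c.
Proof.
apply/ffunP => A; rewrite !ffunE setU11 sgU1; case: ifP => tA.
  by rewrite setD11 sgD1 add0r mulrA sg_sq mul1r setD1K.
by rewrite addr0 mulrA sg_sq mul1r setU1K ?tA.
Qed.

Lemma signlt (s t : 'I_k) : s != t ->
  (-1) ^+ (s < t)%N * (-1) ^+ (t < s)%N = -1 :> S.
Proof.
rewrite neq_ltn => /orP[] lt; rewrite lt ltnNge (ltnW lt).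
  by rewrite expr0 expr1 mulr1.
by rewrite expr0 expr1 mul1r.
Qed.

Lemma iot_ext s t c : s != t -> iot s (ext t c) = - ext t (iot s c).
Proof.
move=> st; apply/ffunP => A; rewrite !ffunE !inE (eq_sym t s) (negbTE st) /=.
case sA: (s \in A); case tA: (t \in A); rewrite ?mulr0 ?oppr0 //.
have -> : (s |: A) :\ t = s |: (A :\ t).
  apply/setP => r; rewrite !inE; case: (eqVneq r t) => [->|] //=.
  by rewrite orbF eq_sym (negbTE st).
rewrite sgU ?sA // -{1}(setD1K tA) (@sgU s t); last by rewrite setD11.
transitivity ((-1) ^+ (s < t)%N * (-1) ^+ (t < s)%N *
   (sg s (A :\ t) * sg t A * c (s |: A :\ t))); first by ring.
by rewrite signlt //; ring.
Qed.

Lemma iot_iot s t c : s != t -> iot s (iot t c) = - iot t (iot s c).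
Proof.
move=> st; apply/ffunP => A; rewrite !ffunE !inE (eq_sym t s) (negbTE st) /=.
case sA: (s \in A); case tA: (t \in A); rewrite ?mulr0 ?oppr0 //.
rewrite !sgU ?sA ?tA // setUCA.
suff -> : (-1) ^+ (s < t)%N = - (-1) ^+ (t < s)%N :> S by ring.
have sq (b : bool) : (-1) ^+ b * (-1) ^+ b = 1 :> S by rewrite -expr2 sqrr_sign.
transitivity ((-1) ^+ (s < t)%N * (-1) ^+ (t < s)%N * (-1) ^+ (t < s)%N : S).
  by rewrite -mulrA sq mulr1.
by rewrite signlt // mulN1r.
Qed.

Lemma iot_iot0 t c : iot t (iot t c) = 0.
Proof.
by apply/ffunP => A; rewrite !ffunE; case: ifP => //; rewrite setU11 mulr0.
Qed.

Lemma iot_cm t q c : iot t (cm q c) = cm q (iot t c).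
Proof.
by apply/ffunP => A; rewrite !ffunE; case: ifP => _; rewrite ?mulr0 // mulrCA.
Qed.

Lemma ext_cm t q c : ext t (cm q c) = cm q (ext t c).
Proof.
by apply/ffunP => A; rewrite !ffunE; case: ifP => _; rewrite ?mulr0 // mulrCA.
Qed.

Lemma cmA p q c : cm p (cm q c) = cm (p * q) c.
Proof. by apply/ffunP => A; rewrite !ffunE mulrA. Qed.

Lemma cm_kd V q c : kd V (cm q c) = cm q (kd V c).
Proof.
rewrite /kd raddf_sum; apply: eq_bigr => t _ /=; rewrite iot_cm.
by rewrite !cmA mulrC.
Qed.

Lemma kd_iot V t c : kd V (iot t c) = - iot t (kd V c).
Proof.
rewrite /kd raddf_sum -sumrN; apply: eq_bigr => s _ /=; rewrite iot_cm.
case: (eqVneq s t) => [->|st]; first by rewrite iot_iot0 raddf0 oppr0.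
by rewrite iot_iot // raddfN.
Qed.

(** Cartan formula: exterior multiplication by [e_t] is a null-homotopy of multiplication by
    [X_t]. *)
Lemma kd_ext V t c : t \in V -> kd V (ext t c) = cm 'X_t c - ext t (kd V c).
Proof.
move=> tV; rewrite /kd !(bigD1 t tV) /= raddfD /=.
rewrite ext_cm -{3}(ext_iot t c) raddfD /= raddf_sum.
have -> : \sum_(s in V | s != t) cm 'X_s (iot s (ext t c)) =
   - \sum_(s in V | s != t) ext t (cm 'X_s (iot s c)).
  rewrite -sumrN; apply: eq_bigr => s /andP[_ st].
  by rewrite iot_ext // raddfN ext_cm.
by rewrite opprD addrA [in RHS]addrK.
Qed.

Lemma kd_extN V t c : t \notin V -> kd V (ext t c) = - ext t (kd V c).
Proof.
move=> tV; rewrite /kd raddf_sum -sumrN; apply: eq_bigr => s sV /=.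
have st : s != t by apply: contraNneq tV => <-.
by rewrite iot_ext // raddfN ext_cm.
Qed.

Lemma kdU1 V t c : t \notin V -> kd (t |: V) c = cm 'X_t (iot t c) + kd V c.
Proof. by move=> tV; rewrite /kd big_setU1. Qed.

Lemma kd0 c : kd set0 c = 0.
Proof. by rewrite /kd big_set0. Qed.

Lemma kd_kd V c : kd V (kd V c) = 0.
Proof.
elim: {V}#|V| {-2}V (erefl #|V|) c => [|m IH] V.
  by move=> /cards0_eq-> c; rewrite kd0.
move=> cV c; have /card_gt0P[t tV] : (0 < #|V|)%N by rewrite cV.
have tV' : t \notin V :\ t by rewrite setD11.
have cV' : #|V :\ t| = m by move: cV; rewrite (cardsD1 t) tV => -[].
rewrite -(setD1K tV) !kdU1 // (raddfD (kd (V :\ t))) /= (IH _ cV') addr0.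
rewrite (raddfD (iot t)) /= iot_cm iot_iot0 raddf0 add0r cm_kd kd_iot raddfN.
by rewrite subrr.
Qed.

End Koszul.

Section Pointwise.
Variables (T : finType) (R : nzRingType).
Implicit Types (c : {ffun T -> R}) (x : T).
Lemma cDE c c' x : (c + c') x = c x + c' x. Proof. by rewrite ffunE. Qed.
Lemma cNE c x : (- c) x = - c x. Proof. by rewrite ffunE. Qed.
Lemma c0E x : (0 : {ffun T -> R}) x = 0. Proof. by rewrite ffunE. Qed.
End Pointwise.

Ltac cring := apply/ffunP => ?; rewrite ?(cDE, cNE, c0E); ring.

(** * Bidegrees, graded ideals and contractions of the Koszul complex *)

Section Degree.
Variables (K : fieldType) (k : nat).
Local Notation S := {mpoly K[k]}.
Local Notation C := {ffun {set 'I_k} -> S}.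
Implicit Types (p q : S) (c : C) (t s : 'I_k) (A B V D : {set 'I_k}).

(** Pointwise form of [kbideg], with zero allowed everywhere, so that closure under sums comes from
    the additive predicate structure. *)
Definition kb i j A : {pred S} := fun p =>
  if (#|A| == i) && (i <= j)%N then p \is (j - i).-homog else p == 0.

Lemma kbE i j A p : (p \in kb i j A) =
  if (#|A| == i) && (i <= j)%N then p \is (j - i).-homog else p == 0.
Proof. by []. Qed.

Lemma kbidegP i j c : kbideg i j c <-> forall A, c A \in kb i j A.
Proof.
split=> [h A|h A /eqP nz].
  rewrite kbE; case: (eqVneq (c A) 0) => [->|/eqP nz]; first by rewrite rpred0 if_same.
  by have [-> -> ->] := h A nz; rewrite eqxx.
have := h A; rewrite kbE; case: ifP => [/andP[/eqP-> ->] //|_].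
by rewrite (negbTE nz).
Qed.

Fact kb_zmod i j A : zmod_closed (kb i j A).
Proof.
split=> [|p q]; rewrite !kbE; case: ifP => _; rewrite ?rpred0 ?eqxx //.
  exact: rpredB.
by move=> /eqP-> /eqP->; rewrite subr0.
Qed.
HB.instance Definition _ i j A := GRing.isZmodClosed.Build S (kb i j A) (kb_zmod i j A).

Lemma kbideg0 i j : kbideg i j (0 : C).
Proof. by apply/kbidegP => A; rewrite ffunE rpred0. Qed.

Lemma kbidegD i j c c' : kbideg i j c -> kbideg i j c' -> kbideg i j (c + c').
Proof. by move=> /kbidegP h /kbidegP h'; apply/kbidegP => A; rewrite ffunE rpredD. Qed.

Lemma kbidegN i j c : kbideg i j c -> kbideg i j (- c).
Proof. by move=> /kbidegP h; apply/kbidegP => A; rewrite ffunE rpredN. Qed.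

Lemma kbidegB i j c c' : kbideg i j c -> kbideg i j c' -> kbideg i j (c - c').
Proof. by move=> h h'; apply: kbidegD => //; apply: kbidegN. Qed.

Lemma kbideg_sum (T : finType) (P : pred T) i j (F : T -> C) :
  (forall x, P x -> kbideg i j (F x)) -> kbideg i j (\sum_(x | P x) F x).
Proof.
move=> h; elim/big_rec: _ => [|x c Px hc]; first exact: kbideg0.
by apply: kbidegD => //; apply: h.
Qed.

Lemma kbideg_cm i j d q c : q \is d.-homog -> kbideg i j c -> kbideg i (d + j) (cm q c).
Proof.
move=> hq h A; rewrite ffunE => nz.
have nzc : c A <> 0 by move=> E; apply: nz; rewrite E mulr0.
have [-> le hc] := h A nzc; split=> //; first exact: leq_trans (leq_addl _ _).
by rewrite -addnBA //; apply: dhomogM.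
Qed.

Lemma kbideg_cmX i j t c : kbideg i j c -> kbideg i j.+1 (cm 'X_t c).
Proof. by move=> h; apply: (@kbideg_cm _ _ 1) => //; apply: dhomogU. Qed.

Lemma sgM_dhomog d t A p : p \is d.-homog -> sg K t A * p \is d.-homog.
Proof. by move=> h; rewrite /sg -signr_odd mulr_sign; case: ifP; rewrite ?rpredN. Qed.

Lemma kbideg_iot i j t c : kbideg i.+1 j.+1 c -> kbideg i j (iot t c).
Proof.
move=> h A; rewrite ffunE; case: ifP => // /negbT tA nz.
have nzc : c (t |: A) <> 0 by move=> E; apply: nz; rewrite E mulr0.
have [cA le hc] := h _ nzc; split=> //; last by rewrite subSS in hc; apply: sgM_dhomog.
by move: cA; rewrite cardsU1 tA add1n => -[].
Qed.

Lemma kbideg_ext i j t c : kbideg i j c -> kbideg i.+1 j.+1 (ext t c).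
Proof.
move=> h A; rewrite ffunE; case: ifP => // tA nz.
have nzc : c (A :\ t) <> 0 by move=> E; apply: nz; rewrite E mulr0.
have [cA le hc] := h _ nzc; split=> //; last by rewrite subSS; apply: sgM_dhomog.
by rewrite (cardsD1 t) tA cA.
Qed.

Lemma kbideg_gt i j c : (j < i)%N -> kbideg i j c -> c = 0.
Proof.
move=> lt h; apply/ffunP => A; rewrite ffunE; apply: NNPP => nz.
by have [_ + _] := h A nz; rewrite leqNgt lt.
Qed.

Lemma kbideg_del i j t c : kbideg i j.+1 c -> kbideg i j (cmap (del t) c).
Proof.
move=> h A; rewrite ffunE => nz.
have nzc : c A <> 0 by move=> E; apply: nz; rewrite E raddf0.
have [-> le hc] := h A nzc; move: le; rewrite leq_eqVlt => /orP[/eqP Ei|le].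
  by case: nz; apply: del_dhomog0; move: hc; rewrite Ei subnn.
by split=> //; apply: del_dhomog; rewrite -subSn.
Qed.

Lemma kbideg_hdel i j t c : kbideg i j c -> kbideg i.+1 j (ext t (cmap (del t) c)).
Proof.
case: j => [|j] h; last by apply: kbideg_ext; apply: kbideg_del.
suff -> : cmap (del t) c = 0 by rewrite raddf0; apply: kbideg0.
apply/ffunP => A; rewrite !ffunE; apply: NNPP => nz.
have nzc : c A <> 0 by move=> E; apply: nz; rewrite E raddf0.
have [_ _] := h A nzc; rewrite sub0n => /del_dhomog0 h0.
by apply: nz; rewrite h0.
Qed.

Lemma kbideg_kd V i j c : kbideg i.+1 j c -> kbideg i j (kd V c).
Proof.
case: j => [|j] h.
  by rewrite (kbideg_gt _ h) // raddf0; apply: kbideg0.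
by apply: kbideg_sum => t _; apply: kbideg_cmX; apply: kbideg_iot.
Qed.

Lemma kbideg0_kd V j c : kbideg 0 j c -> kd V c = 0.
Proof.
move=> h; rewrite /kd big1 // => t _; apply/ffunP => A; rewrite !ffunE.
case: ifP => [|/negbT tA]; rewrite ?mulr0 //.
suff -> : c (t |: A) = 0 by rewrite !mulr0.
by apply: NNPP => nz; have [+ _ _] := h _ nz; rewrite cardsU1 tA.
Qed.

Lemma ltn_card_kbideg i j c : (k < i)%N -> kbideg i j c -> c = 0.
Proof.
move=> lt h; apply/ffunP => A; rewrite ffunE; apply: NNPP => nz.
have [cA _ _] := h A nz; have := max_card (mem A).
by rewrite card_ord leqNgt cA lt.
Qed.

(** [hiH] allows a membership to be cut down to the degree at hand; this is what keeps lifted chains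
    bihomogeneous. *)
Record hideal (I : S -> Prop) : Prop := HIdeal {
  hi0 : I 0;
  hiD : forall p q, I p -> I q -> I (p + q);
  hiM : forall p q, I q -> I (p * q);
  hiH : forall d p, I p -> I (pihomog mdeg d p) }.

Definition inC (I : S -> Prop) c := forall A, I (c A).

Section Ideal.
Variables (I : S -> Prop) (hI : hideal I).

Lemma hiN p : I p -> I (- p).
Proof. by rewrite -mulN1r; apply: hiM. Qed.

Lemma hiB p q : I p -> I q -> I (p - q).
Proof. by move=> Ip Iq; apply: hiD => //; apply: hiN. Qed.

Lemma hiMr p q : I p -> I (p * q).
Proof. by rewrite mulrC; apply: hiM. Qed.

Lemma hi_sum (T : finType) (P : pred T) (F : T -> S) :
  (forall x, P x -> I (F x)) -> I (\sum_(x | P x) F x).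
Proof. by move=> h; elim/big_rec: _ => [|x p Px]; [apply: hi0 | apply: hiD; auto]. Qed.

Lemma inC0 : inC I 0. Proof. by move=> A; rewrite ffunE; apply: hi0. Qed.
Lemma inCD c c' : inC I c -> inC I c' -> inC I (c + c').
Proof. by move=> h h' A; rewrite ffunE; apply: hiD. Qed.
Lemma inCN c : inC I c -> inC I (- c).
Proof. by move=> h A; rewrite ffunE; apply: hiN. Qed.
Lemma inCB c c' : inC I c -> inC I c' -> inC I (c - c').
Proof. by move=> h h'; apply: inCD => //; apply: inCN. Qed.
Lemma inC_sum (T : finType) (P : pred T) (F : T -> C) :
  (forall x, P x -> inC I (F x)) -> inC I (\sum_(x | P x) F x).
Proof. by move=> h; elim/big_rec: _ => [|x p Px]; [apply: inC0 | apply: inCD; auto]. Qed.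
Lemma inC_cm q c : inC I c -> inC I (cm q c).
Proof. by move=> h A; rewrite ffunE; apply: hiM. Qed.
Lemma inC_iot t c : inC I c -> inC I (iot t c).
Proof. by move=> h A; rewrite ffunE; case: ifP => _; [apply: hi0 | apply: hiM]. Qed.
Lemma inC_ext t c : inC I c -> inC I (ext t c).
Proof. by move=> h A; rewrite ffunE; case: ifP => _; [apply: hiM | apply: hi0]. Qed.
Lemma inC_kd V c : inC I c -> inC I (kd V c).
Proof. by move=> h; apply: inC_sum => t _; apply: inC_cm; apply: inC_iot. Qed.
Lemma inC_cmap (f : S -> S) c : (forall p, I p -> I (f p)) -> inC I c -> inC I (cmap f c).
Proof. by move=> hf h A; rewrite ffunE; apply: hf. Qed.

End Ideal.

Local Notation d := (kd (setT : {set 'I_k})).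

(* [H_i(S/I)] vanishes in total degree [j]. *)
Definition hz (I : S -> Prop) i j := forall c, kbideg i j c -> inC I (d c) ->
  exists2 b, kbideg i.+1 j b & inC I (c - d b).

Lemma hz_ext I J i j : (forall p, I p <-> J p) -> hz I i j -> hz J i j.
Proof.
move=> E h c kc dc; have [|b kb bE] := h c kc; first by move=> A; apply/E.
by exists b => // A; apply/E.
Qed.

Lemma hz_gt I i j : hideal I -> (j < i)%N -> hz I i j.
Proof.
move=> hI lt c /(kbideg_gt lt) -> _; exists 0; first exact: kbideg0.
by rewrite raddf0 subrr; apply: inC0.
Qed.

Lemma hz_card I i j : hideal I -> (k < i)%N -> hz I i j.
Proof.
move=> hI lt c /(ltn_card_kbideg lt) -> _; exists 0; first exact: kbideg0.
by rewrite raddf0 subrr; apply: inC0.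
Qed.

(* Holds when [I] is generated by polynomials not involving [X_t]. *)
Definition xfree (I : S -> Prop) t := forall p, I p -> I (del t p).

(** [del t] commutes with the summands of [d] at the other variables. On the summand of [t],
    removing [X_t] is exact on the left but loses the part at [X_t = 0] on the right, which is the
    correction term. *)
Lemma cmap_del_kd t c :
  cmap (del t) (d c) = d (cmap (del t) c) + cmap (ev [set t]) (iot t c).
Proof.
rewrite /kd !(bigD1 t (in_setT t)) /= raddfD raddf_sum /= addrAC; congr (_ + _).
  apply/ffunP => A; rewrite !ffunE; case: ifP => _; first by rewrite !(mulr0, raddf0, addr0).
  rewrite delX /sg -signr_odd !mulr_sign; case: ifP => _; rewrite ?(rmorphN, raddfN) /=.
    by rewrite mulrN mulX_del; ring.
  by rewrite mulX_del; ring.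
apply: eq_bigr => s st; apply/ffunP => A; rewrite !ffunE delXs //.
  by case: ifP => _; rewrite ?raddf0 // /sg raddfMsign.
by case/andP: st.
Qed.

(** The projection onto the Koszul complex in the variables outside [D]: both the polynomial
    variables and the basis vectors of [D] are sent to zero. *)
Definition phi D c : C := [ffun A : {set 'I_k} => if [disjoint A & D] then ev D (c A) else 0].

(* [ext t \o del t] contracts the Koszul complex onto its part free of [X_t] and [e_t]; this
   works in every characteristic, unlike the Euler homotopy. *)
Lemma homotopy t c :
  d (ext t (cmap (del t) c)) + ext t (cmap (del t) (d c)) = c - phi [set t] c.
Proof.
rewrite kd_ext ?inE // cmap_del_kd raddfD /= addrA subrK.
apply/ffunP => A; rewrite !ffunE mulX_del setD11.
rewrite disjoint_sym disjoints1; case: ifP => tA /=; last by rewrite addr0.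
rewrite sgD1 setD1K // subr0 /sg -signr_odd !mulr_sign.
by case: (odd _); rewrite ?rmorphN /=; ring.
Qed.

Fact phi_zmod D : zmod_morphism (phi D).
Proof.
move=> c c'; apply/ffunP => A; rewrite !ffunE.
by case: ifP => _; rewrite ?subr0 // rmorphB.
Qed.
HB.instance Definition _ D := GRing.isZmodMorphism.Build C C (phi D) (phi_zmod D).

Lemma phi0 c : phi set0 c = c.
Proof.
apply/ffunP => A; rewrite ffunE -setI_eq0 setI0 eqxx.
apply: (rmorph_mpoly_eq (f := ev set0) (g := idfun)) => [a|t] /=; first exact: evC.
by rewrite evX inE.
Qed.

Lemma phiU1 t D c : phi (t |: D) c = phi [set t] (phi D c).
Proof.
apply/ffunP => A; rewrite !ffunE -!setI_eq0 setIUr setU_eq0.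
by case: (A :&: D == set0); case: (A :&: [set t] == set0); rewrite ?rmorph0 // ev_ev.
Qed.

Lemma phi_phi D c : phi D (phi D c) = phi D c.
Proof. by apply/ffunP => A; rewrite !ffunE; case: [disjoint _ & _] => //; rewrite ev_ev setUid. Qed.

Lemma phi_kd D c : d (phi D c) = phi D (d c).
Proof.
apply/ffunP => A; rewrite !ffunE !sum_ffunE rmorph_sum /=.
case: ifP => dA.
  apply: eq_bigr => t _; rewrite !ffunE rmorphM /= evX.
  have -> : [disjoint t |: A & D] = (t \notin D).
    rewrite -setI_eq0 setIUl setU_eq0 !setI_eq0 dA andbT disjoints1 //.
  case: (t \in A); rewrite ?rmorph0 ?mulr0 //.
  by case: (t \in D) => /=; rewrite ?mulr0 ?mul0r // rmorphM /sg rmorphXn rmorphN1.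
apply: big1 => t _; rewrite !ffunE; case: (t \in A); rewrite ?mulr0 //.
have -> : [disjoint t |: A & D] = false; last by rewrite !mulr0.
by rewrite -setI_eq0 setIUl setU_eq0 !setI_eq0 dA andbF.
Qed.

Lemma kbideg_phi i j D c : kbideg i j c -> kbideg i j (phi D c).
Proof.
move=> h A; rewrite ffunE; case: ifP => // _ nz.
have nzc : c A <> 0 by move=> E; apply: nz; rewrite E raddf0.
by have [-> le hc] := h A nzc; split=> //; apply: ev_dhomog.
Qed.

Lemma free_ev I t p : hideal I -> xfree I t -> I p -> I (ev [set t] p).
Proof.
move=> hI fI Ip; have -> : ev [set t] p = p - 'X_t * del t p.
  by rewrite mulX_del subKr.
by apply: hiB => //; apply: hiM => //; apply: fI.
Qed.

(** The contractions of [homotopy] are composed over the variables of [D]. The second term of each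
    homotopy stays in [I], because [d c] does and [xfree] makes [I] stable under [del t]. *)
Lemma phi_homologous I i j D c : hideal I -> (forall t, t \in D -> xfree I t) ->
  kbideg i j c -> inC I (d c) ->
  exists2 b, kbideg i.+1 j b & inC I (c - phi D c - d b).
Proof.
move=> hI; elim: {D}#|D| {-2}D (erefl #|D|) => [|m IH] D.
  move=> /cards0_eq-> _ _ _; exists 0; first exact: kbideg0.
  by rewrite phi0 subrr raddf0 subrr; apply: inC0.
move=> cD fD kc dc; have /card_gt0P[t tD] : (0 < #|D|)%N by rewrite cD.
have cD' : #|D :\ t| = m by move: cD; rewrite (cardsD1 t) tD => -[].
have [|b kb bE] := IH _ cD' _ kc dc; first by move=> s /setD1P[_]; apply: fD.
set c' := phi (D :\ t) c in bE; have kc' : kbideg i j c' by apply: kbideg_phi.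
have dc' : inC I (d c').
  have -> : c' = c - ((c - c' - d b) + d b) by rewrite subrK subKr.
  rewrite raddfB raddfD /= kd_kd addr0; apply: inCB => //; exact: inC_kd.
exists (b + ext t (cmap (del t) c')).
  by apply: kbidegD => //; apply: kbideg_hdel.
rewrite -(setD1K tD) phiU1 -/c'.
have := homotopy t c'; set x := d _; set y := ext t _; set z := phi _ _ => E.
have -> : c - z - d (b + ext t (cmap (del t) c')) = (c - c' - d b) + y.
  rewrite raddfD /= -/x -[z](subKr c') -E; cring.
apply: inCD => //; apply: inC_ext => //; apply: inC_cmap => // p Ip.
exact: fD.
Qed.

(** With [D] the set of all variables, [phi] keeps only the constant term of the coefficient of the
    empty set, which lives in bidegree (0, 0). *)
Lemma koszul_exact i j : (i, j) != (0, 0)%N -> hz (fun p => p = 0) i j.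
Proof.
move=> ij c kc dc.
have hI : hideal (fun p : S => p = 0).
  split=> // [p q -> ->|p q ->|e p ->]; by rewrite ?addr0 ?mulr0 ?raddf0.
have fI t : t \in [set: 'I_k] -> xfree (fun p : S => p = 0) t.
  by move=> _ p ->; rewrite raddf0.
have [b kb bE] := phi_homologous hI fI kc dc; exists b => //.
suff E : phi setT c = 0 by move: bE; rewrite E subr0.
apply/ffunP => A; rewrite !ffunE -setI_eq0 setIT; case: eqP => // ->.
apply: NNPP => nz; have nzc : c set0 <> 0 by move=> E; apply: nz; rewrite E raddf0.
have [] := kc _ nzc; rewrite cards0 => i0 _ hc; apply: nz.
rewrite evE big_seq big1 // => m mp; case: ifP => [/'forall_in_eqP m0|_]; last first.
  by rewrite scaler0.
have md : mdeg m = 0%N by rewrite mdegE big1 // => t _; apply: m0; rewrite inE.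
have := dhomog_mf hc mp; rewrite /= md -i0 subn0 => j0.
by move: ij; rewrite -i0 -j0.
Qed.

(** The projection S/I -> S/J followed by [ev D] : S/J -> S/I acts as the identity on Koszul
    homology by [phi_homologous], so the homology of S/I is a direct summand of that of S/J. *)
Lemma hz_transfer (I J : S -> Prop) D i j : hideal I -> hideal J ->
  (forall t, t \in D -> xfree I t) -> (forall p, I p -> J p) ->
  (forall p, J p -> I (ev D p)) -> hz J i j -> hz I i j.
Proof.
move=> hI hJ fD IJ JI hz c kc dc; have [b kb bE] := phi_homologous hI fD kc dc.
have [||b' kb' b'E] := hz (phi D c); first exact: kbideg_phi.
  by move=> A; rewrite phi_kd ffunE; case: ifP => _; [apply/IJ/JI/IJ/dc | apply: hi0].
exists (b + phi D b'); first by apply: kbidegD => //; apply: kbideg_phi.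
have -> : c - d (b + phi D b') = (c - phi D c - d b) + phi D (phi D c - d b').
  by rewrite raddfB /= phi_phi raddfD /= phi_kd; cring.
apply: inCD => // A; rewrite ffunE; case: ifP => _; [apply: JI; exact: b'E | exact: hi0].
Qed.

End Degree.

(** * Long exact sequences, regularity and rigidity *)

Section LES.
Variables (K : fieldType) (k : nat).
Local Notation S := {mpoly K[k]}.
Local Notation C := {ffun {set 'I_k} -> S}.
Local Notation d := (kd (setT : {set 'I_k})).
Implicit Types (p q f g : S) (c : C) (t s : 'I_k) (A B V D : {set 'I_k}) (I J : S -> Prop).

Lemma ev_setT e p : p \is e.+1.-homog -> ev setT p = 0.
Proof.
move=> hp; rewrite evE big_seq big1 // => m mp; case: ifP => [/'forall_in_eqP m0|_].
  have := dhomog_mf hp mp; rewrite /= mdegE big1 // => t _.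
  by apply: m0; rewrite inE.
by rewrite scaler0.
Qed.

Lemma sub_ev_decomp e D p : p \is e.+1.-homog -> exists g : 'I_k -> S,
  (forall t, g t \is e.-homog) /\ p - ev D p = \sum_t 'X_t * g t.
Proof.
move=> hp; elim: {D}#|D| {-2}D (erefl #|D|) => [|m IH] D.
  move=> /cards0_eq->; exists (fun=> 0); split=> [t|]; first exact: rpred0.
  rewrite big1 => [|t _]; last by rewrite mulr0.
  suff -> : ev set0 p = p by rewrite subrr.
  have := phi0 [ffun A : {set 'I_k} => p] => /(congr1 (fun c : C => c set0)).
  by rewrite !ffunE -setI_eq0 setI0 eqxx.
move=> cD; have /card_gt0P[t tD] : (0 < #|D|)%N by rewrite cD.
have cD' : #|D :\ t| = m by move: cD; rewrite (cardsD1 t) tD => -[].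
have [g [hg gE]] := IH _ cD'.
exists (fun s => g s + (if s == t then del t (ev (D :\ t) p) else 0)); split=> [s|].
  by rewrite rpredD //; case: eqP => _; rewrite ?rpred0 ?del_dhomog ?ev_dhomog.
under eq_bigr do rewrite mulrDr.
rewrite big_split /= -gE (bigD1 t) //= eqxx mulX_del ev_ev setD1K //.
rewrite big1 => [|s /negbTE ->]; last by rewrite mulr0.
by rewrite addr0 addrA subrK.
Qed.

Lemma homog_decomp e p : p \is e.+1.-homog -> exists g : 'I_k -> S,
  (forall t, g t \is e.-homog) /\ p = \sum_t 'X_t * g t.
Proof.
move=> hp; have [g [hg gE]] := sub_ev_decomp setT hp; exists g; split=> //.
by rewrite -gE (ev_setT hp) subr0.
Qed.

Definition addI I f p := exists q, I (p - q * f).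
Definition capI I J p := I p /\ J p.
Definition sumI I J p := exists a, I a /\ J (p - a).
(* [f] is a nonzerodivisor on [S/I]. *)
Definition reg I f := forall p, I (f * p) -> I p.
(* [S/I] has Castelnuovo-Mumford regularity at most [r]. *)
Definition regle r I := forall i j, (i + r < j)%N -> hz I i j.

Lemma addI_sub I f p : hideal I -> I p -> addI I f p.
Proof. by move=> hI Ip; exists 0; rewrite mul0r subr0. Qed.

Lemma addI_gen I f q : hideal I -> addI I f (q * f).
Proof. by move=> hI; exists q; rewrite subrr; apply: hi0. Qed.

Lemma hideal_addI I f e : f \is e.-homog -> hideal I -> hideal (addI I f).
Proof.
move=> hf hI; split.
- by exists 0; rewrite mul0r subr0; apply: hi0.
- move=> p q [a Ia] [b Ib]; exists (a + b).
  by have := hiD hI Ia Ib; congr I; ring.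
- move=> p q [a Ia]; exists (p * a).
  by have := hiM hI p Ia; congr I; ring.
- move=> e' p [a Ia]; have := hiH hI e' Ia.
  rewrite raddfB /= mulrC (pihomogM e' a hf); case: ifP => _ h.
    by exists (pihomog mdeg (e' - e)%N a); rewrite mulrC.
  by exists 0; rewrite mul0r.
Qed.

Lemma hideal_capI I J : hideal I -> hideal J -> hideal (capI I J).
Proof.
move=> hI hJ; split.
- by split; apply: hi0.
- by move=> p q [Ip Jp] [Iq Jq]; split; apply: hiD.
- by move=> p q [Iq Jq]; split; apply: hiM.
- by move=> e p [Ip Jp]; split; apply: hiH.
Qed.

Lemma hideal_sumI I J : hideal I -> hideal J -> hideal (sumI I J).
Proof.
move=> hI hJ; split.
- by exists 0; rewrite subrr; split; apply: hi0.
- move=> p q [a [Ia Ja]] [b [Ib Jb]]; exists (a + b); split; first exact: hiD.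
  by have := hiD hJ Ja Jb; congr J; ring.
- move=> p q [a [Ia Ja]]; exists (p * a); split; first exact: hiM.
  by rewrite -mulrBr; apply: hiM.
- move=> e p [a [Ia Ja]]; exists (pihomog mdeg e a); split; first exact: hiH.
  by rewrite -raddfB; apply: hiH.
Qed.

(** Cofactors of [f] can be replaced by their homogeneous components of the expected degree. The
    case [j < e] is separate because [j - e] is a truncated subtraction. *)
Lemma addI_lift I f e i j c : hideal I -> f \is e.-homog -> kbideg i j c ->
  inC (addI I f) c -> exists w : C, [/\ inC I (c - cm f w),
    (j < e)%N -> w = 0 & (e <= j)%N -> kbideg i (j - e) w].
Proof.
move=> hI hf kc ic.
have H A : exists q, I (c A - f * q) /\ (q <> 0 ->
    [/\ #|A| = i, (i + e <= j)%N & q \is (j - e - i).-homog]).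
  case: (eqVneq (c A) 0) => [c0|/eqP nz].
    by exists 0; rewrite c0 mulr0 subrr; split=> //; apply: hi0.
  have [cA le hc] := kc A nz; have [q Iq] := ic A.
  have := hiH hI (j - i) Iq; rewrite raddfB /= pihomog_dE // mulrC (pihomogM _ q hf).
  case: leqP => [le'|lt] Iq'; last by exists 0; rewrite mulr0.
  exists (pihomog mdeg (j - i - e)%N q); split=> // _; split=> //.
    by rewrite -leq_subRL.
  by rewrite subnAC; apply: pihomogP.
have [w hw] := fin_all_exists H; exists [ffun A => w A]; split.
- by move=> A; rewrite !ffunE; have [] := hw A.
- move=> lt; apply/ffunP => A; rewrite !ffunE; apply: NNPP => nz.
  have [_ /(_ nz) [_ le _]] := hw A.
  by move: (leq_trans (leq_addl i e) le); rewrite leqNgt lt.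
- move=> le A; rewrite ffunE => nz; have [_ /(_ nz) [-> le' hq]] := hw A.
  by split=> //; rewrite leq_subRL // addnC.
Qed.

(** Middle exactness of the sequence of 0 -> S/I(-e) -> S/I -> S/(I,f) -> 0. Modulo [I], [d c] is
    [f w]; regularity of [f] makes [w] a cycle, a filling [w'] of it turns [c - f w'] into a cycle
    modulo [I]. *)
Lemma hz_addI I f e i j : hideal I -> f \is e.-homog -> reg I f -> hz I i j ->
  (forall i' j', i = i'.+1 -> j = (e + j')%N -> hz I i' j') -> hz (addI I f) i j.
Proof.
move=> hI hf rf; have hfI := hideal_addI hf hI.
case: i => [|i] h0 h1 c kc dc.
  have [|b kb bE] := h0 c kc; first by rewrite (kbideg0_kd _ kc); apply: inC0.
  by exists b => // A; apply: addI_sub.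
have [w [wE w0 kw]] := addI_lift hI hf (kbideg_kd (V:=setT) kc) dc.
have dw : inC I (d w).
  move=> A; apply: rf; have := inCN hI (inC_kd hI setT wE) A.
  by rewrite raddfB /= kd_kd sub0r opprK cm_kd ffunE.
have [w' kw' w'E] : exists2 w', kbideg i.+1 j (cm f w') & inC I (w - d w').
  case: (ltnP j e) => [lt|le].
    exists 0; first by rewrite raddf0; apply: kbideg0.
    by rewrite w0 // raddf0 subrr; apply: inC0.
  have [b kb bE] := h1 i (j - e)%N erefl (esym (subnKC le)) w (kw le) dw.
  by exists b => //; rewrite -(subnKC le); apply: kbideg_cm.
have [||b kb bE] := h0 (c - cm f w'); first exact: kbidegB.
  have -> : d (c - cm f w') = (d c - cm f w) + cm f (w - d w').
    by rewrite raddfB /= [cm f (w - _)]raddfB /= cm_kd; cring.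
  by apply: inCD => //; apply: inC_cm.
exists b => // A; exists (w' A); have := bE A.
by rewrite !cDE !cNE [cm f w' A]ffunE; congr I; ring.
Qed.

Section Homotopy.
Variables (g : 'I_k -> S).
(** Exterior product with the sum of the [g t e_t]. By [kd_wedge] it is a null-homotopy of
    multiplication by the sum of the [X_t g t], that is, by any given form of positive degree. *)
Definition wedge c : C := \sum_t ext t (cm (g t) c).

Lemma kd_wedge c : d (wedge c) + wedge (d c) = cm (\sum_t 'X_t * g t) c.
Proof.
rewrite /wedge raddf_sum -big_split /=.
transitivity (\sum_t cm ('X_t * g t) c).
  by apply: eq_bigr => t _; rewrite kd_ext ?inE // cm_kd subrK cmA.
apply/ffunP => A; rewrite sum_ffunE !ffunE mulr_suml.
by apply: eq_bigr => t _; rewrite ffunE.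
Qed.

Lemma inC_wedge I c : hideal I -> inC I c -> inC I (wedge c).
Proof. by move=> hI h; apply: inC_sum => // t _; apply: inC_ext => //; apply: inC_cm. Qed.

Lemma kbideg_wedge e i j c : (forall t, g t \is e.-homog) ->
  kbideg i j c -> kbideg i.+1 (e.+1 + j) (wedge c).
Proof. by move=> hg h; apply: kbideg_sum => t _; apply: kbideg_ext; apply: kbideg_cm. Qed.
End Homotopy.

(** Multiplication by [f] is null-homotopic, so passing to S/(I,f) is injective on homology: if
    [c - d b] is [f w] modulo [I], then [w] is a cycle and [f w] bounds [wedge g w]. *)
Lemma hz_addI_inj I f e i j : hideal I -> f \is e.+1.-homog -> reg I f ->
  hz (addI I f) i j -> hz I i j.
Proof.
move=> hI hf rf h c kc dc; have [g [hg gE]] := homog_decomp hf.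
have [|b kb bE] := h c kc; first by move=> A; apply: addI_sub.
have kcb : kbideg i j (c - d b) by apply: kbidegB => //; apply: kbideg_kd.
have [w [wE w0 kw]] := addI_lift hI hf kcb bE.
have dw : inC I (d w).
  move=> A; apply: rf; have := inCB hI dc (inC_kd hI setT wE) A.
  rewrite !raddfB /= kd_kd cm_kd !(cDE, cNE, c0E) ![cm _ _ _]ffunE.
  by congr I; ring.
exists (b + wedge g w).
  apply: kbidegD => //; case: (ltnP j e.+1) => [/w0 ->|le].
    rewrite /wedge big1 => [|t _]; last by rewrite !raddf0.
    exact: kbideg0.
  by rewrite -(subnKC le); apply: kbideg_wedge => //; apply: kw.
have -> : c - d (b + wedge g w) = (c - d b - cm f w) + wedge g (d w).
  by rewrite raddfD /= gE -kd_wedge; cring.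
by apply: inCD => //; apply: inC_wedge.
Qed.

(** The connecting map is onto: for a cycle [w], [wedge g w] is a cycle modulo (I,f) whose boundary
    is [f w]. If it bounds, up to some [f u], then applying [d] and cancelling [f] shows that [w]
    bounds [u]. *)
Lemma hz_addI_surj I f e i j : hideal I -> f \is e.+1.-homog -> reg I f ->
  hz (addI I f) i.+1 (e.+1 + j) -> hz I i j.
Proof.
move=> hI hf rf h w kw dw; have [g [hg gE]] := homog_decomp hf.
have dgw : d (wedge g w) = cm f w - wedge g (d w) by rewrite gE -kd_wedge addrK.
have [||b kb bE] := h (wedge g w); first exact: kbideg_wedge.
  rewrite dgw => A; rewrite cDE cNE ffunE mulrC.
  by exists (w A); rewrite addrC addKr; apply: (hiN hI); apply: inC_wedge.
have kcb : kbideg i.+1 (e.+1 + j) (wedge g w - d b).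
  by apply: kbidegB; [apply: kbideg_wedge | apply: kbideg_kd].
have [u [uE u0 ku]] := addI_lift hI hf kcb bE.
exists u; first by have := ku (leq_addr _ _); rewrite addKn.
move=> A; apply: rf; have := inCD hI (inC_kd hI setT uE) (inC_wedge g hI dw) A.
rewrite !raddfB /= kd_kd dgw cm_kd !(cDE, cNE, c0E) ![cm _ _ _]ffunE.
by congr I; ring.
Qed.

Lemma regle_mono r r' I : (r <= r')%N -> regle r I -> regle r' I.
Proof. by move=> le h i j lt; apply: h; apply: leq_ltn_trans lt; rewrite leq_add2l. Qed.

Lemma regle_ext r I J : (forall p, I p <-> J p) -> regle r I -> regle r J.
Proof. by move=> E h i j lt; apply: hz_ext E _; apply: h. Qed.

Lemma regle_top r I : hideal I ->
  (forall e p, (r < e)%N -> p \is e.-homog -> I p) -> regle r I.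
Proof.
move=> hI h i j lt c kc _; exists 0; first exact: kbideg0.
rewrite raddf0 subr0 => A; case: (eqVneq (c A) 0) => [->|/eqP nz]; first exact: hi0.
have [_ le hc] := kc A nz; apply: h hc.
by rewrite ltn_subRL.
Qed.

Lemma regle_addI r I f : hideal I -> f \is 1.-homog -> reg I f ->
  regle r (addI I f) -> regle r I.
Proof. by move=> hI hf rf h i j lt; apply: (hz_addI_inj hI hf rf); apply: h. Qed.

Lemma sumI_lift I J i j c : hideal I -> hideal J -> kbideg i j c ->
  inC (sumI I J) c -> exists u : C, [/\ kbideg i j u, inC I u & inC J (c - u)].
Proof.
move=> hI hJ kc ic.
have H A : exists q, [/\ q \in kb i j A, I q & J (c A - q)].
  case: (eqVneq (c A) 0) => [c0|/eqP nz].
    by exists 0; rewrite c0 subrr rpred0; split=> //; apply: hi0.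
  have [cA le hc] := kc A nz; have [q [Iq Jq]] := ic A.
  exists (pihomog mdeg (j - i)%N q); split.
  - by rewrite kbE cA eqxx le pihomogP.
  - exact: hiH.
  - by have := hiH hJ (j - i) Jq; rewrite raddfB /= pihomog_dE.
have [w hw] := fin_all_exists H; exists [ffun A => w A]; split.
- by apply/kbidegP => A; rewrite ffunE; have [] := hw A.
- by move=> A; rewrite ffunE; have [] := hw A.
- by move=> A; rewrite !ffunE; have [] := hw A.
Qed.

(** Mayer-Vietoris for the intersection and the sum of [I] and [J]. The connecting map raises the
    homological degree of S/(I+J), hence the stricter bound there. *)
Lemma regle_capI r I J : hideal I -> hideal J -> regle r.+1 I -> regle r.+1 J ->
  regle r (sumI I J) -> regle r.+1 (capI I J).
Proof.
move=> hI hJ rI rJ rIJ i j lt c kc dc.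
have [|a ka aE] := rI i j lt c kc; first by move=> A; have [] := dc A.
have [|b kb bE] := rJ i j lt c kc; first by move=> A; have [] := dc A.
have hIJ := hideal_sumI hI hJ.
have [|||x kx xE] := rIJ i.+1 j _ (a - b); first by rewrite addSnnS.
- exact: kbidegB.
- move=> A; exists (- (c A - d a A)); split; first by apply: hiN => //; have := aE A; rewrite cDE cNE.
  have := bE A; rewrite raddfB /= !cDE !cNE; congr J; ring.
have kabx : kbideg i.+1 j (a - b - d x).
  by apply: kbidegB; [apply: kbidegB | apply: kbideg_kd].
have [u [ku Iu Ju]] := sumI_lift hI hJ kabx xE.
(* Here [a - b - d x] splits as [u] in [I] plus a chain in [J], so [a - u] agrees with [a] modulo
   [I] and with [b + d x] modulo [J]. *)
exists (a - u); first exact: kbidegB.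
move=> A; split.
  have := inCD hI aE (inC_kd hI setT Iu) A.
  by rewrite raddfB /= !(cDE, cNE); congr I; ring.
have := inCB hJ bE (inC_kd hJ setT Ju) A.
by rewrite !raddfB /= kd_kd !(cDE, cNE, c0E); congr J; ring.
Qed.

End LES.

(** * Rigidity of Koszul homology *)

Section Rigidity.
Variables (K : fieldType) (k : nat).
Local Notation S := {mpoly K[k]}.
Local Notation C := {ffun {set 'I_k} -> S}.
Implicit Types (p q f g : S) (c : C) (t s : 'I_k) (A B V D : {set 'I_k}) (I J : S -> Prop).

(** Only the exterior part is confined to [V]; coefficients range over all polynomials. Thus [hzV V]
    concerns the Koszul homology of S/I on the variables of [V]. *)
Definition supp V c := forall A, ~~ (A \subset V) -> c A = 0.

Definition hzV V I i j := forall c, kbideg i j c -> supp V c -> inC I (kd V c) ->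
  exists b : C, [/\ kbideg i.+1 j b, supp V b & inC I (c - kd V b)].

Lemma suppD V c c' : supp V c -> supp V c' -> supp V (c + c').
Proof. by move=> h h' A AV; rewrite cDE h // h' // addr0. Qed.

Lemma suppN V c : supp V c -> supp V (- c).
Proof. by move=> h A AV; rewrite cNE h // oppr0. Qed.

Lemma supp_cm V q c : supp V c -> supp V (cm q c).
Proof. by move=> h A AV; rewrite ffunE h // mulr0. Qed.

Lemma suppW V t c : supp V c -> supp (t |: V) c.
Proof.
move=> h A AV; apply: h; apply: contra AV => AV.
exact: subset_trans AV (subsetUr _ _).
Qed.

Section Step.
Variables (V : {set 'I_k}) (t : 'I_k) (tV : t \notin V).

Lemma supp_iot c : supp (t |: V) c -> supp V (iot t c).
Proof.
move=> h A AV; rewrite ffunE; case: ifP => // /negbT tA; rewrite h ?mulr0 //.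
apply: contra AV => /subsetP sA; apply/subsetP => x xA.
have := sA x; rewrite !inE xA orbT => /(_ isT) /orP[/eqP E|//].
by move: tA; rewrite -E xA.
Qed.

Lemma supp_ext c : supp V c -> supp (t |: V) (ext t c).
Proof.
move=> h A AV; rewrite ffunE; case: ifP => // tA; rewrite h ?mulr0 //.
by apply: contra AV; rewrite subDset.
Qed.

Lemma supp_extU c : supp (t |: V) c -> supp (t |: V) (ext t c).
Proof.
move=> h A AV; rewrite ffunE; case: ifP => // tA; rewrite h ?mulr0 //.
by apply: contra AV; rewrite subDset setUA setUid.
Qed.

Lemma iot_supp c : supp V c -> iot t c = 0.
Proof.
move=> h; apply/ffunP => A; rewrite !ffunE; case: ifP => // _.
rewrite h ?mulr0 //; apply: contra tV => /subsetP; apply.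
by rewrite setU11.
Qed.

Lemma kdU_supp c : supp V c -> kd (t |: V) c = kd V c.
Proof. by move=> h; rewrite kdU1 // iot_supp // raddf0 add0r. Qed.

Variable I : S -> Prop.
Hypothesis hI : hideal I.

Lemma inC_kd_iot c : supp (t |: V) c -> inC I (kd (t |: V) c) -> inC I (kd V (iot t c)).
Proof.
move=> sc h; rewrite -kdU_supp; last exact: supp_iot.
by rewrite kd_iot; apply: inCN => //; apply: inC_iot.
Qed.

(* Nakayama by induction on [j]: vanishing of [H_i] on [t |: V] makes [X_t] surjective on [H_i]
   of [V]. *)
Lemma hzV_desc i : (forall j, hzV (t |: V) I i j) -> forall j, hzV V I i j.
Proof.
move=> hU; elim=> [|j IH] c kc sc dc.
  have [||b [kb sb bE]] := hU 0%N c kc; rewrite ?kdU_supp //; first exact: suppW.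
  have b0 : b = 0 by apply: kbideg_gt kb.
  exists 0; split; [exact: kbideg0 | by move=> A _; rewrite ffunE |].
  by move: bE; rewrite b0 !raddf0.
have [||b [kb sb bE]] := hU j.+1 c kc; rewrite ?kdU_supp //; first exact: suppW.
have db1 : inC I (kd V (iot t b)).
  rewrite -kdU_supp; last exact: supp_iot.
  have := inC_iot hI t bE; rewrite raddfB /= iot_supp // kd_iot sub0r; exact: id.
have [|||b' [kb' sb' b'E]] := IH (iot t b); [exact: kbideg_iot | exact: supp_iot | by [] |].
exists (iot t (ext t b) + cm 'X_t b'); split.
- apply: kbidegD; last exact: kbideg_cmX.
  by apply: kbideg_iot; apply: kbideg_ext.
- by apply: suppD; [apply/supp_iot/supp_extU | apply: supp_cm].
have -> : c - kd V (iot t (ext t b) + cm 'X_t b') =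
    (c - kd (t |: V) b) + cm 'X_t (iot t b - kd V b') - ext t (kd V (iot t b)).
  have := ext_iot t b => /(congr1 (kd V)); rewrite raddfD /= [kd V (ext _ _)]kd_extN //.
  move=> /eqP; rewrite subr_eq => /eqP E.
  by rewrite kdU1 // raddfD /= E cm_kd raddfB /=; cring.
by apply: inCB; [|apply: inCD => //; apply: inC_cm|apply: inC_ext].
Qed.

(** The exact sequence H_(i+1)(V) -> H_(i+1)(t |: V) -> H_i(V), whose second map is [iot t]. *)
Lemma hzV_up i : (forall j, hzV V I i j) -> (forall j, hzV V I i.+1 j) ->
  forall j, hzV (t |: V) I i.+1 j.
Proof.
move=> h0 h1 j c kc sc dc.
case: j kc => [|j] kc.
  rewrite (kbideg_gt _ kc) //; exists 0; split; [exact: kbideg0 | | ].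
    by move=> A _; rewrite ffunE.
  by rewrite raddf0 subrr; apply: inC0.
have [|||b [kb sb bE]] := h0 j (iot t c); [exact: kbideg_iot | exact: supp_iot |
  exact: inC_kd_iot |].
(* A filling [b] of [iot t c] removes the part of [c] involving [e_t]: modulo [I], [c] plus the
   boundary of [ext t b] equals [c'], which is supported on [V]. *)
pose c' := iot t (ext t c) + cm 'X_t b.
have kdb : kd (t |: V) (ext t b) = cm 'X_t b - ext t (kd V b).
  by rewrite kd_ext ?setU11 // kdU_supp.
have cE : c + kd (t |: V) (ext t b) - c' = ext t (iot t c - kd V b).
  by rewrite kdb /c' -{1}(ext_iot t c) raddfB /=; cring.
have icE : inC I (ext t (iot t c - kd V b)) by apply: inC_ext.
have sc' : supp V c' by apply: suppD; [apply/supp_iot/supp_extU | apply: supp_cm].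
have [||b' [kb' sb' b'E]] := h1 j.+1 c' _ sc'.
- apply: kbidegD; last exact: kbideg_cmX.
  by apply: kbideg_iot; apply: kbideg_ext.
- rewrite -kdU_supp //; have := inC_kd hI (t |: V) icE.
  rewrite -cE raddfB raddfD /= kd_kd addr0 => h.
  by have := inCB hI dc h; rewrite subKr.
exists (b' - ext t b); split.
- by apply: kbidegB => //; apply: kbideg_ext.
- by apply: suppD; [apply: suppW | apply/suppN/supp_ext].
have := inCD hI b'E icE; rewrite -cE raddfB /= (kdU_supp sb') => h A.
by have := h A; congr (I _); rewrite !(cDE, cNE); ring.
Qed.

End Step.

(** Induction on the number of variables: [hzV_desc] removes a variable in degree [i], the induction
    hypothesis climbs to [i.+1], and [hzV_up] restores the variable. *)
Lemma rigidV V I i : hideal I -> (forall j, hzV V I i j) -> forall j, hzV V I i.+1 j.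
Proof.
move=> hI; elim: {V}#|V| {-2}V (erefl #|V|) i => [|m IH] V.
  move=> /cards0_eq-> i _ j c kc sc _; exists 0; split; first exact: kbideg0.
    by move=> A _; rewrite ffunE.
  suff -> : c = 0 by rewrite raddf0 subrr; apply: inC0.
  apply/ffunP => A; rewrite ffunE; apply: NNPP => nz.
  have [+ _ _] := kc A nz; case: (boolP (A \subset set0)) => [|/sc //].
  by rewrite subset0 => /eqP->; rewrite cards0.
move=> cV i hV; have /card_gt0P[t tV] : (0 < #|V|)%N by rewrite cV.
have tV' : t \notin V :\ t by rewrite setD11.
have cV' : #|V :\ t| = m by move: cV; rewrite (cardsD1 t) tV => -[].
rewrite -(setD1K tV) in hV *; have h0 := hzV_desc tV' hI hV.
exact: hzV_up (IH _ cV' i h0).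
Qed.

Lemma koszul_rigid I i i' : hideal I -> (i <= i')%N ->
  (forall j, hz I i j) -> forall j, hz I i' j.
Proof.
move=> hI le h.
suff H : forall j, hzV setT I i' j.
  move=> j c kc dc; have [|b [kb _ bE]] := H j c kc _ dc; last by exists b.
  by move=> A; rewrite subsetT.
rewrite -(subnKC le); elim: (i' - i)%N => [|m IH].
  rewrite addn0 => j c kc _ dc; have [b kb bE] := h j c kc dc; exists b; split=> //.
  by move=> A; rewrite subsetT.
by rewrite addnS; apply: rigidV.
Qed.

End Rigidity.

(** * Ideals of quadrics and their syzygies *)

Section Quadrics.
Variables (K : fieldType) (k : nat).
Local Notation S := {mpoly K[k]}.
Local Notation C := {ffun {set 'I_k} -> S}.
Local Notation d := (kd (setT : {set 'I_k})).
Implicit Types (p q g : S) (c : C) (t s : 'I_k) (A B V D : {set 'I_k}) (I J : S -> Prop).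

Variables (F : finType) (f : F -> S).
Hypothesis hf : forall e, f e \is 2.-homog.

Definition genI p := exists q : F -> S, p = \sum_e q e * f e.

Lemma genI_hideal : hideal genI.
Proof.
split.
- by exists (fun=> 0); rewrite big1 // => e _; rewrite mul0r.
- move=> p q [a ->] [b ->]; exists (fun e => a e + b e).
  by rewrite -big_split; apply: eq_bigr => e _; rewrite mulrDl.
- move=> p q [a ->]; exists (fun e => p * a e).
  by rewrite mulr_sumr; apply: eq_bigr => e _; rewrite mulrA.
- move=> e p [a ->].
  exists (fun x => if (2 <= e)%N then pihomog mdeg (e - 2)%N (a x) else 0).
  rewrite raddf_sum; apply: eq_bigr => x _ /=; rewrite mulrC (pihomogM _ _ (hf x)).
  by case: ifP; rewrite ?mul0r // mulrC.
Qed.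

Lemma genI_lift i j c : kbideg i j c -> inC genI c ->
  exists w : F -> C, [/\ c = \sum_e cm (f e) (w e),
    (j < 2)%N -> forall e, w e = 0 & (2 <= j)%N -> forall e, kbideg i (j - 2) (w e)].
Proof.
move=> kc ic.
have H A : exists q : F -> S, c A = \sum_e f e * q e /\ (forall e, q e <> 0 ->
    [/\ #|A| = i, (i + 2 <= j)%N & q e \is (j - 2 - i).-homog]).
  case: (eqVneq (c A) 0) => [c0|/eqP nz].
    by exists (fun=> 0); split=> //; rewrite c0 big1 // => e _; rewrite mulr0.
  have [cA le hc] := kc A nz; have [q Iq] := ic A.
  have E : c A = \sum_e pihomog mdeg (j - i)%N (f e * q e).
    rewrite -[LHS](pihomog_dE hc) Iq raddf_sum; apply: eq_bigr => e _.
    by rewrite mulrC.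
  case: (leqP 2 (j - i)) => [le'|lt]; last first.
    exists (fun=> 0); split=> //; rewrite E; apply: eq_bigr => e _.
    by rewrite (pihomogM _ _ (hf e)) leqNgt lt mulr0.
  exists (fun e => pihomog mdeg (j - i - 2)%N (q e)); split.
    by rewrite E; apply: eq_bigr => e _; rewrite (pihomogM _ _ (hf e)) le'.
  by move=> e _; split=> //; [rewrite -leq_subRL | rewrite subnAC; apply: pihomogP].
have [w hw] := fin_all_exists H; exists (fun e => [ffun A => w A e]); split.
- apply/ffunP => A; rewrite sum_ffunE; have [-> _] := hw A.
  by apply: eq_bigr => e _; rewrite !ffunE.
- move=> lt e; apply/ffunP => A; rewrite !ffunE; apply: NNPP => nz.
  have [_ /(_ e nz) [_ le _]] := hw A.
  by move: (leq_trans (leq_addl i 2) le); rewrite leqNgt lt.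
- move=> le e A; rewrite ffunE => nz; have [_ /(_ e nz) [-> le' hq]] := hw A.
  by split=> //; rewrite leq_subRL // addnC.
Qed.

(** An honest cycle bounds by exactness of the Koszul complex of the polynomial ring, so it is
    enough that cycles modulo [I] are honest cycles. *)
Lemma hz_cycle0 I i j : hideal I -> (i, j) != (0, 0)%N ->
  (forall c, kbideg i j c -> inC I (d c) -> d c = 0) -> hz I i j.
Proof.
move=> hI ij h c kc dc; have := h c kc dc => E.
have [|b kb bE] := koszul_exact ij kc; first by move=> A; rewrite E ffunE.
by exists b => // A; rewrite bE; apply: hi0.
Qed.

Lemma exact_cycle i j c : (i, j) != (0, 0)%N -> kbideg i j c -> d c = 0 ->
  exists2 b : C, kbideg i.+1 j b & c = d b.
Proof.
move=> ij kc dc; have [|b kb bE] := koszul_exact ij kc.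
  by move=> A; rewrite dc ffunE.
exists b => //; apply/ffunP => A; have := bE A.
by rewrite cDE cNE => /eqP; rewrite subr_eq0 => /eqP.
Qed.

(** The boundary has linear coefficients, and an ideal generated by quadrics contains no nonzero
    linear form. *)
Lemma hz_diag i : hz genI i.+1 i.+1.
Proof.
apply: hz_cycle0 => //; first exact: genI_hideal.
move=> c kc dc; have [w [-> w0 kw]] := genI_lift (kbideg_kd (V:=setT) kc) dc.
rewrite big1 // => e _; suff -> : w e = 0 by rewrite raddf0.
case: (ltnP i.+1 2) => [lt|le]; first exact: w0.
by apply: kbideg_gt (kw le e); rewrite ltn_subLR // addnC addn2.
Qed.

(** In this degree the cofactors [w e] of [d c] have positive degree, so they bound chains [b e];
    subtracting the [f e b e], which lie in the ideal, leaves an honest cycle. *)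
Lemma hz_gens j : hz genI 1 j.+3.
Proof.
move=> c kc dc; have [w [wE _ kw]] := genI_lift (kbideg_kd (V:=setT) kc) dc.
have {}kw e : kbideg 0 j.+1 (w e) by have := kw isT e; rewrite subn2.
have H e : exists b : C, kbideg 1 j.+1 b /\ w e = d b.
  have [|b kb bE] := @exact_cycle 0 j.+1 (w e) isT (kw e); last by exists b.
  exact: kbideg0_kd (kw e).
have [b hb] := fin_all_exists H.
pose u := \sum_e cm (f e) (b e).
have du : d u = d c.
  rewrite wE raddf_sum; apply: eq_bigr => e _ /=; rewrite cm_kd.
  by have [_ <-] := hb e.
have [|||x kx xE] := @exact_cycle 1 j.+3 (c - u); rewrite ?raddfB /= ?du ?subrr //.
  apply: kbidegB => //; apply: kbideg_sum => e _.
  by apply: (@kbideg_cm _ _ _ _ 2) => //; have [] := hb e.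
exists x => //; rewrite -xE subKr => A; rewrite sum_ffunE.
apply: (hi_sum genI_hideal) => e _; rewrite ffunE.
apply: (hiMr genI_hideal); exists (fun e' => (e' == e)%:R).
rewrite (bigD1 e) //= eqxx mul1r big1 ?addr0 // => e' /negbTE ->.
by rewrite mul0r.
Qed.

Hypothesis indep : forall l : F -> S, (forall e, l e \is 1.-homog) ->
  \sum_e l e * f e = 0 -> forall e, l e = 0.

Lemma indepC i j (w : F -> C) : (forall e, kbideg i j (w e)) -> j = i.+1 ->
  \sum_e cm (f e) (w e) = 0 -> forall e, w e = 0.
Proof.
move=> kw ji w0 e; apply/ffunP => A; rewrite [RHS]ffunE.
apply: (indep (l := fun e => w e A)) => [e'|].
  case: (eqVneq (w e' A) 0) => [->|/eqP nz]; first exact: rpred0.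
  by have [_ _] := kw e' A nz; rewrite ji subSnn.
have := congr1 (fun c : C => c A) w0; rewrite sum_ffunE [RHS]ffunE => E; rewrite -[RHS]E.
by apply: eq_bigr => e' _; rewrite ffunE mulrC.
Qed.

(** The cofactors of [d c] have constant coefficients. Their boundaries give linear syzygies, which
    vanish by [indep]; a cycle with constant coefficients is zero, because a filling would have
    negative degree. *)
Lemma hz_linear i : hz genI i.+2 i.+3.
Proof.
apply: hz_cycle0 => //; first exact: genI_hideal.
move=> c kc dc; have [w [wE _ kw]] := genI_lift (kbideg_kd (V:=setT) kc) dc.
have {}kw e : kbideg i.+1 i.+1 (w e) by have := kw isT e; rewrite subn2.
have dw e : d (w e) = 0.
  apply: (indepC (w := fun e => d (w e)) (i := i) (j := i.+1)) => // [e'|].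
    exact: kbideg_kd.
  have := congr1 d wE; rewrite kd_kd raddf_sum => /esym E; rewrite -[RHS]E.
  by apply: eq_bigr => e' _; rewrite -cm_kd.
rewrite wE big1 // => e _; suff -> : w e = 0 by rewrite raddf0.
have [|b kb ->] := @exact_cycle i.+1 i.+1 (w e) _ (kw e) (dw e); first by [].
by rewrite (kbideg_gt _ kb) // raddf0.
Qed.

(** The unit chain, one times the basis vector of the empty set; no mapping cone is involved. *)
Definition cone : C := [ffun A : {set 'I_k} => if A == set0 then 1 else 0].

Lemma kbideg_cone : kbideg 0 0 cone.
Proof.
move=> A; rewrite ffunE; case: eqP => // -> _; rewrite cards0; split=> //.
exact: dhomog1.
Qed.

Lemma wedge_cone (g : 'I_k -> S) t : wedge g cone [set t] = g t.
Proof.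
rewrite sum_ffunE (bigD1 t) //= big1 ?addr0 => [|s st].
  rewrite !ffunE set11 setDv eqxx mulr1.
  rewrite /sg (_ : [set s in _ | _] = set0) ?cards0 ?mul1r //.
  by apply/setP => s; rewrite !inE; case: eqP => // ->; rewrite ltnn.
by rewrite ffunE inE (negbTE st).
Qed.

Lemma kd_set0 c : d c set0 = \sum_t 'X_t * c [set t].
Proof.
rewrite sum_ffunE; apply: eq_big => [t|t _]; first by rewrite inE.
rewrite !ffunE inE setU0 /sg (_ : [set s in _ | _] = set0) ?cards0 ?mul1r //.
by apply/setP => s; rewrite !inE.
Qed.

Lemma kd_wedge_cone (g : 'I_k -> S) : d (wedge g cone) = cm (\sum_t 'X_t * g t) cone.
Proof.
rewrite -kd_wedge (kbideg0_kd _ kbideg_cone) /wedge [X in _ = _ + X]big1 ?addr0 //.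
by move=> t _; rewrite !raddf0.
Qed.

Lemma kbideg_wedge_cone (e : nat) (g : 'I_k -> S) : (forall t, g t \is e.-homog) ->
  kbideg 1 e.+1 (wedge g cone).
Proof. by move=> hg; have := kbideg_wedge hg kbideg_cone; rewrite addn0. Qed.

Lemma genI_sum (w : F -> C) : inC genI (\sum_e cm (f e) (w e)).
Proof. by move=> A; rewrite sum_ffunE; exists (fun e => w e A); apply: eq_bigr => e _; rewrite ffunE mulrC. Qed.

(** This is Tor_2 = Syz / m Syz: if it vanishes in degree [j.+3], no syzygy with entries of degree
    [j.+1] is minimal. Writing [s e] as the boundary of [u e], the sum of the [f e u e] is a cycle
    with some filling [c]. Filling [c] modulo the ideal corrects each [u e] by [d (w e)], after
    which every coefficient of the [u e] forms a syzygy. *)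
Lemma syzygy_decomp j (s : F -> S) : hz genI 2 j.+3 ->
  (forall e, s e \is j.+1.-homog) -> \sum_e s e * f e = 0 ->
  exists r : 'I_k -> F -> S, (forall t, \sum_e r t e * f e = 0) /\
    forall e, s e = \sum_t 'X_t * r t e.
Proof.
move=> h hs s0.
have H e : exists g : 'I_k -> S, (forall t, g t \is j.-homog) /\ s e = \sum_t 'X_t * g t.
  exact: homog_decomp.
have [g hg] := fin_all_exists H; pose u e := wedge (g e) cone.
have du e : d (u e) = cm (s e) cone by rewrite kd_wedge_cone; have [_ <-] := hg e.
have ku e : kbideg 1 j.+1 (u e) by apply: kbideg_wedge_cone; have [] := hg e.
have dfu : d (\sum_e cm (f e) (u e)) = 0.
  rewrite raddf_sum /=; apply/ffunP => A; rewrite sum_ffunE ffunE.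
  transitivity ((\sum_e s e * f e) * cone A); last by rewrite s0 mul0r.
  rewrite mulr_suml; apply: eq_bigr => e _; rewrite cm_kd du [LHS]ffunE [X in _ * X]ffunE.
  ring.
have [|||c kc cE] := @exact_cycle 1 j.+3 (\sum_e cm (f e) (u e)); rewrite ?dfu //.
  by apply: kbideg_sum => e _; apply: (@kbideg_cm _ _ _ _ 2).
have [|b kb bE] := h c kc; first by rewrite -cE; apply: genI_sum.
have [|w [wE _ _]] := @genI_lift 2 j.+3 (c - d b) _ bE.
  by apply: kbidegB => //; apply: kbideg_kd.
have dw : \sum_e cm (f e) (u e - d (w e)) = 0.
  under eq_bigr do rewrite raddfB /= -cm_kd.
  rewrite sumrB cE -raddf_sum -wE raddfB /= kd_kd subr0 subrr //.
exists (fun t e => (u e - d (w e)) [set t]); split=> [t|e].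
  have := congr1 (fun c : C => c [set t]) dw; rewrite sum_ffunE [RHS]ffunE => E; rewrite -[RHS]E.
  by apply: eq_bigr => e _; rewrite [in RHS]ffunE mulrC.
rewrite -kd_set0 raddfB /= kd_kd subr0 du !ffunE eqxx mulr1 //.
Qed.

(** The columns [r _ t] are syzygies with quadratic entries, and the variables give a linear
    relation among them; vanishing of H_3 in degree 5 makes such a relation trivial. The same zigzag
    as in [syzygy_decomp] is run one step further; at its end the coefficients are linear, so
    [indep] applies. *)
Lemma second_syzygy0 (r : F -> 'I_k -> S) : hz genI 3 5 ->
  (forall e t, r e t \is 2.-homog) -> (forall e, \sum_t 'X_t * r e t = 0) ->
  (forall t, \sum_e r e t * f e = 0) -> forall e t, r e t = 0.
Proof.
move=> h hr r0 fr0; pose x e := wedge (r e) cone.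
have kx e : kbideg 1 3 (x e) by apply: kbideg_wedge_cone.
have H e : exists w : C, kbideg 2 3 w /\ x e = d w.
  have [|||w kw wE] := @exact_cycle 1 3 (x e); rewrite // ?kd_wedge_cone ?r0.
    by apply/ffunP => A; rewrite !ffunE mul0r.
  by exists w.
have [w hw] := fin_all_exists H.
have dfw : d (\sum_e cm (f e) (w e)) = 0.
  rewrite raddf_sum /=; apply/ffunP => A; rewrite sum_ffunE ffunE.
  under eq_bigr => e _ do rewrite cm_kd -(proj2 (hw e)) ffunE /x /wedge sum_ffunE mulr_sumr.
  rewrite exchange_big big1 //= => t _.
  transitivity (ext t (cm (\sum_e r e t * f e) cone) A); last first.
    rewrite fr0 (_ : cm 0 cone = 0) ?raddf0 ?ffunE //.
    by apply/ffunP => B; rewrite !ffunE mul0r.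
  rewrite !ffunE; under eq_bigr do rewrite !ffunE.
  case: (t \in A); last by rewrite big1 // => e _; rewrite mulr0.
  by rewrite mulr_suml mulr_sumr; apply: eq_bigr => e _; ring.
have [|||c kc cE] := @exact_cycle 2 5 (\sum_e cm (f e) (w e)); rewrite ?dfw //.
  by apply: kbideg_sum => e _; apply: (@kbideg_cm _ _ _ _ 2) => //; have [] := hw e.
have [|b kb bE] := h c kc; first by rewrite -cE; apply: genI_sum.
have [|g [gE _ kg]] := @genI_lift 3 5 (c - d b) _ bE.
  by apply: kbidegB => //; apply: kbideg_kd.
have wg e : w e - d (g e) = 0.
  apply: (indepC (w := fun e => w e - d (g e)) (i := 2) (j := 3)) => // [e'|].
    by apply: kbidegB; [have [] := hw e' | apply: kbideg_kd; apply: kg].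
  under eq_bigr do rewrite raddfB /= -cm_kd.
  rewrite sumrB cE -raddf_sum -gE raddfB /= kd_kd subr0 subrr //.
move=> e t; rewrite -(wedge_cone (r e) t) -/(x e) (proj2 (hw e)).
by rewrite -[w e](subrK (d (g e))) wg add0r kd_kd ffunE.
Qed.

End Quadrics.

Notation addL := (foldl (@addI _ _)).

(** * Regular sequences of path and cycle generators *)

Section RegSeq.
Variables (K : fieldType) (k : nat).
Local Notation S := {mpoly K[k]}.
Implicit Types (p q f g a b : S) (t s x y u v : 'I_k) (I J : S -> Prop).

Lemma mem_homog I p : hideal I -> (forall e, I (pihomog mdeg e p)) -> I p.
Proof.
move=> hI h; rewrite (pihomog_partitionE (mf := mdeg) (leqnn (msize p))).
by apply: hi_sum => // i _; apply: h.
Qed.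

Lemma hiH_mul I e f m p : hideal I -> f \is e.-homog -> I (f * p) ->
  I (f * pihomog mdeg m p).
Proof.
move=> hI hf /(hiH hI (e + m)); rewrite (pihomogM _ _ hf) leq_addr.
by rewrite addKn.
Qed.

Lemma reg_homog I e f : hideal I -> f \is e.-homog ->
  (forall m p, p \is m.-homog -> I (f * p) -> I p) -> reg I f.
Proof.
move=> hI hf h p Ifp; apply: mem_homog => // m; apply: (h m); first exact: pihomogP.
exact: hiH_mul hf Ifp.
Qed.

Lemma addI_homog I f e m p : hideal I -> f \is e.-homog -> p \is m.-homog ->
  addI I f p -> exists q, [/\ I (p - q * f), (m < e)%N -> q = 0 & q \is (m - e).-homog].
Proof.
move=> hI hf hp [q /(hiH hI m)]; rewrite raddfB /= pihomog_dE // mulrC (pihomogM _ _ hf).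
case: leqP => le h.
  exists (pihomog mdeg (m - e)%N q); split; [by rewrite mulrC | by [] | exact: pihomogP].
by exists 0; rewrite mul0r rpred0.
Qed.

Lemma reg_ext I J f : (forall p, I p <-> J p) -> reg I f -> reg J f.
Proof. by move=> E h p /E /h /E. Qed.

Lemma reg_congr I f g : hideal I -> I (f - g) -> reg I f -> reg I g.
Proof.
move=> hI fg h p gp; apply: h.
by have := hiD hI (hiMr hI p fg) gp; congr I; ring.
Qed.

Lemma regN I f : hideal I -> reg I f -> reg I (- f).
Proof. by move=> hI h p; rewrite mulNr => /(hiN hI); rewrite opprK => /h. Qed.

Lemma regM I f g : reg I f -> reg I g -> reg I (f * g).
Proof. by move=> hf hg p; rewrite -mulrA => /hf /hg. Qed.

Lemma reg1 I : reg I 1.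
Proof. by move=> p; rewrite mul1r. Qed.

(** Homogeneous regular sequences can be permuted. If [g p] is in [I], then [p] is [f q] modulo [I]
    with [g q] again in [I]; positive degree of [f] lets an induction on the degree of [p]
    conclude. *)
Lemma reg_swap I f g e e' : hideal I -> f \is e.+1.-homog -> g \is e'.-homog ->
  reg I f -> reg (addI I f) g -> reg I g /\ reg (addI I g) f.
Proof.
move=> hI hf hg rf rg; split.
  apply: (reg_homog hI hg) => m; elim/ltn_ind: m => m IH p hp gp.
  have [q [pq q0 hq]] := addI_homog hI hf hp (rg _ (addI_sub f hI gp)).
  suff Iq : I q by have := hiD hI pq (hiMr hI f Iq); rewrite subrK.
  case: (ltnP m e.+1) => [/q0 -> |le]; first exact: hi0.
  apply: (IH (m - e.+1)%N) => //; first by rewrite ltn_subrL (leq_trans _ le).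
  apply: rf; have := hiB hI gp (hiM hI g pq); congr I; ring.
move=> p [q fpq].
have [q' qq'] : addI I f q.
  apply: rg; exists p; have := hiN hI fpq; congr I; ring.
exists q'; apply: rf; have := hiD hI fpq (hiMr hI g qq'); congr I; ring.
Qed.

Lemma addIC I f g p : addI (addI I f) g p <-> addI (addI I g) f p.
Proof.
by split=> -[a [b h]]; exists b, a; move: h; congr I; ring.
Qed.

Lemma addI_oppr I f p : addI I (- f) p <-> addI I f p.
Proof. by split=> -[a h]; exists (- a); move: h; congr I; ring. Qed.

Lemma free_addI I f t : ev [set t] f = f -> xfree I t -> xfree (addI I f) t.
Proof.
move=> ef fI p [q h]; exists (del t q); have := fI _ h.
by rewrite raddfB /= [q * f]mulrC delM // mulrC.
Qed.

Lemma free_reg I t : xfree I t -> reg I 'X_t.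
Proof. by move=> fI p /fI; rewrite delX. Qed.

Lemma free_regX I t g : hideal I -> xfree I t -> ev [set t] g = g -> reg I g ->
  reg (addI I 'X_t) g.
Proof.
move=> hI fI eg rg p [q h]; have := free_ev hI fI h.
rewrite rmorphB !rmorphM /= ev1X mulr0 subr0 eg => /rg h'.
by exists (del t p); rewrite mulrC mulX_del subKr.
Qed.

Lemma ev_neq t s : s != t -> ev [set t] ('X_s : S) = 'X_s.
Proof. by move=> st; rewrite evX inE (negbTE st). Qed.

(** Modulo [X_y] the form becomes [a X_x], a product of regular elements; [reg_swap] then exchanges
    it with [X_y]. It serves to attach a new vertex carrying the free variables [X_x] and [X_y]. *)
Lemma reg_leaf I e a b x y : hideal I -> a \is e.-homog -> b \is e.-homog ->
  xfree I x -> xfree I y -> x != y -> ev [set y] a = a -> reg I a ->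
  reg I (a * 'X_x + b * 'X_y) /\ reg (addI I (a * 'X_x + b * 'X_y)) 'X_y.
Proof.
move=> hI ha hb fx fy xy ea ra.
have hX t : ('X_t : S) \is 1.-homog by apply: dhomogU.
have hy := hideal_addI (hX y) hI.
apply: (@reg_swap I 'X_y _ 0 (e + 1)) => //.
- by rewrite rpredD // dhomogM.
- exact: free_reg.
apply: (@reg_congr _ (a * 'X_x)) => //.
  by exists (- b); have := hi0 hI; congr I; ring.
apply: regM; first exact: free_regX.
by apply: free_reg; apply: free_addI => //; apply: ev_neq; rewrite eq_sym.
Qed.

(* The invariant of the induction along a path whose end vertices carry the variables
   [(u1, v1)] and [(u, v)], in coordinates where the generators are 2-minors. *)
Record endpoints I u1 v1 u v : Prop := Endpoints {
  ep_hideal : hideal I;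
  ep_u : reg I 'X_u;
  ep_v : reg I 'X_v;
  ep_u1 : reg I 'X_u1;
  ep_v1 : reg I 'X_v1;
  ep_u1v : reg (addI I 'X_u1) 'X_v;
  ep_v1u : reg (addI I 'X_v1) 'X_u;
  ep_close : reg I ('X_u1 * 'X_u - 'X_v1 * 'X_v) }.

Lemma endpoints0 I u v : hideal I -> xfree I u -> xfree I v -> u != v ->
  endpoints I u v u v.
Proof.
move=> hI fu fv uv; have vu : v != u by rewrite eq_sym.
split=> //; try exact: free_reg.
- by apply: free_reg; apply: free_addI => //; apply: ev_neq.
- by apply: free_reg; apply: free_addI => //; apply: ev_neq.
(* For a single vertex the closing form is a difference of squares. Both linear factors are regular
   in every characteristic, even when they coincide. *)
have -> : 'X_u * 'X_u - 'X_v * 'X_v = (1 * 'X_u + 1 * 'X_v) * (1 * 'X_u + (-1) * 'X_v) :> S by ring.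
have e1 : ev [set v] 1 = 1 :> S by rewrite rmorph1.
by apply: regM; apply (@reg_leaf I 0); rewrite ?rpredN ?dhomog1 //; apply: reg1.
Qed.

Section Step.
Variables (I : S -> Prop) (u1 v1 um vm u v : 'I_k).
Hypotheses (ep : endpoints I u1 v1 um vm) (fu : xfree I u) (fv : xfree I v).
Hypotheses (uv : u != v) (u1u : u1 != u) (u1v : u1 != v) (v1u : v1 != u) (v1v : v1 != v).
Hypotheses (umu : um != u) (umv : um != v) (vmu : vm != u) (vmv : vm != v).
Let hI := ep_hideal ep.
(** [g] is the generator of the new edge; [f] and [D] are the closing forms of the longer and of the
    shorter path. *)
Let g : S := 'X_um * 'X_v - 'X_vm * 'X_u.
Let f : S := 'X_u1 * 'X_u - 'X_v1 * 'X_v.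
Let D : S := 'X_u1 * 'X_um - 'X_v1 * 'X_vm.
Let hX t : ('X_t : S) \is 1.-homog := dhomogU K t.
Let hg : g \is 2.-homog. Proof. by rewrite rpredB // (@dhomogM _ _ _ 1 _ 1). Qed.
Let hD : D \is 2.-homog. Proof. by rewrite rpredB // (@dhomogM _ _ _ 1 _ 1). Qed.
Let hf : f \is 2.-homog. Proof. by rewrite rpredB // (@dhomogM _ _ _ 1 _ 1). Qed.

Let leafu J : hideal J -> xfree J u -> xfree J v -> reg J 'X_um ->
  reg J g /\ reg (addI J g) 'X_u.
Proof.
move=> hJ fJu fJv rJ.
have -> : g = 'X_um * 'X_v + (- 'X_vm) * 'X_u by rewrite /g; ring.
by apply: (@reg_leaf J 1); rewrite ?rpredN // 1?eq_sym // ev_neq.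
Qed.

Let leafv J : hideal J -> xfree J u -> xfree J v -> reg J 'X_vm ->
  reg J g /\ reg (addI J g) 'X_v.
Proof.
move=> hJ fJu fJv rJ.
have -> : g = (- 'X_vm) * 'X_u + 'X_um * 'X_v by rewrite /g; ring.
apply: (@reg_leaf J 1); rewrite ?rpredN //; last exact: regN.
by rewrite rmorphN /= ev_neq.
Qed.

(** [X_v1], [X_um] is a regular sequence modulo [I], so the ideal it generates has grade at least 2;
    dividing by the regular element [D] lowers the grade by at most one. *)
Let closeD p : addI I D ('X_um * p) -> addI I D ('X_v1 * p) -> addI I D p.
Proof.
move=> [q' h'] [q h].
have [q'' h''] : addI I 'X_v1 q.
  apply: (ep_v1u ep); exists q'; apply: (ep_close ep).
  have := hiB hI (hiM hI 'X_v1 h') (hiM hI 'X_um h); congr I; rewrite /D; ring.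
exists q''; apply: (ep_v1 ep).
by have := hiD hI h (hiM hI D h''); congr I; ring.
Qed.

(* Coefficients of [v] in [g] and [f] are [u_m] and [- v_1]; compare [r] with its value at
   [X_u = 0] and divide the difference by [X_u]. *)
Let closeQ r : addI I D (g * r) -> addI I D (f * r) -> addI I D r.
Proof.
have hQ := hideal_addI hD hI.
have eD t : u1 != t -> um != t -> v1 != t -> vm != t -> ev [set t] D = D.
  by move=> *; rewrite rmorphB !rmorphM /= !ev_neq.
have Qu : xfree (addI I D) u by apply: free_addI => //; apply: eD.
have Qv : xfree (addI I D) v by apply: free_addI => //; apply: eD.
move=> gr fr; apply: mem_homog => // m.
have {}gr := hiH_mul m hQ hg gr; have {}fr := hiH_mul m hQ hf fr.
move: (pihomog _ m r) (pihomogP mdeg m r) gr fr => {}r.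
have vu : v != u by rewrite eq_sym.
have Qe (r' : S) : addI I D (g * r') -> addI I D (f * r') -> addI I D (ev [set u] r').
  move=> /(free_ev hQ Qu) gr /(free_ev hQ Qu) fr; apply: closeD.
    apply: (free_reg Qv); move: gr; congr (addI I D).
    by rewrite rmorphM rmorphB !rmorphM /= ev1X !ev_neq //; ring.
  apply: (free_reg Qv); move: (hiN hQ fr); congr (addI I D).
  by rewrite rmorphM rmorphB !rmorphM /= ev1X !ev_neq //; ring.
have Qd (h r' : S) : addI I D (h * r') -> addI I D (ev [set u] r') -> addI I D (h * del u r').
  move=> hr er; apply: (free_reg Qu); have := hiB hQ hr (hiM hQ h er).
  by rewrite -mulrBr -mulX_del mulrCA.
have rE (r' : S) : r' = ev [set u] r' + 'X_u * del u r' by rewrite mulX_del addrC subrK.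
elim: m r => [|m IH] r hr gr fr.
  by rewrite (rE r) (del_dhomog0 u hr) mulr0 addr0; apply: Qe.
have er := Qe r gr fr; rewrite (rE r); apply: (hiD hQ) => //; apply: (hiM hQ).
by apply: IH; [exact: del_dhomog | exact: Qd | exact: Qd].
Qed.

(* Cramer: [u_m f + v_1 g = D u], so [f p] in [(I, g)] forces [D p = g r] modulo [I]. *)
Lemma endpoints_close : reg (addI I g) f.
Proof.
have [rg rgu] := leafu hI fu fv (ep_u ep).
move=> p [q fpq].
have [r Dpr] : addI I g (D * p).
  apply: rgu; exists ('X_um * q + 'X_v1 * p).
  by have := hiM hI 'X_um fpq; congr I; rewrite /D /f /g; ring.
have Dq : I (D * q - f * r).
  apply: rg; have := hiB hI (hiM hI f Dpr) (hiM hI D fpq); congr I; ring.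
have [r' rr'] : addI I D r.
  apply: closeQ.
    by exists p; have := hiN hI Dpr; congr I; ring.
  by exists q; have := hiN hI Dq; congr I; ring.
exists r'; apply: (ep_close ep).
by have := hiD hI Dpr (hiM hI g rr'); congr I; rewrite -/D; ring.
Qed.

(** [reg_leaf] over [I], over [I] with [u1] and over [I] with [v1] gives the conditions at the new
    end; [reg_swap] carries those on [u1] and [v1] past [g]. *)
Lemma endpointsS : endpoints (addI I g) u1 v1 u v /\ reg I g.
Proof.
have [rg rgu] := leafu hI fu fv (ep_u ep).
have [_ rgv] := leafv hI fu fv (ep_v ep).
have h1 t : hideal (addI I 'X_t) by apply: hideal_addI hI.
have f1 t s : t != s -> xfree I s -> xfree (addI I 'X_t) s.
  by move=> ts; apply: free_addI; apply: ev_neq.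
have [ru1 ru1v] := leafv (h1 u1) (f1 _ _ u1u fu) (f1 _ _ u1v fv) (ep_u1v ep).
have [rv1 rv1u] := leafu (h1 v1) (f1 _ _ v1u fu) (f1 _ _ v1v fv) (ep_v1u ep).
split=> //; split=> //.
- exact: hideal_addI hg hI.
- by have [] := reg_swap hI (hX u1) hg (ep_u1 ep) ru1.
- by have [] := reg_swap hI (hX v1) hg (ep_v1 ep) rv1.
- by apply: reg_ext ru1v => p; apply: addIC.
- by apply: reg_ext rv1u => p; apply: addIC.
- exact: endpoints_close.
Qed.

End Step.

(* The Betti table of a complete intersection of [m] quadrics. *)
Definition ci m I := [/\ hideal I,
  forall i j, ~ (j = i.*2 /\ (i <= m)%N) -> hz I i j &
  forall i, (i <= m)%N -> ~ hz I i i.*2].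

Lemma hideal0 : hideal (fun p : S => p = 0).
Proof. by split=> // [p q -> ->|p q ->|e p ->]; rewrite ?addr0 ?mulr0 ?raddf0. Qed.

Lemma ci0 : ci 0 (fun p : S => p = 0).
Proof.
split=> [|i j ij|i]; first exact: hideal0.
  apply: koszul_exact; apply/eqP => -[i0 j0]; apply: ij.
  by rewrite i0 j0.
rewrite leqn0 => /eqP-> h; have [|b kb bE] := h _ (@kbideg_cone K k).
  by move=> A; rewrite (kbideg0_kd _ (@kbideg_cone K k)) ffunE.
have := bE set0; rewrite (kbideg_gt _ kb) // raddf0 subr0 ffunE eqxx => /eqP.
by rewrite oner_eq0.
Qed.

Lemma ciS m I f : ci m I -> f \is 2.-homog -> reg I f -> ci m.+1 (addI I f).
Proof.
move=> [hI hv hn] hf rf; split=> [|i j ij|i]; first exact: hideal_addI hf hI.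
  apply: (hz_addI hI hf rf) => [|i' j' Ei Ej]; apply: hv => -[E le]; apply: ij.
    by rewrite E (leq_trans le).
  by rewrite Ej Ei E doubleS.
rewrite leq_eqVlt => /orP[/eqP-> h|lt h].
  by apply: (hn m) => //; apply: (hz_addI_surj hI hf rf); rewrite doubleS in h.
by apply: (hn i) => //; apply: (hz_addI_inj hI hf rf h).
Qed.

Lemma ci_ext m I J : hideal J -> (forall p, I p <-> J p) -> ci m I -> ci m J.
Proof.
move=> hJ E [hI hv hn]; split=> // [i j ij|i le h].
  by apply: hz_ext E _; apply: hv.
by apply: (hn i le); apply: hz_ext h => p; rewrite E.
Qed.

Lemma addL_hideal I (l : seq S) : hideal I -> (forall f, f \in l -> f \is 2.-homog) ->
  hideal (addL I l).
Proof.
elim: l I => [|f l IH] I hI hl //=; apply: IH => [|g gl].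
  by apply: hideal_addI hI; apply: (hl f); rewrite mem_head.
by apply: hl; rewrite in_cons gl orbT.
Qed.

Lemma addL_sub I J (l : seq S) : hideal J -> (forall p, I p -> J p) ->
  (forall f, f \in l -> J f) -> forall p, addL I l p -> J p.
Proof.
move=> hJ; elim: l I => [|f l IH] I IJ hl //=; apply: IH => [p [q h]|g gl].
  have := hiD hJ (IJ _ h) (hiM hJ q (hl f (mem_head _ _))).
  by rewrite subrK.
by apply: hl; rewrite in_cons gl orbT.
Qed.

Lemma addL_base I (l : seq S) p : hideal I -> (forall f, f \in l -> f \is 2.-homog) ->
  I p -> addL I l p.
Proof.
elim: l I => [|f l IH] I hI hl Ip //=; apply: IH => [|g gl|].
- by apply: hideal_addI hI; apply: (hl f); rewrite mem_head.
- by apply: hl; rewrite in_cons gl orbT.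
- exact: addI_sub.
Qed.

Lemma addL_mem I (l : seq S) f : hideal I -> (forall f, f \in l -> f \is 2.-homog) ->
  f \in l -> addL I l f.
Proof.
elim: l I => [|g l IH] I hI hl //=; have hg := hl g (mem_head _ _).
have hgI := hideal_addI hg hI.
have hl' h : h \in l -> h \is 2.-homog by move=> hh; apply: hl; rewrite in_cons hh orbT.
rewrite in_cons => /orP[/eqP->|fl]; last exact: IH.
by apply: addL_base => //; exists 1; rewrite mul1r subrr; apply: hi0.
Qed.

End RegSeq.

(** * Complete intersection graphs *)

Section Graph.
Variables (K : fieldType) (n : nat).
Local Notation S := {mpoly K[n + n]}.
Local Notation bg := (@bgen K n).
Implicit Types (p q f g : S) (i j l x y z : 'I_n) (s w : seq 'I_n) (e : rel 'I_n).

(* [x_i] for [b = true], [y_i] for [b = false]. *)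
Definition vx (b : bool) i : 'I_(n + n) := if b then lshift n i else rshift n i.

#[global] Arguments vx : simpl never.

Lemma vx_inj b b' i j : vx b i = vx b' j -> b = b' /\ i = j.
Proof.
rewrite /vx; case: b b' => -[]; [|move/eqP|move/eqP|].
- by move/lshift_inj.
- by rewrite eq_lrshift.
- by rewrite eq_rlshift.
- by move/rshift_inj.
Qed.

Lemma vx_eq b b' i j : (vx b i == vx b' j) = (b == b') && (i == j).
Proof. by apply/eqP/andP => [/vx_inj[-> ->]|[/eqP-> /eqP->]]. Qed.

Lemma vx_surj (t : 'I_(n + n)) : exists b i, t = vx b i.
Proof.
by rewrite -(splitK t); case: (split t) => i /=; [exists true | exists false]; exists i.
Qed.

Local Notation X b i := ('X_(vx b i) : S).

Lemma bgenE i j : bg i j = X true i * X true j - X false i * X false j.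
Proof. by []. Qed.

Lemma bgenC i j : bg i j = bg j i.
Proof. by rewrite !bgenE mulrC [X false i * _]mulrC. Qed.

Lemma bgen2 i j : bg i j \is 2.-homog.
Proof. by rewrite bgenE rpredB // (@dhomogM _ _ _ 1 _ 1) // dhomogU. Qed.

Lemma ev_bgen (D : {set 'I_(n + n)}) i j : (forall b, vx b i \notin D) -> (forall b, vx b j \notin D) ->
  ev D (bg i j) = bg i j.
Proof.
move=> hi hj; rewrite bgenE rmorphB !rmorphM /= !evX.
by rewrite !(negbTE (hi _)) !(negbTE (hj _)).
Qed.

Lemma addI_ext (I J : S -> Prop) f : (forall p, I p <-> J p) ->
  forall p, addI I f p <-> addI J f p.
Proof. by move=> E p; split=> -[q h]; exists q; apply/E. Qed.

Lemma endpoints_ext (I J : S -> Prop) u1 v1 u v : hideal J -> (forall p, I p <-> J p) ->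
  endpoints I u1 v1 u v -> endpoints J u1 v1 u v.
Proof.
move=> hJ E [? ? ? ? ? ? ? ?]; split=> //; try by apply: reg_ext; eassumption.
all: by apply: reg_ext; [apply: addI_ext E | eassumption].
Qed.

Definition vfree (I : S -> Prop) i := forall b, xfree I (vx b i).

Lemma vfree_bgen I i j l : i != l -> j != l -> vfree I l -> vfree (addI I (bg i j)) l.
Proof.
move=> il jl fl b; apply: free_addI => //; apply: ev_bgen => b'.
  by rewrite inE vx_eq (negbTE il) andbF.
by rewrite inE vx_eq (negbTE jl) andbF.
Qed.

(** The exchange of variables at every other vertex is recorded by the colour [c], which tells
    whether the x- or the y-variable of [j] plays the part of [u]. The colour flips along each edge,
    and edge generators are minors up to sign. *)
Lemma path_endpoints i0 s (c : bool) m N j :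
  endpoints N (vx true i0) (vx false i0) (vx c j) (vx (~~ c) j) -> ci m N ->
  uniq (j :: s) -> i0 \notin s -> (forall l, l \in s -> vfree N l) ->
  let I := addL N (pairmap bg j s) in
  [/\ endpoints I (vx true i0) (vx false i0) (vx (c (+) odd (size s)) (last j s))
        (vx (~~ (c (+) odd (size s))) (last j s)), ci (m + size s) I &
      forall l, l \notin j :: s -> vfree N l -> vfree I l].
Proof.
elim: s c m N j => [|z s IH] c m N j ep cN.
  by move=> _ _ _ /=; rewrite addbF addn0; split.
rewrite in_cons negb_or => /andP[jzs uzs] /andP[i0z i0s] fs.
have jz : j != z by move: jzs; rewrite in_cons negb_or => /andP[].
have hN := ep_hideal ep.
have fz := fs z (mem_head _ _).
have [] := endpointsS (u := vx (~~ c) z) (v := vx c z) ep (fz _) (fz _).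
all: rewrite ?vx_eq ?(negbTE i0z) ?(negbTE jz) ?andbF //.
  by case: (c).
set g := (X in addI N X) => ep' rg.
have gE : g = if c then bg j z else - bg j z.
  by rewrite /g bgenE; case: (c) => //=; ring.
have E p : addI N g p <-> addI N (bg j z) p.
  by rewrite gE; case: (c) => //; apply: addI_oppr.
have hNg : hideal (addI N (bg j z)) by apply: hideal_addI hN; apply: bgen2.
have ep2 : endpoints (addI N (bg j z)) (vx true i0) (vx false i0)
   (vx (~~ c) z) (vx (~~ (~~ c)) z).
  by rewrite negbK; apply: endpoints_ext hNg E _.
have rg2 : reg N (bg j z).
  by have := rg; rewrite -/g gE; case: (c) => // /(regN hN); rewrite opprK.
have := IH (~~ c) m.+1 _ z ep2 (ciS cN (bgen2 _ _) rg2) uzs i0s.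
have fs' l : l \in s -> vfree (addI N (bg j z)) l.
  move=> ls; apply: vfree_bgen; last by apply: fs; rewrite in_cons ls orbT.
    by apply: contraNneq jzs => ->; rewrite in_cons ls orbT.
  by apply: contraTneq uzs => ->; rewrite /= ls.
move=> /(_ fs') [h1 h2 h3]; split=> /=.
- by rewrite addbN -addNb.
- by rewrite addnS -addSn.
move=> l; rewrite !in_cons !negb_or => /and3P[lj lz ls] fl; apply: h3.
  by rewrite in_cons negb_or lz.
by apply: vfree_bgen => //; rewrite eq_sym.
Qed.

Lemma path_ci m N i s : ci m N -> uniq (i :: s) ->
  (forall l, l \in i :: s -> vfree N l) -> let I := addL N (pairmap bg i s) in
  [/\ ci (m + size s) I, ~~ odd (size s) -> reg I (bg (last i s) i) &
    forall l, l \notin i :: s -> vfree N l -> vfree I l].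
Proof.
move=> cN us fs; have [hN _ _] := cN.
have fi := fs i (mem_head _ _).
have ep := endpoints0 hN (fi true) (fi false).
rewrite vx_eq /= in ep; have [||h1 h2 h3] := path_endpoints (ep isT) cN us.
- by move: us => /= /andP[].
- by move=> l ls; apply: fs; rewrite in_cons ls orbT.
(* The colour starts at [true] and returns to it after an even number of edges; only then is
   [ep_close] about the generator of the closing edge. *)
split=> // /negbTE os; have := ep_close h1; rewrite os /=.
by rewrite bgenE [X true (last i s) * _]mulrC [X false (last i s) * _]mulrC.
Qed.

Lemma in_IG_hideal e : hideal (@in_IG K n e).
Proof.
split.
- by exists (fun _ _ => 0); rewrite big1 // => i _; rewrite big1 // => j _; rewrite mul0r.
- move=> p q [a ->] [b ->]; exists (fun i j => a i j + b i j).
  rewrite -big_split; apply: eq_bigr => i _; rewrite -big_split; apply: eq_bigr => j _.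
  by rewrite mulrDl.
- move=> p q [a ->]; exists (fun i j => p * a i j).
  rewrite mulr_sumr; apply: eq_bigr => i _; rewrite mulr_sumr; apply: eq_bigr => j _.
  by rewrite mulrA.
- move=> d p [a ->].
  exists (fun i j => if (2 <= d)%N then pihomog mdeg (d - 2)%N (a i j) else 0).
  rewrite raddf_sum; apply: eq_bigr => i _; rewrite raddf_sum; apply: eq_bigr => j _ /=.
  by rewrite mulrC (pihomogM _ _ (bgen2 i j)); case: ifP; rewrite ?mul0r // mulrC.
Qed.

Lemma in_IG_gen e i j : e i j -> @in_IG K n e (bg i j).
Proof.
move=> eij; exists (fun i' j' => ((i' == i) && (j' == j))%:R).
rewrite (bigD1 i) //= (bigD1 j) //= !eqxx mul1r !big1 ?addr0 //.
  by move=> i' /negbTE ->; rewrite big1 // => j' _; rewrite mul0r.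
by move=> j' /andP[_ /negbTE ->]; rewrite andbF mul0r.
Qed.

Lemma in_IG_sub e (J : S -> Prop) : hideal J -> (forall i j, e i j -> J (bg i j)) ->
  forall p, @in_IG K n e p -> J p.
Proof.
move=> hJ h p [q ->]; apply: hi_sum => // i _; apply: hi_sum => // j eij.
by apply: (hiM hJ); apply: h.
Qed.

Lemma bettiP e (i j : nat) : betti_nz K e i j <-> ~ hz (@in_IG K n e) i j.
Proof.
split=> [[c [kc dc nb]] h|nh].
  have [|b kb bE] := h c kc; first by move=> A; rewrite -kdiffE; apply: dc.
  apply: nb; exists b; split=> // A; have := bE A; rewrite kdiffE cDE cNE //.
apply: NNPP => nb; apply: nh => c kc dc; apply: NNPP => nx; apply: nb.
exists c; split=> // [A|[b [kb bE]]]; first by rewrite kdiffE.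
by apply: nx; exists b => // A; have := bE A; rewrite kdiffE cDE cNE.
Qed.

Definition induced e (W : {set 'I_n}) : rel 'I_n :=
  fun x y => [&& x \in W, y \in W & e x y].

Lemma in_IG_vfree e l : (forall x y, e x y -> (x != l) && (y != l)) -> vfree (@in_IG K n e) l.
Proof.
move=> h b p [q ->]; rewrite raddf_sum /=; apply: (hi_sum (in_IG_hideal e)) => i _.
rewrite raddf_sum /=; apply: (hi_sum (in_IG_hideal e)) => j eij.
have /andP[il jl] := h _ _ eij; rewrite mulrC delM; last first.
  by apply: ev_bgen => b'; rewrite inE vx_eq ?(negbTE il) ?(negbTE jl) andbF.
by apply: (hiMr (in_IG_hideal e)); apply: in_IG_gen.
Qed.

(** Setting the variables outside [W] to zero kills the generators of all edges leaving [W] and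
    fixes the others, so [hz_transfer] applies. *)
Lemma hz_induced e W (i j : nat) : hz (@in_IG K n e) i j -> hz (@in_IG K n (induced e W)) i j.
Proof.
pose D := [set t | [exists b, exists l, (l \notin W) && (t == vx b l)]].
have inD b l : (vx b l \in D) = (l \notin W).
  rewrite inE; apply/existsP/idP => [[b' /existsP[l' /andP[lW /eqP/vx_inj[_ ->]]]] //|lW].
  by exists b; apply/existsP; exists l; rewrite lW eqxx.
apply: (hz_transfer (D := D)).
- exact: in_IG_hideal.
- exact: in_IG_hideal.
- move=> t; have [b [l ->]] := vx_surj t; rewrite inD => lW.
  apply: in_IG_vfree => x y /and3P[xW yW _].
  by apply/andP; split; [apply: contraNneq lW => <- | apply: contraNneq lW => <-].
- apply: in_IG_sub; first exact: in_IG_hideal.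
  by move=> x y /and3P[_ _ exy]; apply: in_IG_gen.
move=> p [q ->]; rewrite raddf_sum; apply: (hi_sum (in_IG_hideal _)) => x _ /=.
rewrite raddf_sum; apply: (hi_sum (in_IG_hideal _)) => y exy /=.
rewrite rmorphM; apply: (hiM (in_IG_hideal _)).
case xW: (x \in W); case yW: (y \in W); last 3 first.
- rewrite bgenE rmorphB !rmorphM /= ![ev _ (X _ y)]evX !inD yW /=.
  by rewrite !mulr0 subrr; apply: (hi0 (in_IG_hideal _)).
- rewrite bgenE rmorphB !rmorphM /= ![ev _ (X _ x)]evX !inD xW /=.
  by rewrite !mul0r subrr; apply: (hi0 (in_IG_hideal _)).
- rewrite bgenE rmorphB !rmorphM /= ![ev _ (X _ x)]evX !inD xW /=.
  by rewrite !mul0r subrr; apply: (hi0 (in_IG_hideal _)).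
rewrite /= ev_bgen => [|b|b]; rewrite ?inD ?xW ?yW //.
by apply: in_IG_gen; rewrite /induced xW yW.
Qed.

Definition zeroI : S -> Prop := fun p => p = 0.

Lemma vfree0 l : vfree zeroI l.
Proof. by move=> b p ->; rewrite raddf0. Qed.

Lemma addL_in_IG e (l : seq S) :
  (forall f, f \in l -> exists x y, e x y /\ f = bg x y) ->
  (forall x y, e x y -> bg x y \in l) -> forall p, addL zeroI l p <-> @in_IG K n e p.
Proof.
move=> h1 h2 p; have h2' f : f \in l -> f \is 2.-homog.
  by move=> /h1 [x [y [_ ->]]]; apply: bgen2.
have h0 : hideal zeroI := hideal0 K (n + n).
split.
  apply: addL_sub => [|q ->|f /h1 [x [y [exy ->]]]].
  - exact: in_IG_hideal.
  - exact: hi0 (in_IG_hideal e).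
  - exact: in_IG_gen.
apply: in_IG_sub; first exact: addL_hideal.
by move=> x y exy; apply: addL_mem => //; apply: h2.
Qed.

Lemma ci_induced_betti e W m (l : seq S) : ci m (addL zeroI l) ->
  (forall f, f \in l -> exists x y, induced e W x y /\ f = bg x y) ->
  (forall x y, induced e W x y -> bg x y \in l) ->
  forall i : nat, (i <= m)%N -> betti_nz K e i i.*2.
Proof.
move=> [_ _ hn] h1 h2 i le; apply: (proj2 (bettiP e i i.*2)) => h; apply: (hn i le).
have := hz_induced (W := W) h; apply: hz_ext => p.
by apply: iff_sym; apply: addL_in_IG.
Qed.

End Graph.

#[global] Arguments vx : simpl never.

Section CompleteIntersection.
Variables (K : fieldType) (n : nat).
Local Notation S := {mpoly K[n + n]}.
Local Notation bg := (@bgen K n).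
Local Notation IG e := (@in_IG K n e).
Implicit Types (p q f g : S) (i j l x y z : 'I_n) (s w : seq 'I_n) (e : rel 'I_n).

Lemma consecP i w x y : reflect
  (exists2 k, (k < size w)%N & (nth i (i :: w) k = x /\ nth i w k = y) \/
                          (nth i (i :: w) k = y /\ nth i w k = x))
  (consec (i :: w) x y).
Proof.
apply: (iffP hasP) => [[k]|[k kw h]]; rewrite ?mem_iota ?add0n /=.
  move=> kw h; exists k => //; move: h.
  rewrite !(set_nth_default i x) //=; last by rewrite ltnS ltnW.
  by case/orP => /andP[/eqP-> /eqP->]; [left | right].
exists k; first by rewrite mem_iota.
rewrite !(set_nth_default i x) //=; last by rewrite ltnS ltnW.
by case: h => -[-> ->]; rewrite !eqxx ?orbT.
Qed.

Lemma consec_pairmap i w x y : consec (i :: w) x y -> bg x y \in pairmap bg i w.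
Proof.
case/consecP => k kw h; apply/(nthP 0); exists k; first by rewrite size_pairmap.
by rewrite (nth_pairmap i) //; case: h => -[-> ->]; rewrite // bgenC.
Qed.

Lemma pairmap_consec i w f : f \in pairmap bg i w ->
  exists x y, [/\ x \in i :: w, y \in i :: w, consec (i :: w) x y & f = bg x y].
Proof.
case/(nthP 0) => k; rewrite size_pairmap => kw <-; rewrite (nth_pairmap i) //.
exists (nth i (i :: w) k), (nth i w k); split=> //.
- by rewrite mem_nth // ltnS ltnW.
- by rewrite in_cons mem_nth ?orbT.
- by apply/consecP; exists k => //; left.
Qed.

Section Union.
Variables (e : rel 'I_n) (e_sym : ssrbool.symmetric e).

Lemma add_component (U : {set 'I_n}) v i w : closed e U ->
  (forall x, (x \in component e v) = (x \in i :: w)) ->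
  (forall x y, x \in component e v -> y \in component e v -> e x y = consec (i :: w) x y) ->
  forall p, addL (IG (induced e U)) (pairmap bg i w) p <->
            IG (induced e (U :|: component e v)) p.
Proof.
move=> Ucl Cw he p.
have h2 f : f \in pairmap bg i w -> f \is 2.-homog.
  by move=> /pairmap_consec [x [y [_ _ _ ->]]]; apply: bgen2.
have hU := in_IG_hideal K (induced e U).
have hUC := in_IG_hideal K (induced e (U :|: component e v)).
split.
  apply: addL_sub => // [|f /pairmap_consec [x [y [xw yw cxy ->]]]].
    apply: in_IG_sub => // x y /and3P[xU yU exy]; apply: in_IG_gen.
    by rewrite /induced !inE xU yU.
  rewrite -!Cw in xw yw; apply: in_IG_gen.
  by rewrite /induced !in_setU xw yw !orbT he.
apply: in_IG_sub; first exact: addL_hideal.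
move=> x y /and3P[xUC yUC exy]; move: xUC; rewrite in_setU => /orP[xU|xC].
  apply: addL_base => //; apply: in_IG_gen; rewrite /induced xU exy.
  by rewrite -(Ucl _ _ exy) xU.
have yC : y \in component e v.
  by move: xC; rewrite !inE => /connect_trans; apply; apply: connect1.
by apply: addL_mem => //; apply: consec_pairmap; rewrite -he.
Qed.

(** The set [U] is a union of components already treated. The next component involves only variables
    on which the present ideal is free, which is what [path_ci] asks for. *)
Lemma union_ci : union_odd_cycles_paths e -> exists m, ci m (IG e).
Proof.
move=> hu.
have H : forall m (U : {set 'I_n}), #|~: U| = m -> closed e U ->
    (exists k, ci k (IG (induced e U))) -> exists k, ci k (IG e).
  elim/ltn_ind => m IH U cU Ucl [k ck].
  case: (set_0Vmem (~: U)) => [U0|[v]].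
    exists k; apply: ci_ext ck; first exact: in_IG_hideal.
    have UT x : x \in U by apply: contraT; rewrite -in_setC U0 inE.
    have E x y : induced e U x y = e x y by rewrite /induced !UT.
    move=> p; split; apply: in_IG_sub => [|x y]; try exact: in_IG_hideal.
      by rewrite E; apply: in_IG_gen.
    by move=> exy; apply: in_IG_gen; rewrite E.
  rewrite inE => vU; set C := component e v.
  have vC : v \in C by rewrite inE connect0.
  have CU x : x \in C -> x \notin U.
    by rewrite inE => cvx; apply: contra vU => xU; rewrite (closed_connect Ucl cvx).
  have fN x : x \in C -> vfree (IG (induced e U)) x.
    move=> xC; apply: in_IG_vfree => y z /and3P[yU zU _].
    by apply/andP; split; apply: contraNneq (CU x xC) => <-.
  apply: (IH _ _ (U :|: C) erefl).
  - rewrite -cU; apply: proper_card; apply/properP; split.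
      by apply/subsetP => x; rewrite !inE negb_or => /andP[].
    by exists v; rewrite !inE ?vU // connect0 orbT.
  - apply: intro_closed; first exact: sym_connect_sym.
    move=> x y exy; rewrite !inE => /orP[xU|cvx].
      by rewrite -(Ucl _ _ exy) xU.
    by rewrite (connect_trans cvx) ?orbT // connect1.
  case: (hu v) => [[[|i w] [us Cs he]]|[[|i w] [us Cs s3 os he]]].
  - by have := Cs v; rewrite inE connect0.
  - have fs l : l \in i :: w -> vfree (IG (induced e U)) l by rewrite -Cs; apply: fN.
    have [cI _ _] := path_ci ck us fs; exists (k + size w)%N.
    apply: ci_ext cI; first exact: in_IG_hideal.
    exact: add_component.
  - by [].
  have fs l : l \in i :: w -> vfree (IG (induced e U)) l by rewrite -Cs; apply: fN.
  have [cI rI _] := path_ci ck us fs; exists (k + size w).+1.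
  apply: ci_ext (ciS cI (bgen2 _ _ _) (rI os)); first exact: in_IG_hideal.
  (* Appending the first vertex at the end turns cyclic adjacency into consecutiveness, and the
     closing generator becomes the last entry of [pairmap]. *)
  have A p : addL (IG (induced e U)) (pairmap bg i (rcons w i)) p <->
      IG (induced e (U :|: C)) p.
    apply: add_component => // x; rewrite Cs -rcons_cons mem_rcons in_cons.
    by case: eqP => // ->; rewrite mem_head.
  by move=> p; have := A p; rewrite -cats1 pairmap_cat foldl_cat.
apply: (H _ set0 erefl) => [x y _|]; first by rewrite !inE.
exists 0%N; apply: ci_ext (ci0 K (n + n)); first exact: in_IG_hideal.
move=> p; split=> [->|]; first exact: hi0 (in_IG_hideal K _).
apply: (@in_IG_sub K n _ (fun q => q = 0)) => [|x y /and3P[]]; last by rewrite inE.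
exact: hideal0.
Qed.

Lemma ci_pure m : ci m (IG e) -> pure_resolution K e.
Proof.
move=> [_ hv hn] p [[j bpj] _] i /andP[i1 ip].
have bE a b : betti_nz K e a b -> b = a.*2 /\ (a <= m)%N.
  by move=> /bettiP nh; apply: NNPP => h; apply: nh; apply: hv.
have [_ pm] := bE _ _ bpj.
exists i.*2; split=> [|d [_ /bE[-> _]]] //; split; first by rewrite double_gt0.
by apply/bettiP; apply: hn; apply: leq_trans ip pm.
Qed.

End Union.
End CompleteIntersection.

(** * Complete bipartite graphs *)

Section VariableIdeals.
Variables (K : fieldType) (k : nat).
Local Notation S := {mpoly K[k]}.
Implicit Types (p q f g : S) (t : 'I_k) (D : {set 'I_k}) (I L : S -> Prop).

(** The ideal generated by the variables in [D], encoded as a kernel so that membership is an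
    equation; generation is [varI_sub]. *)
Definition varI D p := ev D p = 0.

Lemma varI_hideal D : hideal (varI D).
Proof.
split; rewrite /varI.
- exact: rmorph0.
- by move=> p q p0 q0; rewrite rmorphD /= p0 q0 addr0.
- by move=> p q q0; rewrite rmorphM /= q0 mulr0.
move=> d p; rewrite {1}(pihomog_partitionE (mf := mdeg) (leqnn (msize p))) rmorph_sum /=.
move=> /(congr1 (pihomog mdeg d)); rewrite raddf_sum raddf0 /= => E.
have hh e : ev D (pihomog mdeg e p) \is e.-homog by apply/ev_dhomog/pihomogP.
have pe e : pihomog mdeg d (ev D (pihomog mdeg e p)) =
    if e == d then ev D (pihomog mdeg d p) else 0.
  by case: eqP => [->|/eqP ne]; [rewrite pihomog_dE | rewrite (pihomog_ne0 ne)].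
move: E; under eq_bigr => e _ do rewrite pe.
case: (ltnP d (msize p)) => [lt|ge _].
  rewrite (bigD1 (Ordinal lt)) //= eqxx big1 ?addr0 // => i.
  by rewrite -val_eqE /= => /negbTE ->.
rewrite pihomogE big_seq_cond big1 ?rmorph0 // => m /andP[mp /eqP Em].
by move: (msize_mdeg_lt mp); rewrite /= Em ltnNge ge.
Qed.

Lemma sub_ev_mem L D p : hideal L -> (forall t, t \in D -> L 'X_t) -> L (p - ev D p).
Proof.
move=> hL; elim: {D}#|D| {-2}D (erefl #|D|) => [|m IH] D.
  move=> /cards0_eq-> _; suff -> : ev set0 p = p by rewrite subrr; apply: hi0.
  apply: (rmorph_mpoly_eq (f := ev set0) (g := idfun)) => [a|t] /=; first exact: evC.
  by rewrite evX inE.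
move=> cD LD; have /card_gt0P[t tD] : (0 < #|D|)%N by rewrite cD.
have cD' : #|D :\ t| = m by move: cD; rewrite (cardsD1 t) tD => -[].
have -> : p - ev D p = (p - ev (D :\ t) p) + del t (ev (D :\ t) p) * 'X_t.
  by rewrite mulrC mulX_del ev_ev setD1K // addrA subrK.
apply: hiD => //; last by apply: hiM => //; apply: LD.
by apply: IH => // s /setD1P[_]; apply: LD.
Qed.

Lemma varI_sub L D p : hideal L -> (forall t, t \in D -> L 'X_t) -> varI D p -> L p.
Proof. by move=> hL LD p0; rewrite -[p]subr0 -p0; apply: sub_ev_mem. Qed.

Lemma varI_X D t : t \in D -> varI D 'X_t.
Proof. by rewrite /varI evX => ->. Qed.

Lemma varIS D D' p : D \subset D' -> varI D p -> varI D' p.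
Proof.
move=> sD; apply: varI_sub; first exact: varI_hideal.
by move=> t tD; apply/varI_X/(subsetP sD).
Qed.

Lemma hideal_colon I e f : hideal I -> f \is e.-homog -> hideal (fun p => I (f * p)).
Proof.
move=> hI hf; split.
- by rewrite mulr0; apply: hi0.
- by move=> p q Ip Iq; rewrite mulrDr; apply: hiD.
- by move=> p q Iq; rewrite mulrCA; apply: hiM.
- by move=> d p; apply: hiH_mul hf.
Qed.

(** A variable outside [D] is a linear nonzerodivisor, so it may be adjoined without changing the
    bound, until the maximal ideal is reached. *)
Lemma regle_varI D : regle 0 (varI D).
Proof.
elim: {D}#|~: D| {-2}D (erefl #|~: D|) => [|m IH] D cD.
  apply: regle_top; first exact: varI_hideal.
  move=> [//|e] p _ hp; rewrite /varI; suff -> : D = setT by apply: ev_setT hp.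
  by rewrite -[D]setCK (cards0_eq cD) setC0.
have /card_gt0P[t] : (0 < #|~: D|)%N by rewrite cD.
rewrite inE => tD; apply: (@regle_addI _ _ _ _ 'X_t).
- exact: varI_hideal.
- exact: dhomogU.
- move=> p; rewrite /varI rmorphM /= evX (negbTE tD) => /eqP.
  by rewrite mulf_eq0 (negbTE (mpolyX_neq0 _ _)) => /eqP.
apply: (@regle_ext _ _ _ (varI (t |: D))); last first.
  apply: IH; move: cD; rewrite (cardsD1 t) inE tD => -[<-].
  by apply: eq_card => s; rewrite !inE negb_or.
move=> p; split.
  have hD : hideal (addI (varI D) 'X_t) := hideal_addI (dhomogU _ _) (varI_hideal D).
  apply: (varI_sub hD) => s; rewrite in_setU1 => /orP[/eqP->|sD].
    by exists 1; rewrite mul1r subrr; apply: hi0 (varI_hideal D).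
  by apply: addI_sub; [exact: varI_hideal | exact: varI_X].
move=> -[q h]; have hU := varI_hideal (t |: D).
have := hiD hU (varIS (subsetUr [set t] D) h) (hiM hU q (varI_X (setU11 t D))).
by rewrite subrK.
Qed.

End VariableIdeals.

(** * Rank one loci: generation by 2-minors and regularity *)

Section Segre.
Variables (K : fieldType) (n : nat) (col : 'I_n -> bool).
Local Notation S := {mpoly K[n + n]}.
Implicit Types (p q f g : S) (i j l : 'I_n) (C W A B : {set 'I_n}) (t : 'I_(n + n)).

Definition side t : bool := if split t is inl _ then true else false.
Definition vert t : 'I_n := match split t with inl i => i | inr i => i end.

Lemma vert_vx b i : vert (vx b i) = i.
Proof.
rewrite /vert /vx; case: b; first by rewrite (unsplitK (inl i)).
by rewrite (unsplitK (inr i)).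
Qed.

Lemma side_vx b i : side (vx b i) = b.
Proof.
rewrite /side /vx; case: b; first by rewrite (unsplitK (inl i)).
by rewrite (unsplitK (inr i)).
Qed.

Definition vars W := [set t | vert t \in W].
Definition uu i := vx (col i) i.
Definition vv i := vx (~~ col i) i.

Lemma in_vars b i W : (vx b i \in vars W) = (i \in W).
Proof. by rewrite inE vert_vx. Qed.

Lemma varsU W W' : vars (W :|: W') = vars W :|: vars W'.
Proof. by apply/setP => t; rewrite !inE. Qed.

(* Parametrization [u_i = s_i], [v_i = s_i z] of the rank one locus on [C], with the variables
   at [W] set to zero; [X_(uu i)] itself plays the role of [s_i]. *)
Definition seg C W t : {poly S} :=
  if vert t \in W then 0
  else if (vert t \in C) && (side t != col (vert t))
  then ('X_(uu (vert t)))%:P * 'X else ('X_t)%:P.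

Definition sev C W : S -> {poly S} := mmap (@polyC S \o @mpolyC (n + n) K) (seg C W).
HB.instance Definition _ C W := GRing.RMorphism.on (sev C W).

Lemma sevC C W c : sev C W c%:MP = c%:MP%:P.
Proof. by rewrite /sev mmapC. Qed.

Lemma sevX C W t : sev C W 'X_t = seg C W t.
Proof. by rewrite /sev mmapX mmap1U. Qed.

Lemma sev_uu C W i : i \notin W -> sev C W 'X_(uu i) = ('X_(uu i))%:P.
Proof. by move=> iW; rewrite sevX /seg vert_vx side_vx (negbTE iW) eqxx andbF. Qed.

Lemma sev_vv C W i : i \in C -> i \notin W -> sev C W 'X_(vv i) = ('X_(uu i))%:P * 'X.
Proof.
move=> iC iW; rewrite sevX /seg vert_vx side_vx (negbTE iW) iC.
by case: (col i).
Qed.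

Lemma sev_W C W t : vert t \in W -> sev C W 'X_t = 0.
Proof. by move=> tW; rewrite sevX /seg tW. Qed.

Lemma sev_ev C W W' p : sev C W (ev (vars W') p) = sev C (W :|: W') p.
Proof.
apply: (rmorph_mpoly_eq (f := sev C W \o ev (vars W')) (g := sev C (W :|: W'))) => [c|t] /=.
  by rewrite evC !sevC.
rewrite evX inE; case: ifP => tW'; rewrite ?rmorph0 !sevX /seg !inE tW' ?orbT //.
by rewrite orbF.
Qed.

Lemma map_sev C W W' p : map_poly (ev (vars W')) (sev C W p) = sev C (W :|: W') p.
Proof.
apply: (rmorph_mpoly_eq (f := map_poly (ev (vars W')) \o sev C W)
   (g := sev C (W :|: W'))) => [c|t] /=.
  by rewrite !sevC map_polyC /= evC.
rewrite !sevX /seg !inE; case: ifP => _; first by rewrite rmorph0.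
case: ifP => _ /=.
  rewrite rmorphM /= map_polyX map_polyC /= evX in_vars.
  by case: (vert t \in W') => //; rewrite polyC0 mul0r.
rewrite map_polyC /= evX inE.
by case: (vert t \in W').
Qed.

(** The variables that vanish on the fibre z = 0 of the parametrization: those at [W], and the
    [vv i] with [i] in [C]. *)
Definition uvC C W := vars W :|: [set t | (vert t \in C) && (side t != col (vert t))].

Lemma sev_at0 C W p : (sev C W p).[0] = ev (uvC C W) p.
Proof.
apply: (rmorph_mpoly_eq (f := horner_eval 0 \o sev C W) (g := ev (uvC C W))) => [c|t] /=.
  by rewrite sevC evC horner_evalE hornerC.
rewrite sevX evX /seg horner_evalE !inE; case: ifP => _ /=; first by rewrite horner0.
by case: ifP => _; rewrite ?hornerMX ?mulr0 // hornerC.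
Qed.

(** The prime ideal of the parametrized locus. That it is generated by the 2-minors on [C] and the
    variables at [W] is [seg_gen]. *)
Definition segI C W p := sev C W p = 0.

Lemma sev_homog C W d p : p \is d.-homog -> forall m, (sev C W p)`_m \is d.-homog.
Proof.
pose hom d (P : {poly S}) := forall m, P`_m \is d.-homog.
have homM a b P Q : hom a P -> hom b Q -> hom (a + b)%N (P * Q).
  by move=> hP hQ m; rewrite coefM rpred_sum // => i _; apply: dhomogM.
have homC (Q : S) e : Q \is e.-homog -> hom e Q%:P.
  by move=> h m; rewrite coefC; case: eqP => _; rewrite ?rpred0.
have hX (m : 'X_{1..n + n}) : hom (mdeg m) (sev C W 'X_[m]).
  rewrite mpolyXE_id rmorph_prod mdegE /=.
  elim/big_rec2: _ => [|t P a _ IH]; first by apply: homC; apply: dhomog1.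
  apply: (homM) IH; rewrite rmorphXn /=.
  elim: (m t) => [|c IHc]; first by rewrite expr0; apply: homC; apply: dhomog1.
  rewrite exprS; apply: (homM 1%N) IHc; rewrite sevX /seg.
  case: ifP => _; first by move=> x; rewrite coef0 rpred0.
  case: ifP => _; last by apply: homC; apply: dhomogU.
  move=> x; rewrite coefMX; case: eqP => _; first exact: rpred0.
  by apply: homC; apply: dhomogU.
move=> hp m; rewrite (mpolyE p) rmorph_sum coef_sum big_seq; apply: rpred_sum => x xp /=.
rewrite -mul_mpolyC rmorphM /= sevC coefCM mul_mpolyC; apply: rpredZ.
by have := hX x m; rewrite (dhomog_mf hp xp).
Qed.

Lemma segI_hideal C W : hideal (segI C W).
Proof.
split; rewrite /segI.
- exact: rmorph0.
- by move=> p q p0 q0; rewrite rmorphD /= p0 q0 addr0.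
- by move=> p q q0; rewrite rmorphM /= q0 mulr0.
move=> d p p0; apply/polyP => m; rewrite coef0.
have := p0; rewrite {1}(pihomog_partitionE (mf := mdeg) (leqnn (msize p))) rmorph_sum /=.
move=> /(congr1 (fun P : {poly S} => pihomog mdeg d P`_m)).
rewrite coef_sum coef0 raddf_sum raddf0 /= => E.
have hh e : (sev C W (pihomog mdeg e p))`_m \is e.-homog by apply/sev_homog/pihomogP.
have pe e : pihomog mdeg d (sev C W (pihomog mdeg e p))`_m =
    if e == d then (sev C W (pihomog mdeg d p))`_m else 0.
  by case: eqP => [->|/eqP ne]; [rewrite pihomog_dE | rewrite (pihomog_ne0 ne)].
move: E; under eq_bigr => e _ do rewrite pe.
case: (ltnP d (msize p)) => [lt|ge _].
  rewrite (bigD1 (Ordinal lt)) //= eqxx big1 ?addr0 // => i.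
  by rewrite -val_eqE /= => /negbTE ->.
rewrite pihomogE big_seq_cond big1 ?rmorph0 ?coef0 // => x /andP[xp /eqP Ex].
by move: (msize_mdeg_lt xp); rewrite /= Ex ltnNge ge.
Qed.

Definition minor i j : S := 'X_(uu i) * 'X_(vv j) - 'X_(vv i) * 'X_(uu j).

Lemma minor2 i j : minor i j \is 2.-homog.
Proof. by rewrite /minor rpredB // (@dhomogM _ _ _ 1 _ 1) // dhomogU. Qed.

Lemma segI_minor C W i j : i \in C -> j \in C -> segI C W (minor i j).
Proof.
move=> iC jC; have hT := segI_hideal C W.
have sW b l : l \in W -> segI C W 'X_(vx b l) by move=> lW; apply: sev_W; rewrite vert_vx.
case: (boolP (i \in W)) => iW.
  by apply: (hiB hT); apply: (hiMr hT); apply: sW.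
case: (boolP (j \in W)) => jW.
  by apply: (hiB hT); apply: (hiM hT); apply: sW.
rewrite /segI /minor rmorphB !rmorphM /= (sev_uu C iW) (sev_uu C jW).
by rewrite (sev_vv iC iW) (sev_vv jC jW); ring.
Qed.

Lemma segI_var C W t : vert t \in W -> segI C W 'X_t.
Proof. exact: sev_W. Qed.

Lemma segIS C W W' p : segI C W p -> segI C (W :|: W') p.
Proof. by rewrite /segI -map_sev => ->; rewrite rmorph0. Qed.

Lemma segI_varI C W p : segI C W p -> varI (uvC C W) p.
Proof. by rewrite /segI /varI -sev_at0 => ->; rewrite horner0. Qed.

Lemma varI_segI C W p : varI (vars W) p -> segI C W p.
Proof. by rewrite /varI /segI => p0; rewrite -[W]setUid -sev_ev p0 rmorph0. Qed.

Lemma segI_top C W p : C \subset W -> segI C W p <-> varI (vars W) p.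
Proof.
move=> sCW; split; last exact: varI_segI.
move=> /segI_varI; congr (varI _ _); apply/setP => t; rewrite !inE.
by case: (boolP (vert t \in C)) => [/(subsetP sCW) -> //|]; rewrite orbF.
Qed.

Lemma segI_reg C W i : i \in C -> i \notin W -> reg (segI C W) 'X_(vv i).
Proof.
move=> iC iW p; rewrite /segI rmorphM /= sev_vv // => /eqP.
by rewrite !mulf_eq0 polyC_eq0 (negbTE (mpolyX_neq0 _ _)) polyX_eq0 => /eqP.
Qed.

(** Write [p] as [l + q1 u_i + q2 v_i]. The variable ideal is prime and misses [u_i], so it contains
    [q1]; and [u_i] times any of its generators lies in (L, v_i), since [u_i v_j] equals [v_i u_j]
    modulo a minor. *)
Lemma seg_step C W i (L : S -> Prop) p : i \in C -> i \notin W -> hideal L ->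
  (forall q, L q -> segI C W q) ->
  (forall j l, j \in C -> l \in C -> L (minor j l)) ->
  (forall t, vert t \in W -> L 'X_t) ->
  addI (addI L 'X_(uu i)) 'X_(vv i) p -> varI (uvC C W) p -> addI L 'X_(vv i) p.
Proof.
move=> iC iW hL LT Lm Lv [q2 [q1 l]] p0.
have hLv : hideal (addI L 'X_(vv i)) by apply: hideal_addI hL; apply: dhomogU.
have l0 := segI_varI (LT _ l); have hM := varI_hideal K (uvC C W).
have uD : uu i \notin uvC C W by rewrite !inE vert_vx side_vx (negbTE iW) eqxx andbF.
have vD j : j \in C -> vv j \in uvC C W.
  by move=> jC; rewrite !inE vert_vx side_vx jC; case: (col j); rewrite ?orbT.
have q10 : varI (uvC C W) q1.
  have : varI (uvC C W) ('X_(uu i) * q1).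
    have := hiB hM (hiB hM p0 l0) (hiM hM q2 (varI_X K (vD i iC))).
    by congr (varI _ _); ring.
  rewrite /varI rmorphM /= evX (negbTE uD) => /eqP.
  by rewrite mulf_eq0 (negbTE (mpolyX_neq0 _ _)) => /eqP.
have h1 : addI L 'X_(vv i) ('X_(uu i) * q1).
  apply: (varI_sub (hideal_colon hLv (dhomogU _ (uu i))) _ q10) => t.
  rewrite !inE => /orP[tW|/andP[tC st]].
    by apply: (hiM hLv); apply: addI_sub => //; apply: Lv.
  have -> : t = vv (vert t).
    have [b [j E]] := vx_surj t; rewrite E side_vx vert_vx in st *.
    by rewrite /vv; case: (b) (col j) st => -[].
  exists 'X_(uu (vert t)); have := Lm i (vert t) iC tC.
  by congr L; rewrite /minor; ring.
have := hiD hLv (addI_sub _ hL l) (hiD hLv h1 (addI_gen _ q2 hL)).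
by congr (addI L _ _); ring.
Qed.

Lemma addI_uv_var (L : S -> Prop) i b : hideal L ->
  addI (addI L 'X_(uu i)) 'X_(vv i) 'X_(vx b i).
Proof.
move=> hL; have hL1 := hideal_addI (dhomogU K (uu i)) hL.
have [->|bc] := eqVneq b (col i).
  by apply: addI_sub => //; exists 1; rewrite mul1r subrr; apply: hi0.
have -> : b = ~~ col i by case: (b) (col i) bc => -[].
by exists 1; rewrite mul1r subrr; apply: hi0.
Qed.

Lemma addI_uv_segI C W i (L : S -> Prop) p : (forall q, L q -> segI C W q) ->
  addI (addI L 'X_(uu i)) 'X_(vv i) p -> segI C (W :|: [set i]) p.
Proof.
move=> LT [a [b h]]; have hT := segI_hideal C (W :|: [set i]).
have iWi c : segI C (W :|: [set i]) 'X_(vx c i).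
  by apply: segI_var; rewrite vert_vx !inE eqxx orbT.
have := hiD hT (segIS _ (LT _ h)) (hiD hT (hiM hT a (iWi (~~ col i))) (hiM hT b (iWi (col i)))).
by congr (segI _ _ _); rewrite /uu /vv; ring.
Qed.

(** Induction on the vertices of [C] outside [W]. Setting vertex [i] to zero and applying [seg_step]
    puts [p] in (L, v_i). As [v_i] is regular on the kernel, the cofactor lies in the kernel again
    and has smaller degree, so a second induction, on the degree, finishes. *)
Lemma seg_gen C W (L : S -> Prop) : hideal L ->
  (forall q, L q -> segI C W q) ->
  (forall j l, j \in C -> l \in C -> L (minor j l)) ->
  (forall t, vert t \in W -> L 'X_t) -> forall p, segI C W p -> L p.
Proof.
elim: {C W}#|C :\: W| {-2}C {-2}W (erefl #|C :\: W|) L => [|m IH] C W cC L hL LT Lm Lv.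
  have sCW : C \subset W by rewrite -setD_eq0 -cards_eq0 cC.
  move=> p /(segI_top p sCW); apply: (varI_sub hL) => t; rewrite inE; exact: Lv.
have /card_gt0P[i] : (0 < #|C :\: W|)%N by rewrite cC.
rewrite inE => /andP[iW iC].
have cC' : #|C :\: (W :|: [set i])| = m.
  by move: cC; rewrite -setDDl (cardsD1 i) inE iW iC => -[].
have step p : segI C W p -> addI L 'X_(vv i) p.
  move=> Tp; apply: (seg_step iC iW hL LT Lm Lv); last exact: segI_varI.
  have hL1 := hideal_addI (dhomogU K (uu i)) hL.
  have hL2 := hideal_addI (dhomogU K (vv i)) hL1.
  have sub q : L q -> addI (addI L 'X_(uu i)) 'X_(vv i) q.
    by move=> Lq; apply: addI_sub => //; apply: addI_sub.
  apply: (IH C (W :|: [set i]) cC' _ hL2) => [q|j l jC lC|t|].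
  - exact: addI_uv_segI.
  - by apply: sub; apply: Lm.
  - rewrite !inE => /orP[tW|/eqP Et]; first by apply: sub; apply: Lv.
    have [b [j E]] := vx_surj t; rewrite E vert_vx in Et *; rewrite Et.
    exact: addI_uv_var.
  - exact: segIS.
move=> p Tp; apply: mem_homog => // d.
have := hiH (segI_hideal C W) d Tp; move: (pihomogP mdeg d p).
move: (pihomog _ d p) => {p}Tp; move: Tp.
elim: d => [|d IHd] p hp Tp.
all: have [q [h q0 hq]] := addI_homog hL (dhomogU K (vv i)) hp (step p Tp).
  by rewrite q0 // mul0r subr0 in h.
have Tq : segI C W q.
  apply: (segI_reg iC iW); have hT := segI_hideal C W.
  by have := hiB hT Tp (LT _ h); congr (segI _ _ _); ring.
rewrite subn1 in hq.
by have := hiD hL h (hiMr hL 'X_(vv i) (IHd q hq Tq)); rewrite subrK.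
Qed.

(** Adding the linear nonzerodivisor [v_i] gives the intersection of the kernel for W + i with a
    variable ideal, and the sum of these two is a variable ideal as well. Mayer-Vietoris with bounds
    1, 0 and 0 closes the induction. *)
Lemma regle_segI C W : regle 1 (segI C W).
Proof.
elim: {C W}#|C :\: W| {-2}C {-2}W (erefl #|C :\: W|) => [|m IH] C W cC.
  have sCW : C \subset W by rewrite -setD_eq0 -cards_eq0 cC.
  apply: (@regle_ext _ _ _ (varI (vars W))).
    by move=> p; apply: iff_sym; apply: segI_top.
  by apply: (@regle_mono _ _ 0) => //; apply: regle_varI.
have /card_gt0P[i] : (0 < #|C :\: W|)%N by rewrite cC.
rewrite inE => /andP[iW iC].
have cC' : #|C :\: (W :|: [set i])| = m.
  by move: cC; rewrite -setDDl (cardsD1 i) inE iW iC => -[].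
have hT := segI_hideal C W; have hT' := segI_hideal C (W :|: [set i]).
have hM := varI_hideal K (uvC C W).
apply: (regle_addI hT (dhomogU K (vv i)) (segI_reg iC iW)).
have vD : varI (uvC C W) ('X_(vv i) : S).
  by apply: varI_X; rewrite !inE vert_vx side_vx iC; case: (col i); rewrite ?orbT.
apply: (@regle_ext _ _ _ (capI (segI C (W :|: [set i])) (varI (uvC C W)))).
  move=> p; split=> [[Tp Mp]|[q h]].
    apply: (seg_step iC iW hT) => // [j l jC lC|t tW|].
    - exact: segI_minor.
    - exact: segI_var.
    have h1 := hideal_addI (dhomogU K (uu i)) hT.
    have sub q : segI C W q -> addI (addI (segI C W) 'X_(uu i)) 'X_(vv i) q.
      by move=> Lq; apply: addI_sub => //; apply: addI_sub.
    apply: (seg_gen (hideal_addI (dhomogU K (vv i)) h1)) Tp => [q|j l jC lC|t].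
    - exact: addI_uv_segI.
    - by apply: sub; apply: segI_minor.
    - rewrite !inE => /orP[tW|/eqP Et]; first by apply: sub; apply: segI_var.
      have [b [j E]] := vx_surj t; rewrite E vert_vx in Et *; rewrite Et.
      exact: addI_uv_var.
  split.
    apply: (addI_uv_segI (L := segI C W)) => //.
    by exists q; apply: addI_sub.
  by have := hiD hM (segI_varI h) (hiM hM q vD); rewrite subrK.
apply: regle_capI => //; first exact: IH.
  by apply: (@regle_mono _ _ 0) => //; apply: regle_varI.
apply: (@regle_ext _ _ _ (varI (uvC C (W :|: [set i])))); last exact: regle_varI.
move=> p; split=> [|[a [Ta Ma]]]; last first.
  have hM' := varI_hideal K (uvC C (W :|: [set i])).
  have sub : uvC C W \subset uvC C (W :|: [set i]).
    by rewrite /uvC varsU; apply: setSU; apply: subsetUl.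
  by have := hiD hM' (segI_varI Ta) (varIS sub Ma); rewrite addrC subrK.
apply: varI_sub; first exact: hideal_sumI.
move=> t; rewrite in_setU => /orP[tW|tC].
  exists 'X_t; split; last by rewrite subrr; apply: hi0.
  by apply: segI_var; rewrite inE in tW.
exists 0; split; first exact: hi0.
by rewrite subr0; apply: varI_X; rewrite in_setU tC orbT.
Qed.

End Segre.

(** * One generator per edge and the absence of linear syzygies *)

Section Edges.
Variables (K : fieldType) (n : nat) (e : rel 'I_n).
Local Notation S := {mpoly K[n + n]}.
Local Notation bg := (@bgen K n).
Local Notation IG e := (@in_IG K n e).
Implicit Types (p q f g : S) (i j l x y z : 'I_n).
Hypothesis he : simple_graph e.

(** Each edge is listed once, with increasing ends: [in_IG] sums over both orientations, whose equal
    generators would violate linear independence. *)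
Definition edge := {p : 'I_n * 'I_n | (p.1 < p.2)%N && e p.1 p.2}.
Definition edge_gen (a : edge) : S := bg (val a).1 (val a).2.

Lemma edge_gen2 a : edge_gen a \is 2.-homog.
Proof. exact: bgen2. Qed.

Definition sort2 x y := if (x < y)%N then (x, y) else (y, x).

Fact sort2_edge x y : e x y -> ((sort2 x y).1 < (sort2 x y).2)%N && e (sort2 x y).1 (sort2 x y).2.
Proof.
case: he => es ei h; rewrite /sort2; case: (ltnP x y) => [lt|le] /=; first by rewrite lt.
rewrite es h andbT ltn_neqAle le andbT.
by apply: contraTneq h => /val_inj ->; rewrite ei.
Qed.

Definition mk_edge x y (h : e x y) : edge := exist _ (sort2 x y) (sort2_edge h).

Lemma edge_gen_mk x y (h : e x y) : edge_gen (mk_edge h) = bg x y.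
Proof. by rewrite /edge_gen /= /sort2; case: (ltnP x y) => _ //=; rewrite bgenC. Qed.

Lemma genI_mem (F : finType) (f : F -> S) a : genI f (f a).
Proof.
exists (fun b => (b == a)%:R); rewrite (bigD1 a) //= eqxx mul1r big1 ?addr0 //.
by move=> b /negbTE ->; rewrite mul0r.
Qed.

Lemma in_IG_genI p : IG e p <-> genI edge_gen p.
Proof.
split.
  apply: in_IG_sub; first exact: genI_hideal edge_gen2.
  by move=> x y h; rewrite -(edge_gen_mk h); apply: genI_mem.
move=> [q ->]; have hI := in_IG_hideal K e; apply: (hi_sum hI) => a _.
by apply: (hiM hI); apply: in_IG_gen; case: a => -[x y] /= /andP[].
Qed.

Lemma mcoeffMX_notle (k : nat) (p : {mpoly K[k]}) (m m' : 'X_{1..k}) :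
  ~~ (m <= m')%MM -> (p * 'X_[m])@_m' = 0.
Proof.
move=> h; apply: memN_msupp_eq0; rewrite (perm_mem (msuppMX p m)).
by apply: contra h => /mapP[m'' _ ->]; apply/mnm_lepP => i; rewrite mnmDE leq_addr.
Qed.

(* The monomial [X_k y_i y_j] with [X_k] an x-variable (or [X_k x_i x_j] with a y-variable) occurs
   in [l_a f_a] only for the edge [a = ij]. *)
Lemma edge_gen_indep (l : edge -> S) : (forall a, l a \is 1.-homog) ->
  \sum_a l a * edge_gen a = 0 -> forall a, l a = 0.
Proof.
move=> hl l0 a; apply/mpolyP => m; rewrite mcoeff0.
case: (eqVneq (mdeg m) 1%N) => [/eqP|ne]; last exact: dhomog_nemf_coeff (hl a) ne.
rewrite mdeg_eq1 => /existsP[t /eqP->].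
have [b [k ->]] := vx_surj t.
case: a => -[i j] ij; set a : edge := exist _ (i, j) ij.
pose M := (U_(vx (~~ b) i) + U_(vx (~~ b) j) + U_(vx b k))%MM.
have mon c x y : ('X_(vx c x) * 'X_(vx c y) : S) = 'X_[U_(vx c x) + U_(vx c y)].
  by rewrite mpolyXD.
have Mb x : M (vx b x) = (k == x).
  rewrite !mnmDE !mnm1E !vx_eq eqxx /=.
  by case: (b).
have Mb' x : M (vx (~~ b) x) = ((i == x) + (j == x))%N.
  rewrite !mnmDE !mnm1E !vx_eq eqxx /=.
  by case: (b); rewrite addn0.
have ltn_ne (x y : 'I_n) : (x < y)%N -> x != y by move=> lt; rewrite neq_ltn lt.
have Eb (a' : edge) : (l a' * ('X_(vx b (val a').1) * 'X_(vx b (val a').2)))@_M = 0.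
  rewrite mon mcoeffMX_notle //; case: a' => -[x y] /= /andP[/ltn_ne xy _].
  apply/negP => /mnm_lepP h; have := h (vx b x); have := h (vx b y).
  rewrite !Mb !mnmDE !mnm1E !vx_eq !eqxx /= [y == x]eq_sym (negbTE xy).
  by case: eqP => // ky; case: eqP => // kx; rewrite -kx -ky eqxx in xy.
have Eb' (a' : edge) : a' != a ->
    (l a' * ('X_(vx (~~ b) (val a').1) * 'X_(vx (~~ b) (val a').2)))@_M = 0.
  move=> aa; rewrite mon mcoeffMX_notle //; apply: contra aa.
  case: a' => -[x y] xy' /=; have /andP[xy _] := xy'; move=> /mnm_lepP h.
  apply/eqP/val_inj => /=; have := h (vx (~~ b) x); have := h (vx (~~ b) y).
  have /andP[ij0 _] := ij.
  rewrite !Mb' !mnmDE !mnm1E !vx_eq !eqxx /= !addn1 !add1n => hy hx.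
  have hx' : (i == x) || (j == x) by move: hx; case: (i == x); case: (j == x).
  have hy' : (i == y) || (j == y) by move: hy; case: (i == y); case: (j == y).
  case/orP: hx' => /eqP Ex; case/orP: hy' => /eqP Ey; subst x y => //.
  - by rewrite ltnn in xy.
  - by move: (ltn_trans ij0 xy); rewrite ltnn.
  - by rewrite ltnn in xy.
have sgn (a' : edge) : l a' * edge_gen a' = (-1) ^+ (~~ b) *
   (l a' * ('X_(vx b (val a').1) * 'X_(vx b (val a').2)))
   - (-1) ^+ (~~ b) * (l a' * ('X_(vx (~~ b) (val a').1) * 'X_(vx (~~ b) (val a').2))).
  by rewrite /edge_gen bgenE; case: (b) => /=; ring.
have := congr1 (mcoeff M) l0; rewrite mcoeff0 raddf_sum (bigD1 a) //= big1 ?addr0.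
  rewrite sgn mcoeffB !mulr_sign !(fun_if (mcoeff M)) !mcoeffN Eb.
  rewrite mon mcoeffMX oppr0 if_same sub0r => /eqP; rewrite oppr_eq0.
  by case: ifP => _; rewrite ?oppr_eq0 => /eqP.
move=> a' ne; rewrite sgn mcoeffB !mulr_sign !(fun_if (mcoeff M)) !mcoeffN Eb Eb' //.
by rewrite oppr0 if_same subrr.
Qed.

End Edges.

Section CompleteBipartite.
Variables (K : fieldType) (n : nat) (e : rel 'I_n) (A B : {set 'I_n}).
Local Notation S := {mpoly K[n + n]}.
Local Notation bg := (@bgen K n).
Local Notation IG := (@in_IG K n e).
Implicit Types (p q f g : S) (i j l x y z : 'I_n).
Hypothesis dAB : [disjoint A & B].
Hypothesis eE : forall x y, e x y = ((x \in A) && (y \in B)) || ((x \in B) && (y \in A)).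

Let col i := i \in A.
Local Notation mn := (@minor K n col).

Let BA i : i \in B -> (i \in A) = false.
Proof. by move=> iB; apply/negbTE; apply: contraTN iB => iA; rewrite (disjointFr dAB iA). Qed.

Let hI := in_IG_hideal K e.

Lemma minor_bgen i j : i \in A -> j \in B -> mn i j = bg i j.
Proof. by move=> iA jB; rewrite bgenE /minor /uu /vv /col iA (BA jB). Qed.

Lemma minorC i j : mn i j = - mn j i.
Proof. by rewrite /minor; ring. Qed.

Lemma minor_IG i j : e i j -> IG (mn i j).
Proof.
rewrite eE => /orP[] /andP[iX jX].
  by rewrite minor_bgen //; apply: in_IG_gen; rewrite eE iX jX.
by rewrite minorC minor_bgen //; apply: hiN => //; apply: in_IG_gen; rewrite eE iX jX.
Qed.

(** The three-term relation obtained by expanding a 3 by 3 determinant with a repeated row. *)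
Lemma minor_mulX i j b c : IG (mn i b) -> IG (mn b j) -> IG (mn i j * 'X_(vx c b)).
Proof.
move=> h1 h2; have [->|cb] := eqVneq c (col b).
  have := hiD hI (hiM hI 'X_(uu col i) h2) (hiM hI 'X_(uu col j) h1).
  by congr (@in_IG K n e _); rewrite /minor /uu; ring.
have -> : c = ~~ col b by case: (c) (col b) cb => -[].
have := hiD hI (hiM hI 'X_(vv col i) h2) (hiM hI 'X_(vv col j) h1).
by congr (@in_IG K n e _); rewrite /minor /vv; ring.
Qed.

Lemma ev_vx_in (W : {set 'I_n}) b i : i \in W -> ev (vars W) ('X_(vx b i) : S) = 0.
Proof. by move=> iW; rewrite evX in_vars iW. Qed.

Lemma ev_vx_notin (W : {set 'I_n}) b i : i \notin W ->
  ev (vars W) ('X_(vx b i) : S) = 'X_(vx b i).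
Proof. by move=> iW; rewrite evX in_vars (negbTE iW). Qed.

Lemma ev_minor_l (W : {set 'I_n}) i j : i \in W -> ev (vars W) (mn i j) = 0.
Proof.
move=> iW; rewrite /minor rmorphB !rmorphM /= (ev_vx_in (col i) iW).
by rewrite (ev_vx_in (~~ col i) iW) !mul0r subrr.
Qed.

Lemma ev_minor_r (W : {set 'I_n}) i j : j \in W -> ev (vars W) (mn i j) = 0.
Proof. by move=> jW; rewrite minorC rmorphN /= ev_minor_l ?oppr0. Qed.

Lemma ev_minor (W : {set 'I_n}) i j : i \notin W -> j \notin W -> ev (vars W) (mn i j) = mn i j.
Proof.
move=> iW jW; rewrite /minor rmorphB !rmorphM /= (ev_vx_notin (col i) iW).
rewrite (ev_vx_notin (~~ col i) iW) (ev_vx_notin (col j) jW).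
by rewrite (ev_vx_notin (~~ col j) jW).
Qed.

Let F := ('I_n * 'I_n)%type.
Let C := A :|: B.
Let fm (a : F) : S := if (a.1 \in C) && (a.2 \in C) then mn a.1 a.2 else 0.

(** By [minor_mulX], a variable at [Y] times a minor inside [X] lies in the edge ideal. Hence [q]
    may be replaced by its value with the variables at [Y] set to zero, while the term at [X]
    vanishes with the minor. *)
Lemma minor_reduce (X Y : {set 'I_n}) i j q : (forall x y, x \in X -> y \in Y -> e x y) ->
  (forall x, x \in X -> x \notin Y) -> i \in X -> j \in X ->
  IG (q * mn i j - ev (vars Y) (q * mn i j) - ev (vars X) (q * mn i j)).
Proof.
move=> eXY XY iX jX; rewrite !rmorphM /= (ev_minor_l _ iX) mulr0 subr0.
rewrite (ev_minor (XY i iX) (XY j jX)) -mulrBl mulrC.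
apply: (sub_ev_mem (D := vars Y) q (hideal_colon hI (minor2 K col i j))) => t.
have [c [b ->]] := vx_surj t; rewrite in_vars => bY.
have sE x y : e x y = e y x by rewrite !eE orbC andbC [in X in _ || X]andbC.
by apply: minor_mulX; apply: minor_IG; [apply: eXY | rewrite sE; apply: eXY].
Qed.

Let fm2 a : fm a \is 2.-homog.
Proof. by rewrite /fm; case: ifP => _; [apply: minor2 | apply: rpred0]. Qed.

(** This gives the nontrivial inclusion in [in_IG_cap]: an element of the ideal of all minors that
    vanishes under both substitutions lies in the edge ideal. *)
Lemma minors_reduce p : genI fm p -> IG (p - ev (vars B) p - ev (vars A) p).
Proof.
move=> [q ->]; rewrite !rmorph_sum -!sumrB; apply: (hi_sum hI) => -[i j] _ /=.
rewrite /fm /=; case: ifP => [/andP[]|_]; last first.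
  by rewrite mulr0 !rmorph0 !subr0; apply: hi0.
have AB x : x \in A -> x \notin B by move=> xA; rewrite (disjointFr dAB xA).
have BA' x : x \in B -> x \notin A by move=> xB; rewrite BA.
have eAB x y : x \in A -> y \in B -> e x y by move=> xA yB; rewrite eE xA yB.
have eBA x y : x \in B -> y \in A -> e x y by move=> xA yB; rewrite eE xA yB orbT.
rewrite !in_setU => /orP[iX|iX] /orP[jX|jX].
- exact: minor_reduce eAB AB iX jX.
- rewrite !rmorphM /= (ev_minor_l _ iX) (ev_minor_r _ jX) !mulr0 !subr0.
  by apply: (hiM hI); apply/minor_IG/eAB.
- rewrite !rmorphM /= (ev_minor_l _ iX) (ev_minor_r _ jX) !mulr0 !subr0.
  by apply: (hiM hI); apply/minor_IG/eBA.
- by rewrite addrAC; apply: minor_reduce eBA BA' iX jX.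
Qed.

Lemma in_IG_cap p : IG p <->
  capI (segI col C set0) (capI (varI (vars A)) (varI (vars B))) p.
Proof.
have hS := segI_hideal K col C set0.
have hA := varI_hideal K (vars A); have hB := varI_hideal K (vars B).
split.
  apply: in_IG_sub; first by apply: hideal_capI => //; apply: hideal_capI.
  have main x y : x \in A -> y \in B ->
      capI (segI col C set0) (capI (varI (vars A)) (varI (vars B))) (bg x y).
    move=> xA yB; rewrite -minor_bgen //; split.
      by apply: segI_minor; rewrite in_setU ?xA ?yB ?orbT.
    by split; [apply: ev_minor_l | apply: ev_minor_r].
  by move=> x y; rewrite eE => /orP[] /andP[xX yX]; [|rewrite bgenC]; apply: main.
move=> [Sp [Ap Bp]].
suff gp : genI fm p by have := minors_reduce gp; rewrite Ap Bp !subr0.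
have hG := genI_hideal fm2.
apply: (seg_gen hG) Sp => [q [c ->]|i j iC jC|t].
- apply: (hi_sum hS) => -[i j] _; apply: (hiM hS); rewrite /fm /=.
  by case: ifP => [/andP[iC jC]|_]; [apply: segI_minor | apply: hi0].
- have -> : mn i j = fm (i, j) by rewrite /fm /= iC jC.
  exact: genI_mem.
- by rewrite inE.
Qed.

Lemma sum_varI (W W' : {set 'I_n}) p : varI (vars (W :|: W')) p <->
  sumI (varI (K := K) (vars W)) (varI (vars W')) p.
Proof.
have hW := varI_hideal K (vars W); have hW' := varI_hideal K (vars W').
have hU := varI_hideal K (vars (W :|: W')).
split=> [|[a [ha hb]]].
  apply: varI_sub; first exact: hideal_sumI.
  move=> t; rewrite varsU in_setU => /orP[tW|tW].
    by exists 'X_t; split; [apply: varI_X | rewrite subrr; apply: hi0].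
  by exists 0; split; [apply: hi0 | rewrite subr0; apply: varI_X].
have sW : vars W \subset vars (W :|: W') by rewrite varsU subsetUl.
have sW' : vars W' \subset vars (W :|: W') by rewrite varsU subsetUr.
by have := hiD hU (varIS sW ha) (varIS sW' hb); rewrite addrC subrK.
Qed.

Lemma sum_segI p : varI (vars C) p <-> sumI (segI (K := K) col C A) (segI col C B) p.
Proof.
have hA := segI_hideal K col C A; have hB := segI_hideal K col C B.
have hU := varI_hideal K (vars C).
split=> [|[a [ha hb]]].
  apply: varI_sub; first exact: hideal_sumI.
  move=> t; rewrite inE in_setU => /orP[tW|tW].
    by exists 'X_t; split; [apply: segI_var | rewrite subrr; apply: hi0].
  by exists 0; split; [apply: hi0 | rewrite subr0; apply: segI_var].
have top q : segI col C C q -> varI (vars C) q by apply: (proj1 (segI_top col q (subxx C))).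
have h1 : segI col C C a by apply: segIS ha.
have h2 : segI col C C (p - a) by have := segIS A hb; rewrite [B :|: A]setUC.
by have := hiD hU (top _ h1) (top _ h2); rewrite addrC subrK.
Qed.

(* Inclusion-exclusion on the restrictions of [p] to [A] and to [B]. *)
Lemma sum_seg_cap p : capI (segI (K := K) col C A) (segI col C B) p <->
  sumI (segI col C set0) (capI (varI (vars A)) (varI (vars B))) p.
Proof.
have hS := segI_hideal K col C set0.
split=> [[Ap Bp]|[a [ha [hA hB]]]]; last first.
  have h0 (W : {set 'I_n}) : varI (vars W) (p - a) -> segI col C W p.
    move=> h; have := segIS W ha; rewrite set0U => ha'.
    by have := hiD (segI_hideal K col C W) ha' (varI_segI col C h); rewrite addrC subrK.
  by split; apply: h0.
have hE (W : {set 'I_n}) : segI col C W p -> segI col C set0 (ev (vars W) p).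
  by rewrite /segI sev_ev set0U.
exists (ev (vars A) p + ev (vars B) p - ev (vars C) p); split.
  apply: (hiB hS); first by apply: (hiD hS); apply: hE.
  by apply: hE; apply: segIS Ap.
have EC (W : {set 'I_n}) : W \subset C -> ev (vars W) (ev (vars C) p) = ev (vars C) p.
  by move=> /setUidPr sW; rewrite ev_ev -varsU sW.
have EAB : ev (vars A) (ev (vars B) p) = ev (vars C) p by rewrite ev_ev -varsU.
have EBA : ev (vars B) (ev (vars A) p) = ev (vars C) p by rewrite ev_ev -varsU setUC.
have EW (W : {set 'I_n}) : ev (vars W) (ev (vars W) p) = ev (vars W) p.
  by rewrite ev_ev setUid.
split; rewrite /varI !(rmorphB, rmorphD) /= EW ?EAB ?EBA EC ?subsetUl ?subsetUr //; ring.
Qed.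

(** Mayer-Vietoris is nested. The sum of the minor ideal with the intersection of the two variable
    ideals is, by [sum_seg_cap], an intersection of two ideals of regularity 1 whose sum has
    regularity 0; it has regularity 1, and the outer step gives 2. *)
Lemma complete_bipartite_regle : regle 2 IG.
Proof.
have hS := segI_hideal K col C set0.
have hA := varI_hideal K (vars A); have hB := varI_hideal K (vars B).
have hSA := segI_hideal K col C A; have hSB := segI_hideal K col C B.
have rV (D : {set 'I_(n + n)}) : regle 1 (varI (K := K) D).
  by apply: (@regle_mono _ _ 0) => //; apply: regle_varI.
apply: (@regle_ext _ _ _ (capI (segI col C set0) (capI (varI (vars A)) (varI (vars B))))).
  by move=> p; apply: iff_sym; apply: in_IG_cap.
apply: regle_capI => //.
- exact: hideal_capI.
- by apply: (@regle_mono _ _ 1) => //; apply: regle_segI.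
- apply: (@regle_mono _ _ 1) => //; apply: regle_capI => //.
  by apply: regle_ext (@regle_varI _ _ _); apply: sum_varI.
apply: regle_ext sum_seg_cap _; apply: regle_capI => //; try exact: regle_segI.
by apply: regle_ext (@regle_varI _ _ _); apply: sum_segI.
Qed.

Lemma complete_bipartite_pure : simple_graph e -> pure_resolution K e.
Proof.
move=> he p [[j /bettiP bpj] _] i /andP[i1 ip].
have h2 := @edge_gen2 K n e; have ind := @edge_gen_indep K n e.
have toG a b : hz (genI (@edge_gen K n e)) a b -> hz IG a b.
  by apply: hz_ext => q; apply: iff_sym; apply: in_IG_genI.
have degE a b : (0 < a)%N -> betti_nz K e a b -> b = if a == 1%N then 2%N else a.+2.
  move=> a0 /bettiP nh.
  have ab : (a <= b)%N by rewrite leqNgt; apply: contra_notN nh => lt; apply: hz_gt.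
  have ba : (b <= a + 2)%N.
    by rewrite leqNgt; apply: contra_notN nh => lt; apply: complete_bipartite_regle.
  have b1 : b != a.
    by apply: contra_notN nh => /eqP->; case: (a) a0 => // c _; apply/toG/hz_diag.
  move: ab ba b1; case: a a0 nh => [//|[|a]] _ nh.
    case: b nh => [|[|[|[|b]]]] //= nh _ _ _.
    by case: nh; apply/toG/hz_gens.
  rewrite /= addn2 leq_eqVlt => /orP[/eqP->|]; first by rewrite eqxx.
  rewrite leq_eqVlt => /orP[/eqP Eb|lt le _]; last by apply/eqP; rewrite eqn_leq le.
  by case: nh; rewrite -Eb; apply/toG/hz_linear.
have [d bd] : exists d, betti_nz K e i d.
  apply: NNPP => nb; apply: bpj; apply: (koszul_rigid hI ip) => d.
  by apply: NNPP => nh; apply: nb; exists d; apply/bettiP.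
exists d; split=> [|d' [_ bd']]; last by rewrite (degE _ _ i1 bd) (degE _ _ i1 bd').
by split=> //; rewrite (degE _ _ i1 bd); case: ifP.
Qed.

End CompleteBipartite.

(** * Graphs without pure resolution *)

Section SyzygyMatrix.
Variables (K : fieldType) (k : nat) (F : finType) (f : F -> {mpoly K[k]}).
Local Notation S := {mpoly K[k]}.
Hypothesis hf : forall e, f e \is 2.-homog.
Hypothesis indep : forall l : F -> S, (forall e, l e \is 1.-homog) ->
  \sum_e l e * f e = 0 -> forall e, l e = 0.

Lemma sum_index (T : finType) (x0 : T) (l : seq T) (g : T -> nat -> S) : uniq l ->
  \sum_(x : T) (if x \in l then g x (index x l) else 0) =
  \sum_(0 <= i < size l) g (nth x0 l i) i.
Proof.
move=> ul; rewrite -big_mkcond -big_uniq //= (big_nth x0).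
by apply: eq_big_nat => i /andP[_ lt]; rewrite index_uniq.
Qed.

(* Row [a] of [M] lists the entries of a second syzygy at the generator [l`_a],
   its columns are indexed by the variables [ts]. *)
Lemma second_syzygy_matrix (e0 : F) (t0 : 'I_k) (l : seq F) (ts : seq 'I_k)
    (M : nat -> nat -> S) :
  uniq l -> uniq ts ->
  (forall a b, (a < size l)%N -> (b < size ts)%N -> M a b \is 2.-homog) ->
  (forall a, (a < size l)%N ->
     \sum_(0 <= b < size ts) 'X_(nth t0 ts b) * M a b = 0) ->
  (forall b, (b < size ts)%N -> \sum_(0 <= a < size l) M a b * f (nth e0 l a) = 0) ->
  hz (genI f) 3 5 ->
  forall a b, (a < size l)%N -> (b < size ts)%N -> M a b = 0.
Proof.
move=> ul uts hM hrow hcol h a b la lb.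
pose r e t := if e \in l then if t \in ts then M (index e l) (index t ts) else 0 else 0.
have := second_syzygy0 hf indep (r := r) h.
move=> /(_ _ _ _ (nth e0 l a) (nth t0 ts b)); rewrite /r !mem_nth // !index_uniq //.
apply=> [e t|e|t].
- case: ifP => el; last exact: rpred0.
  by case: ifP => tts; rewrite ?rpred0 // hM // index_mem.
- case el: (e \in l); last by rewrite big1 // => t _; rewrite mulr0.
  have := hrow (index e l); rewrite index_mem => /(_ el) E; rewrite -[RHS]E.
  rewrite -(sum_index t0 (fun t b => 'X_t * M (index e l) b) uts).
  by apply: eq_bigr => t _; case: ifP; rewrite ?mulr0.
case: (boolP (t \in ts)) => tts; last first.
  by rewrite big1 // => e _; rewrite if_same mul0r.
have := hcol (index t ts); rewrite index_mem => /(_ tts) E; rewrite -[RHS]E.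
rewrite -(sum_index e0 (fun e a => M a (index t ts) * f e) ul).
by apply: eq_bigr => e _; case: ifP; rewrite ?mul0r.
Qed.

End SyzygyMatrix.

(** * Small subgraphs that force a Betti number *)

Section Betti.
Variables (K : fieldType) (n : nat) (e : rel 'I_n).
Hypothesis he : simple_graph e.
Local Notation S := {mpoly K[n + n]}.
Local Notation bg := (@bgen K n).
Local Notation XX i := ('X_(vx true i) : S).
Local Notation YY i := ('X_(vx false i) : S).
Implicit Types (i j l x y z : 'I_n).

Lemma hz_edge_gen (i j : nat) : hz (@in_IG K n e) i j -> hz (genI (@edge_gen K n e)) i j.
Proof. by apply: hz_ext => p; apply: in_IG_genI. Qed.

Lemma mk_edge_eq x y x' y' (h : e x y) (h' : e x' y') :
  mk_edge he h = mk_edge he h' -> (x = x' /\ y = y') \/ (x = y' /\ y = x').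
Proof.
move=> /(congr1 val) /=; rewrite /sort2.
by case: (ltnP x y); case: (ltnP x' y') => _ _ [-> ->]; [left|right|right|left].
Qed.

Lemma homXX b c i j : ('X_(vx b i) * 'X_(vx c j) : S) \is 2.-homog.
Proof. by apply: (@dhomogM _ _ _ 1 _ 1); apply: dhomogU. Qed.

Lemma star_betti v a b c : e v a -> e v b -> e v c -> a != b -> a != c -> b != c ->
  betti_nz K e 3 5.
Proof.
move=> va vb vc ab ac bc; apply/bettiP => h0; have h := hz_edge_gen h0.
have [es ei] := he.
pose l := [:: mk_edge he va; mk_edge he vb; mk_edge he vc].
pose ts := [:: vx true v; vx false a; vx false b; vx false c].
(* [x_v (D_bc, - D_ac, D_ab)] is a combination of the Koszul syzygies of the three edges. *)
pose D i j := XX i * YY j - YY i * XX j.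
pose M := [:: [:: D b c; 0; bg v c; - bg v b];
              [:: - D a c; - bg v c; 0; bg v a];
              [:: D a b; bg v b; - bg v a; 0]].
have nv x : e v x -> v != x by move=> vx; apply: contraTneq vx => <-; rewrite ei.
have ul : uniq l.
  rewrite /= !inE !negb_or !andbT; apply/andP; split; first apply/andP; first split.
  - apply/eqP => /mk_edge_eq [[_ E]|[E _]]; first by rewrite E eqxx in ab.
    by have := nv _ vb; rewrite E eqxx.
  - apply/eqP => /mk_edge_eq [[_ E]|[E _]]; first by rewrite E eqxx in ac.
    by have := nv _ vc; rewrite E eqxx.
  - apply/eqP => /mk_edge_eq [[_ E]|[E _]]; first by rewrite E eqxx in bc.
    by have := nv _ vc; rewrite E eqxx.
have uts : uniq ts by rewrite /= !inE !negb_or !vx_eq /= ab ac bc.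
have hD i j : D i j \is 2.-homog by rewrite rpredB ?homXX.
have H (i j : nat) : (i < size l)%N -> (j < size ts)%N -> (nth [::] M i)`_j = 0.
  apply: (second_syzygy_matrix (@edge_gen2 K n e) (@edge_gen_indep K n e)
    (e0 := mk_edge he va) (t0 := vx true v) (l := l) (ts := ts)
    (M := fun i j : nat => (nth [::] M i)`_j) ul uts _ _ _ h) => {i j}.
  - have hN (p : S) : p \is 2.-homog -> - p \is 2.-homog by rewrite rpredN.
    move=> [|[|[|i]]] [|[|[|[|j]]]] // _ _.
    + exact: hD. + exact: rpred0. + exact: bgen2. + by apply: hN; exact: bgen2.
    + by apply: hN; exact: hD. + by apply: hN; exact: bgen2. + exact: rpred0. + exact: bgen2.
    + exact: hD. + exact: bgen2. + by apply: hN; exact: bgen2. + exact: rpred0.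
  - move=> [|[|[|i]]] //= _; rewrite !big_nat_recl // big_geq //= !bgenE /D; ring.
  move=> [|[|[|[|j]]]] //= _; rewrite !big_nat_recl // big_geq //= !edge_gen_mk !bgenE /D; ring.
have D0 : D b c = 0 := H 0%N 0%N isT isT.
have : (ev [set vx false b] (D b c)) != 0.
  rewrite /D rmorphB !rmorphM /= ev1X mul0r subr0.
  rewrite !ev_neq ?vx_eq ?(eq_sym c) ?(negbTE bc) //.
  by rewrite mulf_neq0 // mpolyX_neq0.
by rewrite D0 rmorph0 eqxx.
Qed.

(** The first two columns of [M] are syzygies of the whole 4-cycle with monomial entries, the third
    is the Koszul syzygy of the edges at [v]. With coefficients [y_v], [x_v], [x_w] the columns sum
    to zero. *)
Lemma four_cycle_betti v w a b : e v a -> e v b -> e w a -> e w b -> v != w -> a != b ->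
  betti_nz K e 3 5.
Proof.
move=> va vb wa wb vw ab; apply/bettiP => h0; have h := hz_edge_gen h0.
have [es ei] := he.
pose l := [:: mk_edge he va; mk_edge he vb; mk_edge he wa; mk_edge he wb].
pose ts := [:: vx false v; vx true v; vx true w].
pose M := [:: [:: YY b * XX w; - (XX w * XX b); bg v b];
              [:: - (YY a * XX w); XX w * XX a; - bg v a];
              [:: - (YY b * XX v); YY b * YY v; 0];
              [:: YY a * XX v; - (YY a * YY v); 0]].
have ne x y : e x y -> x != y by move=> xy; apply: contraTneq xy => <-; rewrite ei.
have ul : uniq l.
  rewrite /= !inE !negb_or !andbT -!andbA; apply/and5P; split.
  - apply/eqP => /mk_edge_eq [[_ E]|[E _]]; first by rewrite E eqxx in ab.
    by have := ne _ _ vb; rewrite E eqxx.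
  - apply/eqP => /mk_edge_eq [[E _]|[E _]]; first by rewrite E eqxx in vw.
    by have := ne _ _ va; rewrite E eqxx.
  - apply/eqP => /mk_edge_eq [[E _]|[E _]]; first by rewrite E eqxx in vw.
    by have := ne _ _ vb; rewrite E eqxx.
  - apply/eqP => /mk_edge_eq [[E _]|[E _]]; first by rewrite E eqxx in vw.
    by have := ne _ _ va; rewrite E eqxx.
  apply/andP; split.
    apply/eqP => /mk_edge_eq [[E _]|[E _]]; first by rewrite E eqxx in vw.
    by have := ne _ _ vb; rewrite E eqxx.
  apply/eqP => /mk_edge_eq [[_ E]|[E _]]; first by rewrite E eqxx in ab.
  by have := ne _ _ wb; rewrite E eqxx.
have uts : uniq ts by rewrite /= !inE !negb_or !vx_eq /= vw.
have H (i j : nat) : (i < size l)%N -> (j < size ts)%N -> (nth [::] M i)`_j = 0.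
  apply: (second_syzygy_matrix (@edge_gen2 K n e) (@edge_gen_indep K n e)
    (e0 := mk_edge he va) (t0 := vx true v) (l := l) (ts := ts)
    (M := fun i j : nat => (nth [::] M i)`_j) ul uts _ _ _ h) => {i j}.
  - have hN (p : S) : p \is 2.-homog -> - p \is 2.-homog by rewrite rpredN.
    move=> [|[|[|[|i]]]] [|[|[|j]]] // _ _.
    + exact: homXX. + by apply: hN; exact: homXX. + exact: bgen2.
    + by apply: hN; exact: homXX. + exact: homXX. + by apply: hN; exact: bgen2.
    + by apply: hN; exact: homXX. + exact: homXX. + exact: rpred0.
    + exact: homXX. + by apply: hN; exact: homXX. + exact: rpred0.
  - move=> [|[|[|[|i]]]] //= _; rewrite !big_nat_recl // big_geq //= ?bgenE; ring.
  move=> [|[|[|j]]] //= _; rewrite !big_nat_recl // big_geq //= !edge_gen_mk !bgenE; ring.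
have : YY b * XX w = 0 := H 0%N 0%N isT isT.
by move/eqP; rewrite mulf_eq0 !(negbTE (mpolyX_neq0 _ _)).
Qed.

Lemma triangle_betti a b c : e a b -> e b c -> e c a -> betti_nz K e 3 6.
Proof.
move=> ab bc ca; have [es ei] := he.
have ne x y : e x y -> x != y by move=> xy; apply: contraTneq xy => <-; rewrite ei.
have us : uniq [:: a; b; c].
  by rewrite /= !inE !negb_or (ne _ _ ab) (ne _ _ bc) eq_sym (ne _ _ ca).
have [cI rI _] := path_ci (ci0 K (n + n)) us (fun l _ => @vfree0 K n l).
have c3 := ciS cI (bgen2 K _ _) (rI isT).
apply: (@ci_induced_betti K n e [set a; b; c] 3 [:: bg a b; bg b c; bg c a] c3 _ _ 3) => //.
  move=> f; rewrite !inE => /or3P[] /eqP->; [exists a, b|exists b, c|exists c, a];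
    by rewrite /induced !inE !eqxx ?orbT ?ab ?bc ?ca.
move=> x y /and3P[]; rewrite !inE -!orbA => /or3P[] /eqP-> /or3P[] /eqP->; rewrite ?ei //.
all: by move=> _; rewrite ?eqxx ?orbT // bgenC eqxx ?orbT.
Qed.

Lemma induced_path4_betti a b c d : uniq [:: a; b; c; d] -> e a b -> e b c -> e c d ->
  ~~ e a c -> ~~ e a d -> ~~ e b d -> betti_nz K e 3 6.
Proof.
move=> us ab bc cd nac nad nbd; have [es ei] := he.
have [cI _ _] := path_ci (ci0 K (n + n)) us (fun l _ => @vfree0 K n l).
apply: (@ci_induced_betti K n e [set a; b; c; d] 3 [:: bg a b; bg b c; bg c d] cI _ _ 3) => //.
  move=> f; rewrite !inE => /or3P[] /eqP->; [exists a, b|exists b, c|exists c, d];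
    by rewrite /induced !inE !eqxx ?orbT ?ab ?bc ?cd.
move=> x y /and3P[]; rewrite !inE -!orbA.
move=> /or4P[] /eqP-> /or4P[] /eqP->; rewrite ?ei ?(negbTE nac) ?(negbTE nad) ?(negbTE nbd) //.
all: rewrite es ?(negbTE nac) ?(negbTE nad) ?(negbTE nbd) //.
all: by move=> _; rewrite ?eqxx ?orbT // bgenC eqxx ?orbT.
Qed.

Lemma induced_path3_edge_betti a b c x y : uniq [:: a; b; c; x; y] ->
  e a b -> e b c -> e x y -> ~~ e a c ->
  (forall z, z \in [:: a; b; c] -> ~~ e z x /\ ~~ e z y) -> betti_nz K e 3 6.
Proof.
move=> us ab bc xy nac nxy; have [es ei] := he.
have := us; rewrite -[[:: a; b; c; x; y]]/([:: a; b; c] ++ [:: x; y]) cat_uniq.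
move=> /and3P[us1 /hasPn dis us2].
have [cI _ vI] := path_ci (ci0 K (n + n)) us1 (fun l _ => @vfree0 K n l).
have fI l : l \in [:: x; y] -> vfree (addL (@zeroI K n) (pairmap bg a [:: b; c])) l.
  by move=> /dis lx; apply: vI => //; apply: vfree0.
have [cJ _ _] := path_ci cI us2 fI.
have [xa xb xc] : [/\ ~~ e a x, ~~ e b x & ~~ e c x].
  by split; [case: (nxy a) | case: (nxy b) | case: (nxy c)]; rewrite ?inE ?eqxx ?orbT.
have [ya yb yc] : [/\ ~~ e a y, ~~ e b y & ~~ e c y].
  by split; [case: (nxy a) | case: (nxy b) | case: (nxy c)]; rewrite ?inE ?eqxx ?orbT.
pose ne := (ei, negbTE nac, (negbTE xa, negbTE xb, negbTE xc, (negbTE ya, negbTE yb, negbTE yc))).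
apply: (@ci_induced_betti K n e [set a; b; c; x; y] 3 [:: bg a b; bg b c; bg x y] cJ _ _ 3) => //.
  move=> f; rewrite !inE => /or3P[] /eqP->; [exists a, b|exists b, c|exists x, y];
    by rewrite /induced !inE !eqxx ?orbT ?ab ?bc ?xy.
move=> z w /and3P[]; rewrite !inE -!orbA.
move=> /or4P[/eqP->|/eqP->|/eqP->|/orP[]/eqP->] /or4P[/eqP->|/eqP->|/eqP->|/orP[]/eqP->].
all: rewrite ?ne //; rewrite 1?es ?ne //.
all: by move=> _; rewrite ?eqxx ?orbT // bgenC eqxx ?orbT.
Qed.

Lemma induced_path3_betti a b c : uniq [:: a; b; c] -> e a b -> e b c -> ~~ e a c ->
  betti_nz K e 2 4.
Proof.
move=> us ab bc nac; have [es ei] := he.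
have [cI _ _] := path_ci (ci0 K (n + n)) us (fun l _ => @vfree0 K n l).
apply: (@ci_induced_betti K n e [set a; b; c] 2 [:: bg a b; bg b c] cI _ _ 2) => //.
  move=> f; rewrite !inE => /orP[] /eqP->; [exists a, b|exists b, c];
    by rewrite /induced !inE !eqxx ?orbT ?ab ?bc.
move=> x y /and3P[]; rewrite !inE -!orbA.
move=> /or3P[] /eqP-> /or3P[] /eqP->; rewrite ?ei ?(negbTE nac) //.
all: rewrite es ?(negbTE nac) //.
all: by move=> _; rewrite ?eqxx ?orbT // bgenC eqxx ?orbT.
Qed.

End Betti.

(** * The long minimal syzygy of an even cycle *)

Section EvenCycle.
Variables (K : fieldType) (n : nat) (e : rel 'I_n).
Hypothesis he : simple_graph e.
Local Notation S := {mpoly K[n + n]}.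
Local Notation bg := (@bgen K n).
Variables (j : nat) (x : 'I_j.+3 -> 'I_n).
Hypothesis x_inj : injective x.
Hypothesis k_even : ~~ odd j.+3.
Hypothesis nbrS : forall a, e (x a) (x (ordS a)).
Hypothesis nbr_only : forall a y, e (x a) y -> y = x (ordS a) \/ exists2 b, a = ordS b & y = x b.
Implicit Types (a b l : 'I_j.+3) (y z : 'I_n).

Let cl a := ~~ odd a.
Let U a : 'I_(n + n) := vx (cl a) (x a).
Let V a : 'I_(n + n) := vx (~~ cl a) (x a).

Let U_inj a b : (U a == U b) = (a == b).
Proof.
apply/eqP/eqP => [/vx_inj[_ /x_inj]|->] //.
Qed.

Let UV a b : (U a == V b) = false.
Proof.
by apply/eqP => /vx_inj[+ /x_inj ab]; rewrite ab; case: (cl b).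
Qed.

(** Evenness of the length makes the colouring alternate across the closing edge too, so all
    generators become minors in [U] and [V] up to sign. *)
Let cl_ordS a : cl (ordS a) = ~~ cl a.
Proof. by rewrite /cl /= odd_mod ?(negbTE k_even). Qed.

Let ordS_val a : a != ord_max -> ordS a = a.+1 :> nat.
Proof.
move=> am; rewrite /= modn_small // ltn_neqAle ltn_ord andbT.
by apply: contra am => /eqP[Ea]; apply/eqP/val_inj.
Qed.

Let ordS_max : ordS (ord_max : 'I_j.+3) = ord0.
Proof. by apply/val_inj; rewrite /= modnn. Qed.

Let ordS_neq a : ordS a != a.
Proof. by apply/eqP => Ea; have := cl_ordS a; rewrite Ea; case: (cl a). Qed.

Let ordSS_neq a : ordS (ordS a) != a.
Proof.
case: (eqVneq a ord_max) => [->|am]; first by rewrite ordS_max -val_eqE.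
case: (eqVneq (ordS a) ord_max) => [Ea|am'].
  rewrite Ea ordS_max; apply/eqP => /(congr1 val) /= a0.
  by have := ordS_val am; rewrite Ea -a0.
apply/eqP => /(congr1 (@nat_of_ord _)); rewrite (ordS_val am') (ordS_val am) => /eqP.
by rewrite -addn2 -[X in _ == X]addn0 eqn_add2l.
Qed.

(** [Mo a] is the exponent of the product of the [U l] off the edge [a], and [PM a] that off the
    vertex [a]; [s] puts the signed monomials [Mo a] on the edges of the cycle and zero on all
    others. *)
Let Mo a : 'X_{1..n + n} := (\big[+%MM/0%MM]_(l | (l != a) && (l != ordS a)) U_(U l))%MM.
Let PM a : 'X_{1..n + n} := (\big[+%MM/0%MM]_(l | l != a) U_(U l))%MM.
Let E a := mk_edge he (nbrS a).
Let s (d : edge e) : S := \sum_(a : 'I_j.+3 | E a == d) (-1) ^+ (odd a) * 'X_[Mo a].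

Let E_inj : injective E.
Proof.
move=> a b /(congr1 val) /=; rewrite /sort2.
have H : (x a = x b) \/ (x a = x (ordS b) /\ x (ordS a) = x b) -> a = b.
  case=> [/x_inj //|[/x_inj Ea /x_inj Eb]].
  by have := ordSS_neq b; rewrite -Ea Eb eqxx.
case: (ltnP (x a) _) => _; case: (ltnP (x b) _) => _ [Ea Eb]; apply: H; auto.
Qed.

(** The sign makes the generator [U_a V_(a+1) - V_a U_(a+1)]. Multiplied by the monomial off the
    edge it is a difference of consecutive terms [PM l] times [V l], and the sum telescopes around
    the cycle. *)
Let cycle_relation : \sum_d s d * edge_gen K d = 0.
Proof.
transitivity (\sum_(a : 'I_j.+3) (-1) ^+ (odd a) * 'X_[Mo a] * edge_gen K (E a)).
  rewrite (partition_big E xpredT) //=; apply: eq_bigr => d _.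
  by rewrite mulr_suml; apply: eq_bigr => a /eqP ->.
have T a : (-1) ^+ (odd a) * 'X_[Mo a] * edge_gen K (E a) =
    'X_[PM (ordS a)] * 'X_(V (ordS a)) - 'X_[PM a] * 'X_(V a).
  have P1 : 'X_[PM (ordS a)] = 'X_[Mo a] * 'X_(U a) :> S.
    rewrite -mpolyXD /PM (bigD1 a) //=; last by rewrite eq_sym ordS_neq.
    by rewrite addmC; congr ('X_[_ + _]); apply: eq_bigl => l; rewrite andbC.
  have P2 : 'X_[PM a] = 'X_[Mo a] * 'X_(U (ordS a)) :> S.
    by rewrite -mpolyXD /PM (bigD1 (ordS a)) ?ordS_neq //= addmC.
  rewrite P1 P2 /E edge_gen_mk bgenE /U /V cl_ordS /cl.
  by case: (odd a) => /=; ring.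
under eq_bigr do rewrite T.
pose g a : S := 'X_[PM a] * 'X_(V a).
have R : \sum_(a : 'I_j.+3) g a = \sum_(a : 'I_j.+3) g (ordS a).
  exact: (reindex_inj (@ordS_inj _)).
by rewrite sumrB -/(\sum_a g (ordS a)) -R subrr.
Qed.

Let Mo_deg a : mdeg (Mo a) = j.+1.
Proof.
rewrite /Mo mdeg_sum (eq_bigr (fun=> 1%N)) => [|l _]; last by rewrite mdeg1.
rewrite sum1_card; have := cardC [set a; ordS a]; rewrite cards2 eq_sym ordS_neq card_ord.
move=> /(congr1 (subn^~ 2)); rewrite addKn !subSS subn0 => Ec; rewrite -[RHS]Ec.
by apply: eq_card => l; rewrite !inE negb_or.
Qed.

Let s_homog d : s d \is j.+1.-homog.
Proof.
apply: rpred_sum => a _; rewrite mulr_sign.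
by case: (odd a); rewrite ?rpredN dhomogX /= Mo_deg.
Qed.

Section Evaluate.
Variables (c : 'I_j.+3) (c0 : c != ord0) (cm : c != ord_max).

(* Sends all generators but the one of the closing edge to zero: vertex [c] is removed, the arc
   before [c] is mapped to points [(s_l, 0)] and the arc after it to points [(s_l, s_l z)], with
   [z = V_0]. *)
Let th (t : 'I_(n + n)) : S := if [pick l | (t == U l) || (t == V l)] is Some l then
  if l == c then 0 else if t == U l then 'X_(U l)
  else if (l < c)%N then 0 else 'X_(U l) * 'X_(V ord0) else 0.

Let psi : S -> S := mmap (@mpolyC (n + n) K) th.
HB.instance Definition _ := GRing.RMorphism.on psi.

Let thU l : th (U l) = if l == c then 0 else 'X_(U l).
Proof.
rewrite /th; case: pickP => [l' /orP[|]|/(_ l)]; rewrite ?eqxx //.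
  by rewrite U_inj => /eqP->; rewrite eqxx.
by rewrite UV.
Qed.

Let V_inj a b : (V a == V b) = (a == b).
Proof. by apply/eqP/eqP => [/vx_inj[_ /x_inj]|->]. Qed.

Let thV l : th (V l) = if l == c then 0 else if (l < c)%N then 0 else 'X_(U l) * 'X_(V ord0).
Proof.
rewrite /th; case: pickP => [l' /orP[|]|/(_ l)]; rewrite ?eqxx ?orbT //.
  by rewrite eq_sym UV.
by rewrite V_inj => /eqP <-; rewrite [V l == _]eq_sym UV.
Qed.

Let th_out (b : bool) y : (forall l, x l != y) -> th (vx b y) = 0.
Proof.
move=> h; rewrite /th; case: pickP => // l; rewrite !vx_eq ![y == _]eq_sym.
by rewrite (negbTE (h l)) !andbF.
Qed.

Let psiX (t : 'I_(n + n)) : psi 'X_t = th t.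
Proof. by rewrite /psi mmapX mmap1U. Qed.

Let psiC (a : K) : psi a%:MP = a%:MP.
Proof. by rewrite /psi mmapC. Qed.

Let psi_minor a : psi (bg (x a) (x (ordS a))) =
  if cl a then th (U a) * th (V (ordS a)) - th (V a) * th (U (ordS a))
  else th (V a) * th (U (ordS a)) - th (U a) * th (V (ordS a)).
Proof.
rewrite bgenE rmorphB !rmorphM /= !psiX /U /V cl_ordS.
by case: (cl a) => /=.
Qed.

Let psi_other a : a != ord_max -> psi (bg (x a) (x (ordS a))) = 0.
Proof.
move=> am; rewrite psi_minor; set z := th _ * _; set z' := th _ * _.
suff -> : z = z' by rewrite subrr if_same.
rewrite /z /z' !thU !thV (ordS_val am).
case: eqP => [_|ac]; first by rewrite !mul0r.
case: eqP => [_|ac']; first by rewrite !mulr0.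
have ca' : (c != a.+1 :> nat).
  by rewrite -(ordS_val am); apply/eqP => Ec; apply: ac'; apply: ord_inj; exact: esym Ec.
have ca : (a != c :> nat) by apply/eqP => Ec; apply: ac; apply: ord_inj.
case: (ltngtP a c) ca => // ac1 _; last by rewrite ltnNge (leqW (ltnW ac1)) /=; ring.
by rewrite ltn_neqAle eq_sym ca' ac1 mulr0 mul0r.
Qed.

Let psi_last : psi (bg (x ord_max) (x (ordS ord_max))) != 0.
Proof.
rewrite psi_minor ordS_max !thU !thV ![_ == c]eq_sym (negbTE cm) (negbTE c0).
(* Vertex 0 lies before [c] and the last vertex after it. The two ends of the closing edge thus
   receive non-proportional points, and its generator survives. *)
have -> : (@ord0 j.+2 < c)%N.
  by rewrite lt0n; apply: contra c0 => /eqP E0; apply/eqP; apply: ord_inj.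
have -> : (@ord_max j.+2 < c)%N = false by rewrite ltnNge -ltnS ltn_ord.
rewrite !mulr0; case: (cl _); rewrite ?sub0r ?subr0 ?oppr_eq0;
  by rewrite !mulf_neq0 // mpolyX_neq0.
Qed.

Let psi_edge d : d != E ord_max -> psi (edge_gen K d) = 0.
Proof.
case: d => -[y z] yz dE; rewrite /edge_gen /=.
have /andP[/= ltyz eyz] := yz.
case: (pickP (fun a => x a == y)) => [a /eqP xa|xy]; last first.
  have ty (b : bool) : th (vx b y) = 0 by apply: th_out => l; apply/negbT/xy.
  by rewrite bgenE rmorphB !rmorphM /= !psiX (ty true) (ty false) !mul0r subrr.
have main a' : bg y z = bg (x a') (x (ordS a')) ->
   ((x a' = y /\ x (ordS a') = z) \/ (x a' = z /\ x (ordS a') = y)) -> psi (bg y z) = 0.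
  move=> -> h; apply: psi_other; apply: contraNneq dE => Ea.
  apply/eqP/val_inj; rewrite /= -Ea /sort2.
  case: h => -[-> ->]; first by rewrite ltyz.
  by rewrite ltnNge (ltnW ltyz).
have := eyz; rewrite -{1}xa => /nbr_only [zE|[b ab zE]].
  by apply: (main a); [rewrite -xa zE | left; rewrite zE].
by apply: (main b); [rewrite -xa ab zE bgenC | right; rewrite -ab zE].
Qed.

Let Dc : {set 'I_(n + n)} := [set t | ~~ [exists l, (l != c) && (t == U l)]].

Let inDcU l : (U l \in Dc) = (l == c).
Proof.
rewrite inE; apply/negbLR; apply/existsP/idP => [[l' /andP[l'c]]|lc].
  by rewrite U_inj => /eqP ->.
by exists l; rewrite lc eqxx.
Qed.

(** Setting z to zero after [psi] leaves exactly the variables [U l] with [l] different from [c]. *)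
Let ev_psi p : ev [set V ord0] (psi p) = ev Dc p.
Proof.
apply: (rmorph_mpoly_eq (f := ev [set V ord0] \o psi) (g := ev Dc)) => [a|t] /=.
  by rewrite psiC !evC.
rewrite psiX evX.
case: (pickP (fun l => (t == U l) || (t == V l))) => [l /orP[] /eqP ->|ht].
- rewrite thU inDcU; case: eqP => _; first by rewrite rmorph0.
  by rewrite ev_neq // UV.
- rewrite thV inE; case: existsP => [[l' /andP[_]]|_]; first by rewrite eq_sym UV.
  case: ifP => _; first by rewrite rmorph0.
  by case: ifP => _; rewrite ?rmorph0 // rmorphM /= ev1X mulr0.
rewrite /th; case: pickP => [l|_]; first by rewrite ht.
rewrite rmorph0 inE; case: existsP => // -[l /andP[_ tU]].
by have := ht l; rewrite tU.
Qed.

(** Under [psi] only the term of the closing edge remains in the syzygy. Its generator has nonzero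
    image in a domain, so the image of its coefficient is zero. *)
Lemma syzygy_eval (r : edge e -> S) : \sum_d r d * edge_gen K d = 0 ->
  ev Dc (r (E ord_max)) = 0.
Proof.
move=> /(congr1 psi); rewrite rmorph0 rmorph_sum (bigD1 (E ord_max)) //= big1.
  rewrite addr0 rmorphM /E edge_gen_mk => /eqP.
  by rewrite mulf_eq0 (negbTE psi_last) orbF -ev_psi => /eqP->; rewrite rmorph0.
by move=> d dE; rewrite rmorphM /= psi_edge ?mulr0.
Qed.

Lemma syzygy_coef (r : edge e -> S) (m : 'X_{1..n + n}) : \sum_d r d * edge_gen K d = 0 ->
  (forall t, m t != 0%N -> exists2 l, l != c & t = U l) -> (r (E ord_max))@_m = 0.
Proof.
move=> /syzygy_eval r0 hm; rewrite -(mcoeff_ev (D := Dc)) ?r0 ?mcoeff0 // => t.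
rewrite inE => tD; apply/eqP; apply: contraNT tD => /hm [l lc ->].
by apply/existsP; exists l; rewrite lc eqxx.
Qed.

End Evaluate.

(** If the syzygy were not minimal, some syzygy [r t] would have, on the closing edge, the monomial
    [Mo ord_max] divided by a variable [U c]. As [Mo ord_max] is squarefree, that quotient avoids
    [U c], against [syzygy_coef] for this [c]. *)
Lemma even_cycle_betti : betti_nz K e 2 j.+3.
Proof.
apply/bettiP => h0.
have h : hz (genI (@edge_gen K n e)) 2 j.+3.
  by apply: hz_ext h0 => p; apply: in_IG_genI.
have [r [r0 sE]] := syzygy_decomp (@edge_gen2 K n e) h s_homog cycle_relation.
have := congr1 (mcoeff (Mo ord_max)) (sE (E ord_max)).
rewrite /s (big_pred1 ord_max) => [|a]; last by rewrite /= (inj_eq E_inj).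
rewrite mulr_sign raddf_sum big1 => [|t _] /=.
  case: (odd _); rewrite ?mcoeffN mcoeffX eqxx => /eqP; rewrite ?oppr_eq0 oner_eq0 //.
rewrite mulrC; case: (boolP (U_(t) <= Mo ord_max)%MM) => [le|/mcoeffMX_notle -> //].
have MoE t' : Mo ord_max t' =
    (\sum_(l : 'I_j.+3 | (l != ord_max) && (l != ord0)) (U l == t'))%N.
  by rewrite /Mo mnm_sumE ordS_max; apply: eq_bigr => l _; rewrite mnm1E.
have MoU c : c != ord_max -> c != ord0 -> Mo ord_max (U c) = 1%N.
  move=> cm c0; rewrite MoE (bigD1 c) ?cm //= eqxx big1 // => l /andP[_ lc].
  by rewrite U_inj (negbTE lc).
have Mo_ex t' : Mo ord_max t' != 0%N -> exists c, [/\ c != ord_max, c != ord0 & t' = U c].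
  rewrite MoE sum_nat_eq0 negb_forall => /existsP[c]; rewrite negb_imply eqb0 negbK.
  by move=> /andP[/andP[cm c0] /eqP <-]; exists c.
have [|c [cm c0 tc]] := Mo_ex t.
  by have /mnm_lepP/(_ t) := le; rewrite mnm1E eqxx -lt0n.
rewrite -(submK le) addmC mcoeffMX; apply: (syzygy_coef c0 cm (r0 t)) => t'.
rewrite mnmBE mnm1E => nz; have [|c' [cm' c0' tc']] := Mo_ex t'.
  by apply: contraNneq nz => ->.
exists c' => //; apply: contraNneq nz => cc.
by rewrite tc' tc cc MoU // eqxx.
Qed.

End EvenCycle.

(** * Consequences of purity in homological degree 3 *)

Section Pure.
Variables (K : fieldType) (n : nat) (e : rel 'I_n).
Hypothesis he : simple_graph e.
Let es : ssrbool.symmetric e := proj1 he.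
Let ei : irreflexive e := proj2 he.
Implicit Types (a b c v x y z : 'I_n) (s w : seq 'I_n).

Lemma betti_le i d : betti_nz K e i d -> (i <= n + n)%N /\ (i <= d)%N.
Proof.
have hI := in_IG_hideal K e.
move=> /bettiP nh; split; rewrite leqNgt; apply: contra_notN nh => lt.
  exact: hz_card.
exact: hz_gt.
Qed.

(** Purity is stated relative to a given projective dimension, so one has to be exhibited; it exists
    because homological degrees are bounded by the number of variables. *)
Lemma exists_pd i d : betti_nz K e i d -> exists2 p, (i <= p)%N & is_pd K e p.
Proof.
move: {2}(n + n - i)%N (leqnn (n + n - i)) => m.
elim: m i d => [|m IH] i d le bid.
  exists i => //; split=> [|i' j' lt /betti_le [le' _]]; first by exists d.
  by move: le; rewrite leqn0 subn_eq0 => /(leq_trans le'); rewrite leqNgt lt.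
case: (classic (exists i' j', (i < i')%N /\ betti_nz K e i' j')) => [[i' [j' [lt b']]]|nb].
  have [|p ip pd] := IH i' j' _ b'; last by exists p => //; apply: leq_trans (ltnW lt) ip.
  have [le' _] := betti_le b'.
  by rewrite -ltnS; apply: leq_trans le; rewrite ltn_sub2l // (leq_trans lt).
exists i => //; split=> [|i' j' lt b']; first by exists d.
by apply: nb; exists i', j'.
Qed.

Hypothesis pure : pure_resolution K e.

Lemma pure_unique i d d' : (0 < i)%N -> betti_nz K e i d -> betti_nz K e i d' -> d = d'.
Proof.
move=> i0 b b'; have [p ip hp] := exists_pd b.
have [|d0 [_ u]] := pure hp (i := i); first by rewrite i0.
have [_ id] := betti_le b; have [_ id'] := betti_le b'.
by rewrite -(u d) ?(u d') //; split=> //; apply: leq_trans i0 _.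
Qed.

(** Purity excludes beta_(3,6). Without triangles and induced 4-vertex paths, the neighbourhoods of
    [b] and [a] span a complete bipartite graph. An edge [x y] elsewhere would form with the path
    [b a b'] the third excluded subgraph; this is why [a] needs two neighbours. *)
Lemma bipartite_of_betti35 a b b' : betti_nz K e 3 5 -> e a b -> e a b' -> b != b' ->
  complete_bipartite e.
Proof.
move=> b35 ab ab' bb'.
have n36 : ~ betti_nz K e 3 6 by move=> b36; have := pure_unique (i := 3) isT b35 b36.
have ne x y : e x y -> x != y by move=> xy; apply: contraTneq xy => <-; rewrite ei.
have diff u x y : e u x -> e u y = false -> x != y.
  by move=> ux uy; apply: contraFneq uy => <-.
have tri x y z : e x y -> e y z -> e x z = false.
  by move=> xy yz; apply/negP => xz; apply: n36; apply: (triangle_betti K he xy yz); rewrite es.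
have p4 x y z t : e x y -> e y z -> e z t -> x != z -> y != t -> e x t.
  move=> xy yz zt xz yt; apply/negPn/negP => xt; apply: n36.
  apply: (@induced_path4_betti K n e he x y z t) => //; last 2 first.
  - by rewrite (tri _ _ _ xy yz).
  - by rewrite (tri _ _ _ yz zt).
  rewrite /= !inE !negb_or (ne _ _ xy) xz (ne _ _ yz) yt (ne _ _ zt) !andbT /=.
  by apply: contraTneq zt => <-; rewrite es (tri _ _ _ xy yz).
have ba : e b a by rewrite es.
exists [set x | e b x], [set x | e a x]; split.
- rewrite -setI_eq0; apply/eqP/setP => x; rewrite !inE; apply/negP => /andP[bx ax].
  by have := tri _ _ _ ab bx; rewrite ax.
- by apply/set0Pn; exists a; rewrite inE.
- by apply/set0Pn; exists b; rewrite inE.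
(* Ends of a walk of length three are adjacent, including degenerate walks that backtrack. *)
have one u v x y : e u v -> e v x -> e x y -> e u y.
  move=> uv vx xy; have [->|yv] := eqVneq y v; first by [].
  have [<-|xu] := eqVneq x u; first by [].
  by apply: (p4 u v x y) => //; rewrite eq_sym.
move=> x y; rewrite !inE; apply/idP/idP; last first.
  case/orP => /andP[hx hy].
    by apply: (one x b a y) => //; rewrite es.
  by apply: (one x a b y) => //; rewrite es.
move=> xy; case bx: (e b x); first by rewrite /= (one _ _ _ _ ab bx xy).
case ax: (e a x); first by rewrite /= (one _ _ _ _ ba ax xy).
have yx : e y x by rewrite es.
have b_y : e b y = false.
  by apply: contraFF ax => byy; apply: (one a b y x).
have a_y : e a y = false.
  by apply: contraFF bx => ayy; apply: (one b a y x).
have b'a : e b' a by rewrite es.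
(* A further neighbour of [b'] is also one of [b], by the path [z b' a b]; so an edge away from [a]
   and [b] misses [b'] as well. *)
have sb' z : e b' z -> e b z = false -> z != a -> False.
  move=> b'z bz za; have : e z b.
    by apply: (p4 z b' a b) => //; rewrite 1?es // eq_sym.
  by rewrite es bz.
have b'x : e b' x = false.
  by apply/negP => h; apply: (sb' x) => //; apply: contraFneq a_y => <-.
have b'y : e b' y = false.
  by apply/negP => h; apply: (sb' y) => //; apply: contraFneq ax => <-.
have bb0 : e b b' = false by apply: tri ba ab'.
have n_a z : e b z = false -> z != a by move=> bz; rewrite eq_sym; apply: diff ba bz.
have n_b z : e a z = false -> z != b by move=> az; rewrite eq_sym; apply: diff ab az.
have n_b' z : e a z = false -> z != b' by move=> az; rewrite eq_sym; apply: diff ab' az.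
case: n36; apply: (@induced_path3_edge_betti K n e he b a b' x y) => //.
- rewrite /= !inE !negb_or !andbT (ne _ _ ba) bb' (ne _ _ ab') (ne _ _ xy) /=.
  rewrite ![_ == x]eq_sym ![_ == y]eq_sym (n_a x) // (n_a y) // (n_b x) // (n_b y) //.
  by rewrite (n_b' x) // (n_b' y).
- by rewrite bb0.
by move=> z; rewrite !inE => /or3P[] /eqP->; rewrite ?bx ?b_y ?ax ?a_y ?b'x ?b'y.
Qed.

End Pure.

(** * Components of graphs of maximal degree two *)

Section Components.
Variables (n : nat) (e : rel 'I_n).
Hypothesis he : simple_graph e.
Let es : ssrbool.symmetric e := proj1 he.
Let ei : irreflexive e := proj2 he.
Implicit Types (a b c v x y z : 'I_n) (s w : seq 'I_n).

(** A path through [v] is prolonged at either end while possible; [m] bounds the number of vertices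
    still outside it. *)
Lemma maximal_path v : exists i w, [/\ path e i w, uniq (i :: w), v \in i :: w,
  forall y, e i y -> y \in i :: w & forall y, e (last i w) y -> y \in i :: w].
Proof.
have H m i w : (n <= m + size (i :: w))%N -> path e i w -> uniq (i :: w) -> v \in i :: w ->
  exists i w, [/\ path e i w, uniq (i :: w), v \in i :: w,
    forall y, e i y -> y \in i :: w & forall y, e (last i w) y -> y \in i :: w].
  elim: m i w => [|m IH] i w le pw uw vw.
    have all_in y : y \in i :: w.
      apply/negPn/negP => yw; have := max_card (mem (y :: i :: w)).
      have /card_uniqP -> : uniq (y :: i :: w) by rewrite cons_uniq yw.
      by rewrite card_ord /= ltnNge le.
    by exists i, w; split.
  case: (classic (exists2 y, e i y & y \notin i :: w)) => [[y iy yw]|hi].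
    apply: (IH y (i :: w)).
    - by rewrite /= -addSnnS.
    - by rewrite /= es iy.
    - by rewrite cons_uniq yw.
    - by rewrite in_cons vw orbT.
  case: (classic (exists2 y, e (last i w) y & y \notin i :: w)) => [[y iy yw]|hl].
    apply: (IH i (rcons w y)).
    - by rewrite /= size_rcons -addSnnS.
    - by rewrite rcons_path pw.
    - by rewrite -rcons_cons rcons_uniq yw.
    - by rewrite -rcons_cons mem_rcons in_cons vw orbT.
  exists i, w; split=> // z ez; apply/negPn/negP => zw; [apply: hi | apply: hl];
    by exists z.
apply: (H n v [::]) => //; first exact: leq_addr.
by rewrite mem_head.
Qed.

Hypothesis deg2 : forall v a b c, e v a -> e v b -> e v c -> [\/ a = b, a = c | b = c].

Section MaximalPath.
Variables (i : 'I_n) (w : seq 'I_n).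
Hypotheses (pw : path e i w) (uw : uniq (i :: w)).
Hypothesis endi : forall y, e i y -> y \in i :: w.
Hypothesis endl : forall y, e (last i w) y -> y \in i :: w.
Let f p := nth i (i :: w) p.
Let k := size w.

Let f_inj p q : (p <= k)%N -> (q <= k)%N -> f p = f q -> p = q.
Proof. by move=> pk qk /eqP; rewrite nth_uniq // => /eqP. Qed.

Let fS p : (p < k)%N -> e (f p) (f p.+1).
Proof. by move=> pk; move/(pathP i): pw => /(_ p pk). Qed.

Let fk : f k = last i w.
Proof. by rewrite /f /k (last_nth i). Qed.

Let mem_f x : x \in i :: w -> exists2 p, (p <= k)%N & x = f p.
Proof.
move=> xw; exists (index x (i :: w)); last by rewrite /f nth_index.
by rewrite -ltnS; have := xw; rewrite -index_mem.
Qed.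

Let f_mem p : (p <= k)%N -> f p \in i :: w.
Proof. by move=> pk; rewrite mem_nth. Qed.

Let nbr_inner p z : (p.+1 < k)%N -> e (f p.+1) z -> z = f p \/ z = f p.+2.
Proof.
move=> pk ez; have e1 := fS pk; have e0 := fS (ltnW pk); rewrite es in e0.
case: (deg2 e0 e1 ez) => [E|->|->]; [|by left|by right].
have /eqP := f_inj (ltnW (ltnW pk)) pk E.
by rewrite -[p.+2]addn2 -{1}[p]addn0 eqn_add2l.
Qed.

(** An inner vertex already has its two neighbours on the path, so a chord can only join the two
    ends. *)
Lemma maximal_adjacent p q : (p < q)%N -> (q <= k)%N -> e (f p) (f q) ->
  q = p.+1 \/ (p = 0%N /\ q = k).
Proof.
move=> pq qk epq; have pk := leq_trans pq qk.
case: p => [|p] in pq epq pk *; last first.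
  have [lt|] := ltnP p.+1 k; last by rewrite leqNgt pk.
  case: (nbr_inner lt epq) => /f_inj E; [|by left; apply: E].
  by move: pq; rewrite E ?(ltnW (ltnW pk)) // ltnNge (leqW (leqnn p)).
case: (ltngtP q k) qk => // [qk _|->]; last by right.
case: q => [//|q] in pq epq qk *; rewrite es in epq.
case: (nbr_inner qk epq) => /f_inj E; left.
  by rewrite -E // ltnW // ltnW.
by have := E (leq0n _) qk.
Qed.

Lemma maximal_closed x y : x \in i :: w -> e x y -> y \in i :: w.
Proof.
move=> /mem_f [p pk ->] ey.
case: p pk ey => [|p] pk ey; first exact: endi.
move: pk; rewrite leq_eqVlt => /orP[/eqP Ep|lt].
  by apply: endl; rewrite -fk -Ep.
by case: (nbr_inner lt ey) => ->; apply: f_mem => //; apply: ltnW; apply: ltnW.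
Qed.

Lemma maximal_component v : v \in i :: w -> component e v =i i :: w.
Proof.
have sw x : x \in i :: w -> connect e i x by apply: path_connect.
have es' := sym_connect_sym es.
move=> vw x; rewrite inE; apply/idP/idP => [/connectP[t pt ->]|xw].
  by elim: t v vw pt => [|y t IH] v vw //= /andP[vy pt]; apply: IH pt; apply: maximal_closed vy.
by apply: connect_trans (sw x xw); rewrite es'; apply: sw.
Qed.

(** The guard [1 < k] is there because for [k = 1] the edge between the two ends is the path
    itself. *)
Lemma maximal_is_path v : v \in i :: w -> ~~ ((1 < k)%N && e (f 0) (f k)) ->
  is_path_on e (component e v).
Proof.
move=> vw nc; exists (i :: w); split=> // [|x y]; first exact: maximal_component.
rewrite !(maximal_component vw) => /mem_f [p pk ->] /mem_f [q qk ->].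
apply/idP/consecP.
  have main p' q' : (p' < q')%N -> (q' <= k)%N -> e (f p') (f q') -> q' = p'.+1.
    move=> pq' qk' epq; case: (maximal_adjacent pq' qk' epq) => // -[p0 qk0].
    move: nc; rewrite -p0 -qk0 epq andbT -leqNgt => q1.
    by apply/eqP; rewrite eqn_leq pq' (leq_trans q1).
  case: (ltngtP p q) => [lt|lt|->] epq.
  - have Eq := main _ _ lt qk epq; subst q; exists p => //; left; split=> //.
  - rewrite es in epq; have Eq := main _ _ lt pk epq; subst p; exists q => //; right; split=> //.
  - by rewrite ei in epq.
by case=> r rk [[<- <-]|[<- <-]]; [|rewrite es]; apply: fS.
Qed.

(** [k] counts the edges of the path, so the cycle has [k.+1] vertices and is odd when [k] is
    even. *)
Lemma maximal_is_cycle v : v \in i :: w -> (1 < k)%N -> e (f 0) (f k) -> ~~ odd k ->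
  is_odd_cycle_on e (component e v).
Proof.
move=> vw k1 ck ok; exists (i :: w); split=> // [|x y]; first exact: maximal_component.
rewrite !(maximal_component vw) => xw yw /=.
have nthr r : (r <= k)%N -> nth i (i :: rcons w i) r = f r.
  by move=> rk; rewrite -rcons_cons nth_rcons /= ltnS rk.
apply/idP/consecP.
  have main p' q' : (p' < q')%N -> (q' <= k)%N -> e (f p') (f q') ->
    exists2 r, (r < size (rcons w i))%N &
      (nth i (i :: rcons w i) r = f p' /\ nth i (rcons w i) r = f q') \/
      (nth i (i :: rcons w i) r = f q' /\ nth i (rcons w i) r = f p').
    move=> pq' qk' epq; have pk' := leq_trans pq' qk'; rewrite size_rcons -/k.
    case: (maximal_adjacent pq' qk' epq) => [qE|[p0 qE]].
      subst q'; exists p'; first exact: ltnW.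
      by left; rewrite nthr ?(ltnW pk') // -[X in nth i _ X]/(p'.+1.-1) -(nthr p'.+1).
    subst p' q'; exists k => //; right; rewrite nthr //; split=> //.
    by rewrite nth_rcons ltnn eqxx.
  case/mem_f: xw => p pk ->; case/mem_f: yw => q qk ->.
  case: (ltngtP p q) => [lt|lt|->] epq; last by rewrite ei in epq.
    exact: main.
  rewrite es in epq; have [r rk h] := main _ _ lt pk epq; exists r => //.
  by case: h => h; [right | left].
have main r : (r < size (rcons w i))%N -> e (nth i (i :: rcons w i) r) (nth i (rcons w i) r).
  rewrite size_rcons ltnS leq_eqVlt -/k => /orP[/eqP->|rk].
    by rewrite nthr // nth_rcons ltnn eqxx es.
  by rewrite nthr ?(ltnW rk) // -[nth i (rcons w i) r]/(nth i (i :: rcons w i) r.+1) nthr //; apply: fS.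
by case=> r rk [[<- <-]|[<- <-]]; [|rewrite es]; apply: main.
Qed.

Lemma maximal_even j : k = j.+2 -> e (f 0) (f k) ->
  exists x : 'I_j.+3 -> 'I_n, [/\ injective x, forall a : 'I_j.+3, e (x a) (x (ordS a)) &
    forall (a : 'I_j.+3) y, e (x a) y ->
      y = x (ordS a) \/ exists2 b : 'I_j.+3, a = ordS b & y = x b].
Proof.
move=> kE ck; exists (fun a : 'I_j.+3 => f a).
have ak (a : 'I_j.+3) : (a <= k)%N by rewrite kE -ltnS.
have inj : injective (fun a : 'I_j.+3 => f a).
  by move=> a b /f_inj E; apply: ord_inj; apply: E.
have nS (a : 'I_j.+3) : e (f a) (f (ordS a)).
  have [lt|] := ltnP a k.
    have -> : ordS a = a.+1 :> nat by rewrite /= modn_small // ltnS; move: lt; rewrite kE.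
    exact: fS.
  move=> ka; have Ea : a = k :> nat by apply/eqP; rewrite eqn_leq ak ka.
  have -> : ordS a = 0%N :> nat by rewrite /= Ea kE modnn.
  by rewrite Ea es.
split=> // a y ey; have yw : y \in i :: w by apply: maximal_closed ey; apply: f_mem.
have [q qk yE] := mem_f yw; have q3 : (q < j.+3)%N by rewrite ltnS -kE.
pose b : 'I_j.+3 := Ordinal q3; have yb : y = f b by [].
have main (p r : 'I_j.+3) : (p < r)%N -> e (f p) (f r) -> r = ordS p \/ p = ordS r.
  move=> pr epr; case: (maximal_adjacent pr (ak r) epr) => [rE|[p0 rk]].
    by left; apply: ord_inj; rewrite /= modn_small -rE.
  by right; apply: ord_inj; rewrite /= rk kE modnn.
case: (ltngtP a b) => [lt|lt|Eab].
- rewrite yb in ey; case: (main a b lt ey) => E; first by left; rewrite yb E.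
  by right; exists b.
- rewrite yb es in ey; case: (main b a lt ey) => E; last by left; rewrite yb E.
  by right; exists b.
- by rewrite yb -Eab ei in ey.
Qed.

End MaximalPath.
End Components.

Theorem theorem3p14 (K : fieldType) (n : nat) (e : rel 'I_n) :
  simple_graph e ->
  (pure_resolution K e <-> complete_bipartite e \/ union_odd_cycles_paths e).
Proof.
move=> he; have [es ei] := he; split=> [pure|[[A [B [dAB _ _ eE]]]|hu]]; last 2 first.
- exact: complete_bipartite_pure dAB eE he.
- by have [m cm] := union_ci K es hu; apply: ci_pure cm.
case: (classic (exists v a b c, [/\ e v a, e v b, e v c & uniq [:: a; b; c]])).
  move=> [v [a [b [c [va vb vc]]]]]; rewrite /= !inE negb_or !andbT => /andP[/andP[ab ac] bc].
  have b35 := star_betti K he va vb vc ab ac bc.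
  by left; exact: (bipartite_of_betti35 he pure b35 va vb ab).
move=> n3; case: (classic (exists v w a b, [/\ e v a, e v b, e w a, e w b & (v != w) && (a != b)])).
  move=> [v [w [a [b [va vb wa wb /andP[vw ab]]]]]].
  have b35 := four_cycle_betti K he va vb wa wb vw ab.
  by left; exact: (bipartite_of_betti35 he pure b35 va vb ab).
move=> n4; right=> v.
have deg2 u a b c : e u a -> e u b -> e u c -> [\/ a = b, a = c | b = c].
  move=> ua ub uc; have [->|ab] := eqVneq a b; first by constructor 1.
  have [->|ac] := eqVneq a c; first by constructor 2.
  have [->|bc] := eqVneq b c; first by constructor 3.
  by case: n3; exists u, a, b, c; split=> //; rewrite /= !inE negb_or ab ac bc.
have [i [w [pw uw vw endi endl]]] := maximal_path he v.
case: (boolP ((1 < size w)%N && e i (nth i (i :: w) (size w)))) => [/andP[w1 cw]|nc]; last first.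
  by left; apply: (maximal_is_path he deg2 pw uw endi endl vw).
right; apply: (maximal_is_cycle he deg2 pw uw endi endl vw w1 cw).
apply/negP => ok; case Ew: (size w) w1 => [|[|j]] // _.
have [x [x_inj nbrS nbr_only]] := maximal_even he deg2 pw uw endi endl Ew cw.
have k_even : ~~ odd j.+3 by rewrite oddS -Ew ok.
have bk := even_cycle_betti K he x_inj k_even nbrS nbr_only.
have v1 : ordS (ord0 : 'I_j.+3) = 1%N :> nat by [].
have v2 : ordS (ordS (ord0 : 'I_j.+3)) = 2%N :> nat by rewrite /= !modn_small.
pose o1 : 'I_j.+3 := ordS ord0; pose o2 : 'I_j.+3 := ordS o1.
have e01 := nbrS ord0; have e12 := nbrS o1; rewrite -/o1 -/o2 in e01 e12.
have xne (a b : 'I_j.+3) : (a != b :> nat) -> x a != x b.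
  by apply: contra => /eqP /x_inj ->.
have j0 : j != 0%N by apply: contraTneq k_even => ->.
have n02 : ~~ e (x ord0) (x o2).
  apply/negP => /nbr_only [/x_inj /(congr1 (@nat_of_ord _))|[b b0 /x_inj E]].
    by rewrite v1 v2.
  have v3 : ordS o2 = 3 :> nat.
    by rewrite -[LHS]/((nat_of_ord o2).+1 %% j.+3)%N v2 modn_small // !ltnS lt0n.
  by have := congr1 (@nat_of_ord _) b0; rewrite -E v3.
have b24 : betti_nz K e 2 4.
  apply: (@induced_path3_betti K n e he (x ord0) (x o1) (x o2)) => //.
  by rewrite /= !inE negb_or !andbT !xne // ?v1 ?v2.
(* Purity in homological degree 2 leaves only length 4, and 4-cycles were excluded by [n4]. *)
have [j1] := pure_unique pure (i := 2) isT bk b24; subst j.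
pose o3 : 'I_4 := ordS o2; have e23 := nbrS o2; have e30 := nbrS o3.
have E30 : ordS o3 = ord0 by apply: ord_inj.
rewrite E30 in e30; apply: n4; exists (x ord0), (x o2), (x o1), (x o3); split=> //.
- by rewrite es.
- by rewrite es.
by rewrite !xne // ?v1 ?v2.
Qed.
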